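(* A graph $G$ is factor-critical, edge-critical equimatchable and has connectivity $2$ if and only if $G\in\mathcal{F}$, where $\mathcal{F}$ is the family of all graphs of Type I, II, III, IV or V.
   Context: Graphs are finite, simple and undirected. A matching is maximal if no other matching properly contains it. A graph is equimatchable if all its maximal matchings have the same cardinality. A graph $G$ is edge-critical equimatchable if $G$ is equimatchable and, for every edge $e$ of $G$, the graph $G\setminus e$ obtained by deleting $e$ (keeping all vertices) is not equimatchable. A graph $G$ is factor-critical if $G-v$ has a perfect matching for every $v\in V(G)$. The connectivity of a connected graph is the smallest $k$ such that some set of $k$ vertices disconnects it when removed. A set $X$ of vertices is complete to a set $Y$ if every vertex of $X$ is adjacent to every vertex of $Y$. For disjoint sets $X,Y$ with at least two vertices each, $X$ is partially-complete to $Y$ if there are a partition $X_1,X_2$ of $X$ into non-empty sets and a partition $Y_1,Y_2$ of $Y$ into non-empty sets such that, for $i=1,2$, $X_i$ is complete to $Y_i$ and no vertex of $X_i$ has a neighbour in $Y_{3-i}$. The types. In each type $V(G)$ is the disjoint union of $A$, $B$ and $S=\{s_1,s_2\}$, where $S$ is an independent set of two vertices, there is no edge between $A$ and $B$, and the only edges between $S$ and $A\cup B$ are the ones listed. Below, $A\cong H$ means that the subgraph induced by $A$ is isomorphic to $H$, and a $(q)$-stable set of $K_{q,q}$ is one of its two colour classes (the $(p+1)$-stable set of $K_{p,p+1}$ is its colour class of size $p+1$). Type I: $A\cong K_{2q}$, $B\cong K_{2p+1}$ with $p,q\ge 1$; $S$ is complete to $A$, and $S$ is partially-complete to $B$. Type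 II: $A\cong K_{q,q}$, $B\cong K_{2p+1}$ with $p,q\ge 1$; $s_1$ is complete to one $(q)$-stable set of $A$ and $s_2$ is complete to the other one (and each has no other neighbour in $A$); $S$ is partially-complete to $B$. Type III: $A\cong K_{2q}$, $B\cong K_{p,p+1}$ with $p,q\ge 1$; $S$ is complete to $A$, and $S$ is partially-complete to the $(p+1)$-stable set of $B$ (and has no neighbour in the $(p)$-stable set of $B$). Type IV: $A\cong K_{q,q}$, $B\cong K_{p,p+1}$ with $p,q\ge 1$; $s_1$ is complete to one $(q)$-stable set of $A$ and $s_2$ to the other one (and each has no other neighbour in $A$); $S$ is partially-complete to the $(p+1)$-stable set of $B$ (and has no neighbour in the $(p)$-stable set of $B$). Type V: $B=\{b\}$ is a single vertex, and $A$ contains three distinct vertices $a_1,a_2,w$ such that, for some $q\ge 3$, $A\setminus\{a_1,a_2\}$ induces $K_{2q-2}$ (so $w$ belongs to this clique), $\{a_1,a_2,w\}$ is an independent set, $\{a_1,a_2,w\}$ is complete to $A\setminus\{a_1,a_2,w\}$, and for $i=1,2$ the neighbourhood of $s_i$ is exactly $\{b,a_i,w\}$. *)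

(* Defs.v *)
From mathcomp Require Import all_boot.

Set Implicit Arguments.
Unset Strict Implicit.
Unset Printing Implicit Defensive.

(* A finite simple graph is a symmetric irreflexive [e : rel T] over a finType;
   an edge is identified with the two-element set of its ends. *)

Section Graph.
Variables (T : finType) (e : rel T).
Implicit Types (A X Y : {set T}) (M : {set {set T}}).

Definition edges : {set {set T}} :=
  [set E | [exists x, exists y, e x y && (E == [set x; y])]].

Definition matching M : bool := (M \subset edges) && trivIset M.

Definition maximal_matching M : bool := maxset matching M.

Definition equimatchable : Prop :=
  forall M M', maximal_matching M -> maximal_matching M' -> #|M| = #|M'|.

Definition del_edge (E : {set T}) : rel T :=
  [rel x y | e x y && ([set x; y] != E)].

(* The subgraph induced by [A] keeps the carrier [T], so its vertex set [A] has
   to be passed separately wherever it matters. *)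
Definition induced A : rel T := [rel x y | [&& x \in A, y \in A & e x y]].

Definition connected_on A : Prop :=
  {in A &, forall x y, connect (induced A) x y}.

Definition disconnects X : Prop := ~ connected_on (~: X).

(* A graph that no vertex set disconnects (a complete graph) has no
   connectivity in this sense. *)
Definition has_connectivity (k : nat) : Prop :=
  [/\ connected_on [set: T],
      exists2 X, disconnects X & #|X| = k
    & forall X, disconnects X -> k <= #|X|].

Definition complete_to X Y : Prop := {in X & Y, forall x y, e x y}.

Definition anticomplete_to X Y : Prop := {in X & Y, forall x y, ~~ e x y}.

Definition independent X : Prop := {in X &, forall x y, ~~ e x y}.

Definition neighbourhood v : {set T} := [set x | e v x].

Definition split_in_two X X1 X2 : Prop :=
  [/\ X1 != set0, X2 != set0, [disjoint X1 & X2] & X1 :|: X2 = X].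

Definition partially_complete_to X Y : Prop :=
  [/\ [disjoint X & Y], 2 <= #|X|, 2 <= #|Y|
    & exists X1 X2 Y1 Y2,
      [/\ split_in_two X X1 X2, split_in_two Y Y1 Y2,
          complete_to X1 Y1 /\ complete_to X2 Y2
        & anticomplete_to X1 Y2 /\ anticomplete_to X2 Y1]].

(* [f] is an isomorphism from the graph [h] onto the subgraph induced by [A]. *)
Definition iso_onto (U : finType) (h : rel U) A (f : U -> T) : Prop :=
  [/\ injective f, f @: [set: U] = A & forall u v, e (f u) (f v) = h u v].

Definition induces (U : finType) (h : rel U) A : Prop :=
  exists f : U -> T, iso_onto h A f.

End Graph.

(* [M] is a perfect matching of the graph obtained by deleting [v]. *)
Definition factor_critical (T : finType) (e : rel T) : Prop :=
  forall v : T, exists2 M : {set {set T}},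
    matching (induced e [set~ v]) M & cover M = [set~ v].

Definition edge_critical_equimatchable (T : finType) (e : rel T) : Prop :=
  equimatchable e /\
  forall E : {set T}, E \in edges e -> ~ equimatchable (del_edge e E).

Definition Kn (n : nat) : rel 'I_n := [rel i j | i != j].

Definition Kmn (m n : nat) : rel ('I_m + 'I_n) :=
  fun u v => match u, v with
             | inl _, inr _ | inr _, inl _ => true
             | _, _ => false
             end.

Arguments Kn n : clear implicits.
Arguments Kmn m n : clear implicits.

Section Family.
Variables (T : finType) (e : rel T).
Implicit Types (A B P Q : {set T}) (s a w b : T).

(* [A] induces K_{m,n}, with colour classes [P] (of size m) and [Q] (of size
   n). *)
Definition induces_Kmn (m n : nat) A P Q : Prop :=
  exists f : 'I_m + 'I_n -> T,
    [/\ iso_onto e (Kmn m n) A f,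
        P = [set f (inl i) | i : 'I_m] & Q = [set f (inr j) | j : 'I_n]].

Definition layout A B s1 s2 : Prop :=
  [/\ s1 != s2 /\ independent e [set s1; s2],
      [/\ [disjoint A & B], [disjoint A & [set s1; s2]]
        & [disjoint B & [set s1; s2]]],
      A :|: B :|: [set s1; s2] = [set: T]
    & anticomplete_to e A B].

Definition A_clique q A s1 s2 : Prop :=
  induces e (Kn (2 * q)) A /\ complete_to e [set s1; s2] A.

Definition A_biclique q A s1 s2 : Prop :=
  exists P Q, [/\ induces_Kmn q q A P Q,
    complete_to e [set s1] P, complete_to e [set s2] Q,
    anticomplete_to e [set s1] Q & anticomplete_to e [set s2] P].

Definition B_clique p B s1 s2 : Prop :=
  induces e (Kn (2 * p).+1) B /\ partially_complete_to e [set s1; s2] B.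

Definition B_biclique p B s1 s2 : Prop :=
  exists P Q, [/\ induces_Kmn p p.+1 B P Q,
    partially_complete_to e [set s1; s2] Q
  & anticomplete_to e [set s1; s2] P].

Definition typeI : Prop :=
  exists A B s1 s2 p q, [/\ 1 <= p, 1 <= q, layout A B s1 s2,
    A_clique q A s1 s2 & B_clique p B s1 s2].

Definition typeII : Prop :=
  exists A B s1 s2 p q, [/\ 1 <= p, 1 <= q, layout A B s1 s2,
    A_biclique q A s1 s2 & B_clique p B s1 s2].

Definition typeIII : Prop :=
  exists A B s1 s2 p q, [/\ 1 <= p, 1 <= q, layout A B s1 s2,
    A_clique q A s1 s2 & B_biclique p B s1 s2].

Definition typeIV : Prop :=
  exists A B s1 s2 p q, [/\ 1 <= p, 1 <= q, layout A B s1 s2,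
    A_biclique q A s1 s2 & B_biclique p B s1 s2].

Definition typeV : Prop :=
  exists A b s1 s2 a1 a2 w q,
    [/\ 3 <= q, layout A [set b] s1 s2,
        [set a1; a2; w] \subset A /\ uniq [:: a1; a2; w],
        [/\ induces e (Kn (2 * q - 2)) (A :\: [set a1; a2]),
            independent e [set a1; a2; w]
          & complete_to e [set a1; a2; w] (A :\: [set a1; a2; w])]
      & neighbourhood e s1 = [set b; a1; w] /\
        neighbourhood e s2 = [set b; a2; w]].

Definition family_F : Prop :=
  [\/ typeI, typeII, typeIII | typeIV \/ typeV].

End Family.

(* Main.v *)
Require Import Defs.
From mathcomp Require Import all_boot.
From mathcomp Require Import zify.

Set Implicit Arguments.
Unset Strict Implicit.
Unset Printing Implicit Defensive.

(* A factor-critical graph is equimatchable iff every independent set left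
   exposed by a matching is a singleton, and then an edge [u v] is critical iff
   for some [w] adjacent to neither end, deleting [u], [v] and [w] leaves a graph
   with a perfect matching. Let {s1, s2} be a cut, [B] the odd side and [A] the even
   one. Completing partial matchings of {s1, s2} shows that [A] and all [B - b],
   with [b] a neighbour of the cut, are randomly matchable when |B| >= 3; they are
   also connected, hence (Sumner) complete or balanced complete bipartite.
   Criticality of the edges at s1 and s2 then forces the adjacencies of types I
   to IV. If no 2-cut has |B| >= 3, then [B = {b}], every [A - x - y] with [x] a
   neighbour of s1 and [y] one of s2 is connected and randomly matchable, and
   comparing these graphs leaves only [A] complete minus a triangle (type V):
   when they are bipartite, an inner edge fails to be critical or two exposed
   vertices contradict equimatchability. *)

(** A factor-critical graph has odd order, so the two sides of a 2-cut have opposite parities, and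
    many contradictions are parity counts: an odd set without edges leaving it has no perfect
    matching. An odd side thus exposes a vertex whatever happens, and equimatchability leaves none
    for the other side; this is the source of random matchability. Adjacencies come from exchanges:
    in a randomly matchable graph, two vertices whose removal leaves a perfect matching must be
    adjacent. The case distinction is on the existence of any cut with an odd side of at least three
    vertices, not on the shape of a given cut. In its absence every 2-cut isolates a vertex, and
    this global fact yields the connectivity of the remainders of A. The obstacle there is that s1
    and s2 may share neighbours in A, so two neighbours of each, all distinct, need not exist;
    configurations with only two or three neighbours of the cut need arguments of their own. *)

(** * Elementary reasoning on sets *)

Lemma disjoint_notin (T : finType) (A B : {set T}) z :
  [disjoint A & B] -> z \in A -> z \notin B.
Proof. by move=> dAB zA; rewrite (disjointFr dAB zA). Qed.

Lemma disjoint_implyb (T : finType) (A B : {set T}) z :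
  [disjoint A & B] -> (z \in A) ==> (z \notin B).
Proof. by move=> /disjoint_notin H; apply/implyP/H. Qed.

Lemma subset_implyb (T : finType) (A B : {set T}) z :
  A \subset B -> (z \in A) ==> (z \in B).
Proof. by move=> /subsetP H; apply/implyP/H. Qed.

Lemma disjointI (T : finType) (A B : {set T}) :
  (forall z, z \in A -> z \in B -> false) -> [disjoint A & B].
Proof.
move=> H; rewrite disjoint_subset; apply/subsetP=> z zA.
by rewrite inE; apply/negP=> /(H _ zA).
Qed.

(* [sets] proves a statement about sets pointwise: the inclusions, equations and
   memberships in the context become booleans, split by cases. *)
Ltac harvest_sets x :=
  repeat match goal with
  | H : is_true (?A \subset ?B) |- _ => move: (subset_implyb x H); clear H
  | H : is_true (disjoint (mem ?A) (mem ?B)) |- _ =>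
      move: (disjoint_implyb x H); clear H
  | H : ?A = ?B |- _ =>
      move: (congr1 (fun S : {set _} => x \in S) H); clear H
  end; rewrite ?inE ?eqxx.

Ltac harvest_mem x :=
  repeat match goal with
  | H : is_true ?P |- _ =>
      match P with context [x] =>
        lazymatch P with
        | _ \in _ => revert H | ~~ (_ \in _) => revert H
        | _ == _ => revert H | ~~ (_ == _) => revert H
        end end
  end.

Ltac atoms :=
  rewrite /= ?inE ?eqxx /= ?andbT ?andbF ?orbT ?orbF ?implybT ?implybF /=; try done;
  lazymatch goal with
  | |- context [?a == ?b] =>
      rewrite ?(eq_sym b a); case: (a == b); atoms
  | |- context [?a \in ?b] => case: (a \in b); atoms
  end.

Ltac set_pt z :=
  rewrite ?eqxx;
  lazymatch goal with
  | |- context [z == ?x] =>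
      let E := fresh "E" in
      case: (eqVneq z x) => E;
        [ subst z; first [ harvest_mem x; atoms | set_pt x ] | set_pt z ]
  | |- context [?x == z] => rewrite (eq_sym x z); set_pt z
  | _ => harvest_mem z; atoms
  end.

Ltac sets :=
  intros;
  match goal with
  | |- is_true (_ \subset _) =>
      let z := fresh "z" in apply/subsetP=> z; harvest_sets z; set_pt z
  | |- is_true (disjoint _ _) =>
      let z := fresh "z" in apply: disjointI => z; harvest_sets z; set_pt z
  | |- _ = _ =>
      let z := fresh "z" in apply/setP=> z; harvest_sets z; set_pt z
  | |- is_true (~~ (?x == ?y)) =>
      first [ harvest_sets x; harvest_mem x; harvest_mem y; atoms
            | harvest_sets y; harvest_mem x; harvest_mem y; atoms
            | let E := fresh "E" in apply/eqP=> E;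
              first [ subst x; harvest_sets y; harvest_mem y; atoms
                    | subst y; harvest_sets x; harvest_mem x; atoms ] ]
  | |- is_true (?x \in _) =>
      harvest_sets x; first [ harvest_mem x; atoms | set_pt x | harvest_mem x; rewrite ?inE; set_pt x ]
  | |- is_true (~~ (?x \in _)) =>
      harvest_sets x; first [ harvest_mem x; atoms | set_pt x | harvest_mem x; rewrite ?inE; set_pt x ]
  end.

(* Membership and adjacency hypotheses slow [lia] down badly. *)
Ltac nlia :=
  repeat match goal with
  | H : ?P |- _ =>
      lazymatch P with
      | is_true (leq _ _) => fail
      | is_true (odd _) => fail
      | is_true (~~ odd _) => fail
      | is_true _ => clear H
      | _ -> _ => clear H
      | forall _, _ => clear H
      end
  end; lia.

(** * Perfect matchings of induced subgraphs *)

Section PM.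
Variables (T : finType) (e : rel T).
Hypotheses (e_sym : symmetric e) (e_irr : irreflexive e).
Implicit Types (X Y A B C P Q R U I : {set T}) (x y z u v w : T).

Lemma adj_neq x y : e x y -> x != y.
Proof. by apply: contraTneq => ->; rewrite e_irr. Qed.

(** Perfect matchability of G[X] with the matching itself forgotten, so that exchanges only add and
    remove pairs of vertices. *)
Inductive pm : {set T} -> Prop :=
| pm0 : pm set0
| pmU x y X : e x y -> x \notin X -> y \notin X -> pm X -> pm (x |: (y |: X)).

Lemma pm_add x y X :
  x \in X -> y \in X -> e x y -> pm (X :\ x :\ y) -> pm X.
Proof.
move=> xX yX xy pX; have nxy := adj_neq xy.
have -> : X = x |: (y |: (X :\ x :\ y)) by sets.
by apply: pmU => //; sets.
Qed.

(** Although a derivation of [pm] fixes an order of the pairs, any vertex can be taken off first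
    with its partner; exchange arguments start here. *)
Lemma pm_rem X x : pm X -> x \in X ->
  exists y, [/\ y \in X, e x y & pm (X :\ x :\ y)].
Proof.
move=> pX; elim: pX x => [|a b Y ab aY bY pY IH] x; first by rewrite inE.
have nab := adj_neq ab.
have [-> _|nxa] := eqVneq x a.
  exists b; split; [by sets|by []|].
  by have -> : (a |: (b |: Y)) :\ a :\ b = Y by sets.
have [-> _|nxb] := eqVneq x b.
  exists a; split; [by sets|by rewrite e_sym|].
  by have -> : (a |: (b |: Y)) :\ b :\ a = Y by sets.
rewrite !inE (negbTE nxa) (negbTE nxb) /= => xY.
have [y [yY xy pYxy]] := IH x xY; exists y; split=> //; first by sets.
have nay : a != y by apply: contraNneq aY => ->.
have nby : b != y by apply: contraNneq bY => ->.
have -> : (a |: (b |: Y)) :\ x :\ y = a |: (b |: (Y :\ x :\ y)) by sets.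
by apply: pmU => //; sets.
Qed.

Lemma pm_union X Y : [disjoint X & Y] -> pm X -> pm Y -> pm (X :|: Y).
Proof.
move=> + pX pY; elim: pX => [|a b X' ab aX bX pX' IH] dXY; first by rewrite set0U.
have aY : a \notin Y by apply: (disjoint_notin dXY); sets.
have bY : b \notin Y by apply: (disjoint_notin dXY); sets.
rewrite -!setUA; apply: pmU => //; [by sets|by sets|].
by apply: IH; sets.
Qed.

(** No matched pair crosses between C and the rest of X, so the pairs inside C suffice. Combined
    with parity, this forbids odd parts without edges leaving them. *)
Lemma pm_restrict X C : 
  {in X :&: C & X :\: C, forall x y, ~~ e x y} -> pm X -> pm (X :&: C).
Proof.
move=> + pX; elim: pX => [|a b Y ab aY bY pY IH] H; first by rewrite set0I; exact: pm0.
have nab := adj_neq ab.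
have {}IH : pm (Y :&: C).
  by apply: IH => x y; rewrite !inE => /andP[xY xC] /andP[yC yY];
     apply: H; rewrite !inE ?xY ?yY ?xC ?yC ?orbT.
have [aC|aC] := boolP (a \in C); have [bC|bC] := boolP (b \in C).
- have -> : (a |: (b |: Y)) :&: C = a |: (b |: (Y :&: C)) by sets.
  by apply: pmU => //; sets.
- by have := H a b; rewrite ab !inE !eqxx aC bC !orbT => /(_ isT isT).
- by have := H b a; rewrite e_sym ab !inE !eqxx aC bC !orbT => /(_ isT isT).
- by have -> : (a |: (b |: Y)) :&: C = Y :&: C by sets.
Qed.

Lemma card_U2 x y X : x != y -> x \notin X -> y \notin X ->
  #|x |: (y |: X)| = #|X|.+2.
Proof. by move=> nxy xX yX; rewrite !cardsU1 !inE negb_or nxy xX yX. Qed.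

Lemma pm_even X : pm X -> ~~ odd #|X|.
Proof.
elim=> [|a b Y ab aY bY pY IH]; first by rewrite cards0.
by rewrite card_U2 ?(adj_neq ab) //= negbK.
Qed.

Lemma card_rem2 X x y : x != y -> x \in X -> y \in X ->
  #|X :\ x :\ y|.+2 = #|X|.
Proof.
move=> nxy xX yX; rewrite (cardsD1 x X) (cardsD1 y (X :\ x)) xX.
by rewrite !inE eq_sym nxy yX.
Qed.

Lemma independentS X Y : X \subset Y -> independent e Y -> independent e X.
Proof. by move=> /subsetP XY iY x y /XY xY /XY; apply: iY. Qed.

(** Every matched pair contains at most one vertex of I. *)
Lemma pm_indep X I : pm X -> I \subset X -> independent e I ->
  #|I|.*2 <= #|X|.
Proof.
move=> pX; elim: pX I => [|a b Y ab aY bY pY IH] I sI iI.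
  by move: sI; rewrite subset0 => /eqP ->; rewrite cards0.
have nab := adj_neq ab.
rewrite card_U2 //.
have := IH (I :&: Y) (subsetIr _ _) (independentS (subsetIl _ _) iI).
suff : #|I| <= #|I :&: Y|.+1 by lia.
have [aI|aI] := boolP (a \in I).
  have bI : b \notin I by apply/negP=> bI; move: (iI a b aI bI); rewrite ab.
  have /(congr1 (fun S : {set T} => #|S|)) : I = a |: (I :&: Y) by sets.
  by rewrite cardsU1; lia.
have sI' : I \subset b |: (I :&: Y) by sets.
by apply: leq_trans (subset_leq_card sI') _; rewrite cardsU1; lia.
Qed.

Definition clique X : Prop := {in X &, forall x y, x != y -> e x y}.

Lemma cliqueS X Y : X \subset Y -> clique Y -> clique X.
Proof. by move=> /subsetP XY iY x y /XY xY /XY; apply: iY. Qed.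

Lemma pm_clique X : clique X -> ~~ odd #|X| -> pm X.
Proof.
move: {2}#|X| (leqnn #|X|) => n; elim: n X => [|n IH] X.
  by rewrite leqn0 cards_eq0 => /eqP -> _ _; exact: pm0.
move=> le kX evX; have [->|/set0Pn[x xX]] := eqVneq X set0; first exact: pm0.
have : #|X :\ x| != 0 by apply/eqP=> H; move: evX; rewrite (cardsD1 x) xX H.
rewrite cards_eq0 => /set0Pn[y]; rewrite !inE => /andP[nyx yX].
rewrite eq_sym in nyx.
have cXY := card_rem2 nyx xX yX.
apply: (pm_add xX yX); first exact: kX.
by apply: IH; [lia|apply: cliqueS kX; sets|move: evX; rewrite -cXY /= negbK].
Qed.

Lemma pm_bip P Q : complete_to e P Q -> [disjoint P & Q] -> #|P| = #|Q| ->
  pm (P :|: Q).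
Proof.
move: {2}#|P| (leqnn #|P|) => n; elim: n P Q => [|n IH] P Q.
  rewrite leqn0 => /eqP P0 _ _; rewrite P0 => /esym/eqP.
  move/eqP: P0; rewrite !cards_eq0 => /eqP-> /eqP->; rewrite setU0; exact: pm0.
move=> le cPQ dPQ eqc; have [P0|/set0Pn[x xP]] := eqVneq P set0.
  move/esym/eqP: eqc; rewrite P0 cards0 cards_eq0 => /eqP ->; rewrite setU0; exact: pm0.
have : 0 < #|Q| by rewrite -eqc card_gt0; apply/set0Pn; exists x.
rewrite card_gt0 => /set0Pn[y yQ].
have xQ := disjoint_notin dPQ xP.
have yP : y \notin P by rewrite (disjointFl dPQ yQ).
apply: (@pm_add x y); [by sets|by sets|exact: cPQ|].
have -> : (P :|: Q) :\ x :\ y = (P :\ x) :|: (Q :\ y).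
  by have nxy : x != y by [apply: contraNneq xQ => ->]; sets.
have cP := cardsD1 x P; have cQ := cardsD1 y Q; rewrite xP in cP; rewrite yQ in cQ.
apply: IH; [lia| |by sets|lia].
by move=> a b; rewrite !inE => /andP[_ aP] /andP[_ bQ]; apply: cPQ.
Qed.

(** Each class holds at most half of X and together they cover X, so each holds exactly half. *)
Lemma pm_bip_inv P Q X : independent e P -> independent e Q ->
  X \subset P :|: Q -> pm X -> #|X :&: P| = #|X :&: Q|.
Proof.
move=> iP iQ sX pX.
have h1 := pm_indep pX (subsetIl X P) (independentS (subsetIr X P) iP).
have h2 := pm_indep pX (subsetIl X Q) (independentS (subsetIr X Q) iQ).
have : #|X| <= #|X :&: P| + #|X :&: Q|.
  rewrite -cardsUI; apply: leq_trans (leq_addr _ _); apply: subset_leq_card.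
  by sets.
by lia.
Qed.

(** Greedy construction of a maximal matching; U is what it leaves exposed. *)
Lemma max_ext R : exists U, [/\ U \subset R, independent e U & pm (R :\: U)].
Proof.
move: {2}#|R| (leqnn #|R|) => n; elim: n R => [|n IH] R.
  rewrite leqn0 cards_eq0 => /eqP ->; exists set0; split; [by []|by move=> x y; rewrite inE|].
  by rewrite setD0; exact: pm0.
move=> le; have [|] := boolP [exists x, exists y, [&& x \in R, y \in R & e x y]].
  move=> /existsP[x /existsP[y /and3P[xR yR xy]]].
  have nxy := adj_neq xy; have c := card_rem2 nxy xR yR.
  have [|U [sU iU pU]] := IH (R :\ x :\ y); first lia.
  exists U; split=> //; first by sets.
  apply: (@pm_add x y _); [by sets|by sets|by []|].
  by have -> : (R :\: U) :\ x :\ y = R :\ x :\ y :\: U by sets.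
move=> H; exists R; split=> //; last by rewrite setDv; exact: pm0.
move=> x y xR yR; apply: contra H => xy.
by apply/existsP; exists x; apply/existsP; exists y; rewrite xR yR xy.
Qed.

End PM.

(** Puts the edge xy into the matching to be built and leaves the set without x and y; the adjacency
    may be known in either direction. *)
Ltac pmadd x y :=
  lazymatch goal with
  | Hs : symmetric ?e, Hi : irreflexive ?e |- pm ?e _ =>
      apply: (pm_add Hi (x := x) (y := y));
        [by sets|by sets|by rewrite // Hs|]
  end.

(** * Matchings as edge sets and the vertex sets they cover *)

Section Matching.
Variables (T : finType) (e : rel T).
Hypotheses (e_sym : symmetric e) (e_irr : irreflexive e).
Implicit Types (X Y A B C P Q U I : {set T}) (x y z u v w : T).
Implicit Types (M : {set {set T}}).

Lemma edgesP (f : rel T) E :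
  reflect (exists x y, f x y /\ E = [set x; y]) (E \in edges f).
Proof.
rewrite inE; apply: (iffP existsP) => [[x /existsP[y /andP[xy /eqP ->]]]|].
  by exists x, y.
by move=> [x [y [xy ->]]]; exists x; apply/existsP; exists y; rewrite xy /=.
Qed.

Lemma matchingU1 (f : rel T) M x y : matching f M -> f x y ->
  x \notin cover M -> y \notin cover M -> matching f ([set x; y] |: M).
Proof.
move=> /andP[sM tM] xy xM yM; apply/andP; split.
  rewrite subUset sM andbT sub1set; by apply/edgesP; exists x, y.
apply: (proj1 (trivIsetU1 _ tM _)).
  move=> E EM; apply: disjointI => z zxy zE.
  have zM : z \in cover M by apply/bigcupP; exists E.
  by move: zxy zM; rewrite !inE => /orP[] /eqP ->; rewrite ?(negbTE xM) ?(negbTE yM).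
apply/negP=> /(subsetP sM) /edgesP[a [b [_ E]]].
by have /setP/(_ a) := E; rewrite !inE eqxx.
Qed.

Lemma matching_pm M : matching e M -> pm e (cover M).
Proof.
move: {2}#|M| (leqnn #|M|) => n; elim: n M => [|n IH] M.
  by rewrite leqn0 cards_eq0 => /eqP -> _; rewrite /cover big_set0; exact: pm0.
move=> le /andP[sM tM]; have [->|/set0Pn[E EM]] := eqVneq M set0.
  by rewrite /cover big_set0; exact: pm0.
have /edgesP[x [y [xy dE]]] := subsetP sM E EM.
have tM' : trivIset (M :\ E) by apply: trivIsetS tM; exact: subD1set.
have H : pm e (cover (M :\ E)).
  apply: IH; first by move: le; rewrite (cardsD1 E) EM.
  by rewrite /matching tM' andbT; apply: subset_trans sM; exact: subD1set.
have dis z : z \in E -> z \notin cover (M :\ E).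
  move=> zE; apply/bigcupP => -[F]; rewrite !inE => /andP[nFE FM] zF.
  move/trivIsetP: tM => /(_ _ _ FM EM nFE) d.
  by have := disjoint_notin d zF; rewrite zE.
have -> : cover M = x |: (y |: cover (M :\ E)).
  by rewrite /cover (big_setD1 E EM) /= dE setUA.
by apply: pmU => //; apply: dis; rewrite dE !inE eqxx ?orbT.
Qed.

Lemma pm_matching X : pm e X -> 
  exists M, matching (induced e X) M /\ cover M = X.
Proof.
elim=> [|x y Y xy xY yY pY [M [/andP[sM tM] cM]]].
  exists set0; rewrite /matching sub0set /trivIset /cover !big_set0 cards0.
  by split.
exists ([set x; y] |: M); split; last first.
  have -> : x |: (y |: Y) = [set x; y] :|: Y by sets.
  by rewrite -cM /cover bigcup_setU big_set1.
apply: matchingU1; rewrite ?cM // /induced /=; last by rewrite !inE !eqxx xy ?orbT.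
apply/andP; split=> //.
apply/subsetP => E /(subsetP sM) /edgesP[a [b [/and3P[aY bY ab] ->]]].
by apply/edgesP; exists a, b; rewrite /induced /= !inE aY bY ab !orbT.
Qed.

Lemma matching_induced X M : matching (induced e X) M -> matching e M.
Proof.
move=> /andP[sM tM]; apply/andP; split=> //; apply: subset_trans sM _.
apply/subsetP => E /edgesP[a [b [/and3P[aY bY ab] ->]]].
by apply/edgesP; exists a, b.
Qed.

Lemma card_cover M : matching e M -> #|cover M| = #|M|.*2.
Proof.
move=> /andP[sM /eqP <-].
rewrite (eq_bigr (fun=> 2)) ?sum_nat_const ?muln2 // => E EM.
have /edgesP[x [y [xy ->]]] := subsetP sM E EM.
by rewrite cards2 (adj_neq e_irr xy).
Qed.

(** A larger matching contains an edge missed by M, whose ends are both exposed; conversely an edge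
    between exposed vertices could be added. *)
Lemma maximal_matchingP M : maximal_matching e M <->
  matching e M /\ independent e (~: cover M).
Proof.
split.
  case/maxsetP=> mM maxM; split=> // x y; rewrite !inE => xM yM.
  apply/negP=> xy; have [|N [mN cN]] := @pm_matching [set x; y].
    have -> : [set x; y] = x |: (y |: set0) by sets.
    by apply: pmU => //; rewrite ?inE // ; exact: pm0.
  suff /maxM : matching e ([set x; y] |: M).
    move=> /(_ (subsetUr _ _)) E; move/negP: xM; apply; rewrite -E.
    by apply/bigcupP; exists [set x; y]; rewrite !inE eqxx.
  exact: matchingU1.
case=> mM iM; apply/maxsetP; split=> // N /andP[sN tN] MN.
apply/eqP; rewrite eqEsubset MN andbT; apply/subsetP => E EN.
apply/negPn/negP=> nEM; have /edgesP[x [y [xy dE]]] := subsetP sN E EN.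
have H z : z \in E -> z \notin cover M.
  move=> zE; apply/bigcupP=> -[F FM zF].
  have nFE : F != E by apply: contraNneq nEM => <-.
  move/trivIsetP: tN => /(_ _ _ (subsetP MN _ FM) EN nFE) d.
  by have := disjoint_notin d zF; rewrite zE.
have := iM x y; rewrite !inE !H ?dE ?inE ?eqxx ?orbT // xy.
by move=> /(_ isT isT).
Qed.

(** Makes [pm] decidable, as the case distinctions on the existence of a perfect matching
    require. *)
Lemma pmP X : reflect (pm e X) [exists M, matching e M && (cover M == X)].
Proof.
apply: (iffP existsP) => [[M /andP[mM /eqP <-]]|]; first exact: matching_pm.
case/pm_matching=> M [/matching_induced mM cM]; by exists M; rewrite mM cM eqxx.
Qed.

(* Factor-criticality, equimatchability (given [fc]) and criticality of every
   edge, in terms of the sets of exposed vertices. Deleting [u v] creates a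
   maximal matching exposing exactly [u], [v] and one more vertex [w]. *)
Definition fc := forall v, pm e (~: [set v]).
Definition eqm := forall U, independent e U -> pm e (~: U) -> #|U| = 1.
Definition crit := forall u v, e u v -> exists w,
  [/\ w != u, w != v, ~~ e u w, ~~ e v w & pm e (~: [set u; v; w])].

Lemma independent1 v : independent e [set v].
Proof. by move=> x y /set1P -> /set1P ->; rewrite e_irr. Qed.

Lemma eqm_equimatchable : eqm -> equimatchable e.
Proof.
move=> H M N /maximal_matchingP[mM iM] /maximal_matchingP[mN iN].
have := H _ iM; have := H _ iN; rewrite !setCK.
move=> /(_ (matching_pm mN)) cN /(_ (matching_pm mM)) cM.
have := cardsC (cover M); have := cardsC (cover N).
rewrite cN cM !card_cover //; lia.
Qed.

(** The matching that misses only v is maximal and fixes the common size, so every maximal matching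
    misses exactly one vertex. *)
Lemma equimatchable_eqm v : pm e (~: [set v]) -> equimatchable e -> eqm.
Proof.
move=> /pm_matching[N [/matching_induced mN cN]] H U iU.
case/pm_matching=> M [/matching_induced mM cM].
have : #|M| = #|N|.
  apply: H; apply/maximal_matchingP; split=> //.
    by rewrite cM setCK.
  by rewrite cN setCK; exact: independent1.
move=> E; have := cardsC U; have := cardsC [set v]; rewrite cards1.
by rewrite -cM -cN !card_cover // E; lia.
Qed.

End Matching.

(** * Critical edges, and connectedness through closed sets *)

Section Critical.
Variables (T : finType) (e : rel T).
Hypotheses (e_sym : symmetric e) (e_irr : irreflexive e).
Implicit Types (X Y A B C P Q U I : {set T}) (x y z u v w : T).

Lemma pm_subrel (e' : rel T) X : subrel e' e -> pm e' X -> pm e X.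
Proof. by move=> s; elim=> [|x y Y /s xy xY yY _]; [exact: pm0|exact: pmU]. Qed.

Lemma del_edgeE E x y : del_edge e E x y = e x y && ([set x; y] != E).
Proof. by []. Qed.

Lemma del_sym u v : symmetric (del_edge e [set u; v]).
Proof. by move=> x y; rewrite /del_edge /= e_sym setUC. Qed.

Lemma del_irr u v : irreflexive (del_edge e [set u; v]).
Proof. by move=> x; rewrite /del_edge /= e_irr. Qed.

Lemma pm_del u v X : u \notin X -> pm e X -> pm (del_edge e [set u; v]) X.
Proof.
move=> + pX; elim: pX => [|x y Y xy xY yY pY IH]; first by move=> _; exact: pm0.
rewrite !inE !negb_or => /and3P[ux uy uY]; apply: pmU => //; last exact: IH.
rewrite del_edgeE xy /=; apply: contraNneq ux => E.
have : u \in [set x; y] by rewrite E !inE eqxx.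
by rewrite !inE (negbTE uy) orbF.
Qed.

Lemma fcP : factor_critical e <-> fc e.
Proof.
split=> H v.
  have [M mM <-] := H v; apply: matching_pm; exact: matching_induced mM.
by have [M [mM cM]] := pm_matching (H v); exists M.
Qed.

(** The matching missing only u survives the deletion, so the new graph is equimatchable iff all its
    maximal matchings miss one vertex. An exposed set that is independent only after the deletion
    contains u and v; putting uv back into the matching leaves exactly one exposed vertex, the
    witness w. *)
Lemma del_equimatchable u v : fc e -> eqm e -> e u v ->
  ~ equimatchable (del_edge e [set u; v]) <->
  exists w, [/\ w != u, w != v, ~~ e u w, ~~ e v w & pm e (~: [set u; v; w])].
Proof.
move=> FC EQ uv; set e' := del_edge _ _.
have s' : symmetric e' := @del_sym u v; have i' : irreflexive e' := @del_irr u v.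
have nuv := adj_neq e_irr uv.
split=> [H|[w [wu wv nuw nvw pw]] H]; last first.
  have := @equimatchable_eqm _ e' i' u _ H [set u; v; w] _ _.
  have c3 : #|[set u; v; w]| = 3.
    rewrite -setUA !cardsU1 cards1 !inE.
    by rewrite !negb_or nuv (eq_sym u w) wu (eq_sym v w) wv.
  rewrite c3 => H'; suff : 3 = 1 by []. apply: H'.
  - by apply: pm_del (FC u); rewrite !inE eqxx.
  - move=> x y; rewrite !inE => /orP[/orP[]|] /eqP -> /orP[/orP[]|] /eqP ->;
      rewrite /e' del_edgeE ?e_irr ?eqxx ?andbF // ?(setUC [set v]) ?eqxx ?andbF //;
      by rewrite ?(e_sym w) ?(negbTE nuw) ?(negbTE nvw).
  - by apply: pm_del pw; rewrite !inE eqxx.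
(* The search for the witness is boolean, so that its failure can be used as a hypothesis. *)
have [/existsP[w /and5P[? ? ? ? /pmP?]]|nw] :=
  boolP [exists w, [&& w != u, w != v, ~~ e u w, ~~ e v w &
   [exists M, matching e M && (cover M == (~: [set u; v; w]))]]]; first by exists w.
case: H; apply: eqm_equimatchable => // U iU pU.
have {}pU : pm e (~: U) by apply: pm_subrel pU => x y; rewrite /e' del_edgeE => /andP[].
have [/andP[uU vU]|nU] := boolP ((u \in U) && (v \in U)); last first.
  apply: EQ => // x y xU yU; apply: contra nU => xy.
  have := iU x y xU yU; rewrite /e' del_edgeE xy /= negbK => /eqP E.
  have : [set u; v] \subset U by rewrite -E; sets.
  by rewrite subUset !sub1set.
have iU' : independent e (U :\ u :\ v).
  move=> x y; rewrite !inE => /and3P[xv xu xU] /and3P[yv yu yU].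
  apply/negP=> xy; have := iU x y xU yU; rewrite /e' del_edgeE xy /= negbK => /eqP E.
  have : x \in [set u; v] by rewrite -E !inE eqxx.
  by rewrite !inE (negbTE xv) (negbTE xu).
(* In G the edge uv can be added to the matching, which then exposes U without u and v. *)
have : #|U :\ u :\ v| = 1.
  apply: EQ => //; apply: (@pm_add _ _ e_irr u v _) => //; [by sets|by sets|].
  by have -> : (~: (U :\ u :\ v)) :\ u :\ v = ~: U by sets.
move/eqP/cards1P=> [w Ew].
have : w \in U :\ u :\ v by rewrite Ew inE.
rewrite !inE => /and3P[wv wu wU].
have EU : U = [set u; v; w].
  by rewrite -(setD1K uU) -(@setD1K _ v (U :\ u)) ?Ew ?setUA // !inE vU eq_sym nuv.
case/existsP: nw; exists w; rewrite wu wv.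
apply/and5P; split=> //.
- apply/negP=> E; have := iU u w uU wU; rewrite /e' del_edgeE E /= negbK => /eqP E'.
  have : w \in [set u; v] by rewrite -E' !inE eqxx orbT.
  by rewrite !inE (negbTE wu) (negbTE wv).
- apply/negP=> E; have := iU v w vU wU; rewrite /e' del_edgeE E /= negbK => /eqP E'.
  have : w \in [set u; v] by rewrite -E' !inE eqxx orbT.
  by rewrite !inE (negbTE wu) (negbTE wv).
- by apply/pmP; rewrite -EU.
Qed.

Lemma edge_criticalP (x0 : T) : factor_critical e ->
  edge_critical_equimatchable e <-> eqm e /\ crit e.
Proof.
move=> /fcP FC; split=> [[H K]|[H K]].
  have EQ := equimatchable_eqm e_irr (FC x0) H; split=> // u v uv.
  by apply/del_equimatchable => //; apply: K; apply/edgesP; exists u, v.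
split; first exact: eqm_equimatchable.
by move=> E /edgesP[u [v [uv ->]]]; apply/del_equimatchable => //; exact: K.
Qed.

(** C is a union of components of G[X], possibly empty. *)
Definition closed_in X C := C \subset X /\ anticomplete_to e C (X :\: C).

Lemma not_connectedP X : ~ connected_on e X <->
  exists C, [/\ closed_in X C, C != set0 & C != X].
Proof.
split=> [H|[C [[sC aC] C0 CX]] H].
  have [/existsP[x /andP[xX /existsP[y /andP[yX nxy]]]]|H'] :=
    boolP [exists x, (x \in X) && [exists y, (y \in X) && ~~ connect (induced e X) x y]].
    exists [set z in X | connect (induced e X) x z]; split.
    - split; first by apply/subsetP=> z; rewrite inE => /andP[].
      move=> a b; rewrite !inE => /andP[aX xa] /andP[+ bX]; rewrite bX /=.
      apply: contra => ab; apply: connect_trans xa _; apply: connect1.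
      by rewrite /induced /= aX bX.
    - by apply/set0Pn; exists x; rewrite inE xX connect0.
    - by apply: contraNneq nxy => E; move: yX; rewrite -{1}E inE => /andP[].
  case: H => x y xX yX; apply/negPn/negP=> nxy; case/existsP: H'; exists x.
  by rewrite xX; apply/existsP; exists y; rewrite yX.
have /set0Pn[x xC] := C0.
have /subsetPn[y yX yC] : ~~ (X \subset C).
  by apply: contra CX => XC; rewrite eqEsubset sC XC.
have cl : closed (induced e X) (mem C).
  move=> a b /and3P[aX bX ab].
  have [aC'|aC'] := boolP (a \in C); have [bC'|bC'] := boolP (b \in C) => //.
    by have := aC a b aC'; rewrite inE bC' bX ab => /(_ isT).
  by have := aC b a bC'; rewrite inE aC' aX e_sym ab => /(_ isT).
have : (x \in C) = (y \in C) := closed_connect cl (H x y (subsetP sC x xC) yX).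
by rewrite xC (negbTE yC).
Qed.

End Critical.

(** * Randomly matchable graphs *)

Section RM.
Variables (T : finType) (e : rel T).
Hypotheses (e_sym : symmetric e) (e_irr : irreflexive e).
Implicit Types (X Y A B C P Q R U I W : {set T}) (x y z u v w : T).

Lemma pm_eq X Y : pm e X -> X = Y -> pm e Y.
Proof. by move=> + <-. Qed.

(* [R] is randomly matchable: [U] ranges over the sets left exposed by the
   maximal matchings of [G[R]]. *)
Definition rm R := forall U, U \subset R -> independent e U ->
  pm e (R :\: U) -> U = set0.

(** Connectedness of G[R] without paths: no proper non-empty union of components. *)
Definition conn R := forall C, closed_in e R C -> C != set0 -> C = R.

Definition bip P Q :=
  [/\ [disjoint P & Q], independent e P, independent e Q & complete_to e P Q].

Lemma rm_pm R : rm R -> pm e R.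
Proof.
move=> rR; have [U [sU iU pU]] := max_ext e_irr R.
by have E := rR U sU iU pU; rewrite E setD0 in pU.
Qed.

Lemma independent2 x y : ~~ e x y -> independent e [set x; y].
Proof.
move=> nxy a b; rewrite !inE => /orP[] /eqP -> /orP[] /eqP ->;
  by rewrite ?e_irr // e_sym.
Qed.

(** Otherwise a perfect matching of the rest would be maximal while exposing x and y. In use,
    matching edges are exchanged until only the two vertices remain. *)
Lemma rm_adj R x y : rm R -> x \in R -> y \in R -> x != y ->
  pm e (R :\ x :\ y) -> e x y.
Proof.
move=> rR xR yR nxy p; apply/negPn/negP=> nxy'.
suff /setP/(_ x) : [set x; y] = set0 by rewrite !inE eqxx.
apply: rR; [by sets|exact: independent2|].
by apply: (pm_eq p); sets.
Qed.

Lemma rm_rem R x y : rm R -> x \in R -> y \in R -> e x y -> rm (R :\ x :\ y).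
Proof.
move=> rR xR yR xy U sU iU pU; have nxy := adj_neq e_irr xy; apply: rR => //.
  by sets.
apply: (pm_add e_irr (x := x) (y := y)); [by sets|by sets|by []|].
by apply: (pm_eq pU); sets.
Qed.

Lemma rm_ext R x y : rm R -> x \in R -> y \in R -> e x y -> pm e (R :\ x :\ y).
Proof. by move=> rR xR yR xy; apply: rm_pm; exact: rm_rem. Qed.

(** Let t be the partner of z in a perfect matching through xy. Replacing xy and zt by yz leaves x
    and t, so these are adjacent and x, y, z, t form a 4-cycle. *)
Lemma rm_square R x y z : rm R -> x \in R -> y \in R -> z \in R ->
  e x y -> e y z -> x != z -> exists t,
  [/\ t \in R :\ x :\ y :\ z, e x t, e z t & pm e (R :\ x :\ y :\ z :\ t)].
Proof.
move=> rR xR yR zR xy yz nxz.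
have nxy := adj_neq e_irr xy; have nyz := adj_neq e_irr yz.
have zR' : z \in R :\ x :\ y by sets.
have [t [tR zt pt]] := pm_rem e_sym e_irr (rm_ext rR xR yR xy) zR'.
have nzt := adj_neq e_irr zt.
exists t; split=> //; first by sets.
apply: (rm_adj rR) => //; [by sets|by sets|].
pmadd y z; by apply: (pm_eq pt); sets.
Qed.

(** The vertices at distance at most two from x form a union of components: a path x, c, y, z
    leaving this set would make x adjacent to z after two exchanges. *)
Lemma rm_diam2 R x w : rm R -> conn R -> x \in R -> w \in R -> x != w ->
  ~~ e x w -> exists2 c, c \in R & e x c && e c w.
Proof.
move=> rR cR xR wR nxw nxw'.
pose C := [set z in R | [|| z == x, e x z | [exists c in R, e x c && e c z]]].
suff E : C = R.
  move: wR; rewrite -{1}E inE => /andP[wR]; rewrite eq_sym (negbTE nxw) (negbTE nxw') /=.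
  by case/existsP=> c /andP[cR' xcw]; exists c.
apply: cR; last by apply/set0Pn; exists x; rewrite inE xR eqxx.
split; first by apply/subsetP=> z; rewrite inE => /andP[].
move=> y z; rewrite !inE => /andP[yR yC] /andP[+ zR]; rewrite zR /=.
rewrite !negb_or => /and3P[nzx nxz /existsPn nz]; apply/negP=> yz.
have [yx|nyx] := eqVneq y x; first by move: nxz; rewrite -yx yz.
have nxy : ~~ e x y by apply/negP=> xy; have := nz y; rewrite yR xy yz.
move: yC; rewrite (negbTE nyx) (negbTE nxy) /=; case/existsP=> c /and3P[cR xc cy].
have ncz : c != z by apply: contraNneq nxz => <-.
rewrite eq_sym in nyx.
(* Let zr be a matching edge outside the 4-cycle x, c, y, t. The edges xc and yz leave t and r, and
   then cy and tr leave x and z. *)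
have [t [tR xt yt pt]] := rm_square rR xR cR yR xc cy nyx.
have ntz : t != z by apply: contraNneq nxz => <-.
have nyz := adj_neq e_irr yz.
have zR' : z \in R :\ x :\ c :\ y :\ t by sets.
have [r [rR' zr pr]] := pm_rem e_sym e_irr pt zR'.
have nxc := adj_neq e_irr xc; have nzr := adj_neq e_irr zr; have ncy := adj_neq e_irr cy.
have tr : e t r.
  apply: (rm_adj rR); [by sets|by sets|by sets|].
  pmadd x c; pmadd y z; by apply: (pm_eq pr); sets.
have : e x z; last by rewrite (negbTE nxz).
  apply: (rm_adj rR) => //; [by sets|].
  pmadd c y; pmadd t r; by apply: (pm_eq pr); sets.
Qed.

(** For two edges uu' and vv' of a perfect matching, u sees an end of the second: a common neighbour
    c of u and v outside the two edges is used together with its own partner c' for two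
    exchanges. *)
Lemma rm_near R u u' v v' : rm R -> conn R ->
  u \in R -> u' \in R :\ u -> v \in R :\ u :\ u' -> v' \in R :\ u :\ u' :\ v ->
  e u u' -> e v v' -> pm e (R :\ u :\ u' :\ v :\ v') -> e u v || e u v'.
Proof.
move=> rR cR uR u'R vR v'R uu' vv' p.
have [//|nuv /=] := boolP (e u v).
have [||c cR' /andP[uc cv]] := rm_diam2 rR cR uR _ _ nuv; [by sets|by sets|].
have [E|ncu'] := eqVneq c u'.
  apply: (rm_adj rR) => //; [by sets|by sets|].
  rewrite E in cv; pmadd u' v; by apply: (pm_eq p); sets.
have [E|ncv'] := eqVneq c v'; first by rewrite -E.
have ncu := adj_neq e_irr uc; have ncv := adj_neq e_irr cv.
have cW : c \in R :\ u :\ u' :\ v :\ v' by sets.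
have [c' [c'R cc' p']] := pm_rem e_sym e_irr p cW.
have ncc' := adj_neq e_irr cc'.
have u'c' : e u' c'.
  apply: (rm_adj rR); [by sets|by sets|by sets|].
  pmadd u c; pmadd v v'; by apply: (pm_eq p'); sets.
apply: (rm_adj rR) => //; [by sets|by sets|].
pmadd u' c'; pmadd c v; by apply: (pm_eq p'); sets.
Qed.

(** The two non-adjacent vertices lie on a 4-cycle x, y, z, t whose complement W is again randomly
    matchable. Exchanges along the cycle decide how each vertex of W attaches to it, exactly as in a
    complete bipartite graph. *)
Lemma rm_conn_bip R x z : rm R -> conn R -> x \in R -> z \in R -> x != z ->
  ~~ e x z -> bip [set w in R | ~~ e x w] [set w in R | e x w].
Proof.
move=> rR cR xR zR nxz nxz'.
have [y yR /andP[xy yz]] := rm_diam2 rR cR xR zR nxz nxz'.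
have [t [tR xt zt pW]] := rm_square rR xR yR zR xy yz nxz.
have nxy := adj_neq e_irr xy; have nyz := adj_neq e_irr yz.
set W := R :\ x :\ y :\ z :\ t in pW.
have nyt : ~~ e y t.
  apply: contra nxz' => yt; apply: (rm_adj rR) => //.
  pmadd y t; by apply: (pm_eq pW); sets.
(* If w is adjacent to x, then w joins the class of y and t, and its partner w' the class of x and
   z. *)
have one w w' : w \in W -> w' \in W -> e w w' -> pm e (W :\ w :\ w') -> 
    e x w -> [/\ e z w, e y w', e t w' & ~~ e x w'].
  move=> wW w'W ww' p xw; have nww' := adj_neq e_irr ww'.
  have yw' : e y w'.
    apply: (rm_adj rR); rewrite /W in wW w'W *; [by sets|by sets|by sets|].
    pmadd x w; pmadd z t; by apply: (pm_eq p); rewrite /W; sets.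
  have tw' : e t w'.
    apply: (rm_adj rR); rewrite /W in wW w'W *; [by sets|by sets|by sets|].
    pmadd x w; pmadd y z; by apply: (pm_eq p); rewrite /W; sets.
  have zw : e z w.
    apply: (rm_adj rR); rewrite /W in wW w'W *; [by sets|by sets|by sets|].
    pmadd x t; pmadd y w'; by apply: (pm_eq p); rewrite /W; sets.
  split=> //; apply: contra nyt => xw'.
  apply: (rm_adj rR); rewrite /W in wW w'W *; [by sets|by sets|by sets|].
  pmadd x w'; pmadd z w; by apply: (pm_eq p); rewrite /W; sets.
have rW : rm W.
  have -> : W = R :\ x :\ y :\ z :\ t by [].
  have rxy := rm_rem rR xR yR xy.
  by apply: rm_rem => //; sets.
have near w w' : w \in W -> w' \in W -> e w w' -> pm e (W :\ w :\ w') -> 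
    e x w || e x w'.
  move=> wW w'W ww' p; have nww' := adj_neq e_irr ww'.
  rewrite /W in wW w'W; apply: (@rm_near R x y w w'); [by []|by []|by []|by sets|by sets|by sets|by []|by []|].
  pmadd z t; by apply: (pm_eq p); rewrite /W; sets.
have partner w : w \in W -> exists w', [/\ w' \in W, e w w' & pm e (W :\ w :\ w')].
  exact: pm_rem.
have inP w : w \in W -> ~~ e x w -> [/\ e y w, e t w & ~~ e z w].
  move=> wW nxw; have [w' [w'W ww' p]] := partner w wW.
  have := near w w' wW w'W ww' p; rewrite (negbTE nxw) /= => xw'.
  have [||_ yw tw _] := one w' w w'W wW _ _ xw'.
  - by rewrite e_sym.
  - by apply: (pm_eq p); sets.
  split=> //; apply: contra nyt => zw.
  have nww' := adj_neq e_irr ww'.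
  apply: (rm_adj rR); rewrite /W in wW w'W *; [by sets|by sets|by sets|].
  pmadd x w'; pmadd z w; by apply: (pm_eq p); sets.
have inQ w : w \in W -> e x w -> [/\ e z w, ~~ e y w & ~~ e t w].
  move=> wW xw; have [w' [w'W ww' p]] := partner w wW.
  have [zw yw' tw' nxw'] := one w w' wW w'W ww' p xw.
  have nww' := adj_neq e_irr ww'.
  split=> //; apply: contra nxw' => ?;
    apply: (rm_adj rR); rewrite /W in wW w'W *; [by sets|by sets|by sets| |by sets|by sets|by sets|].
    by pmadd y w; pmadd z t; apply: (pm_eq p); sets.
  by pmadd t w; pmadd y z; apply: (pm_eq p); sets.
have caseR w : w \in R -> [\/ w = x, w = y, w = z | w = t \/ w \in W].
  move=> wR; have [->|n1] := eqVneq w x; first by constructor 1.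
  have [->|n2] := eqVneq w y; first by constructor 2.
  have [->|n3] := eqVneq w z; first by constructor 3.
  have [->|n4] := eqVneq w t; first by constructor 4; left.
  by constructor 4; right; rewrite /W; sets.
have P_W w : w \in R -> ~~ e x w -> [\/ w = x, w = z | w \in W].
  case/caseR => [->|->|->|[->|wW]]; rewrite ?xy ?xt //; by [constructor 1|constructor 2|constructor 3].
have Q_W w : w \in R -> e x w -> [\/ w = y, w = t | w \in W].
  case/caseR => [->|->|->|[->|wW]]; rewrite ?e_irr ?(negbTE nxz') //; by [constructor 1|constructor 2|constructor 3].
have iP : independent e [set w in R | ~~ e x w].
  move=> a b; rewrite !inE => /andP[aR xa] /andP[bR xb].
  case: (P_W a aR xa) => [->|->|aW]; case: (P_W b bR xb) => [->|->|bW];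
    rewrite ?e_irr // ?(e_sym _ x) //; rewrite 1?(e_sym _ z);
    try by [case: (inP _ aW xa)|case: (inP _ bW xb)].
  apply/negP=> ab; have := near a b aW bW ab (rm_ext rW aW bW ab).
  by rewrite (negbTE xa) (negbTE xb).
split=> //.
- by apply: disjointI => w; rewrite !inE => /andP[_ /negbTE ->]; rewrite andbF.
- move=> a b; rewrite !inE => /andP[aR xa] /andP[bR xb].
  case: (Q_W a aR xa) => [->|->|aW]; case: (Q_W b bR xb) => [->|->|bW];
    rewrite ?e_irr // ?(e_sym t y) //;
    try by [case: (inQ _ bW xb)|rewrite e_sym; case: (inQ _ aW xa)].
  apply/negP=> ab; have [_ _ _] := one a b aW bW ab (rm_ext rW aW bW ab) xa.
  by rewrite xb.
- move=> a b; rewrite !inE => /andP[aR xa] /andP[bR xb].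
  case: (P_W a aR xa) => [->//|->|aW]; case: (Q_W b bR xb) => [->|->|bW] //;
    try by [rewrite e_sym|case: (inQ _ bW xb)|rewrite e_sym; case: (inP _ aW xa)].
  (* The partner b' of b belongs with a to the non-neighbours of x, so if ab is missing [rm_near]
     has no adjacency left to give between a and the edge bb'. *)
  apply/negPn/negP=> nab.
  have [a' [a'W aa' p]] := partner a aW.
  have naa' := adj_neq e_irr aa'.
  have nba' : b != a' by apply: contraNneq nab => ->.
  have nba : b != a by apply: contraTneq xb => ->.
  have bW' : b \in W :\ a :\ a' by sets.
  have [b' [b'W bb' p']] := pm_rem e_sym e_irr p bW'.
  have nbb' := adj_neq e_irr bb'.
  have b'W' : b' \in W by sets.
  have pbb' : pm e (W :\ b :\ b').
    by pmadd a a'; apply: (pm_eq p'); sets.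
  have [_ _ _ xb'] := one b b' bW b'W' bb' pbb' xb.
  have b'R : b' \in R by move: b'W'; rewrite /W !inE => /and5P[].
  have := iP a b'; rewrite !inE aR xa b'R xb' => /(_ isT isT)/negbTE nab'.
  have : e a b || e a b'; last by rewrite (negbTE nab) nab'.
  rewrite /W in aW a'W bW b'W'.
  apply: (@rm_near R a a' b b'); [by []|by []|by []|by sets|by sets|by sets|by []|by []|].
  pmadd x y; pmadd z t; by apply: (pm_eq p'); rewrite /W; sets.
Qed.

Lemma sumner R : rm R -> conn R -> clique e R \/
  exists P Q, [/\ bip P Q, R = P :|: Q & #|P| = #|Q|].
Proof.
move=> rR cR.
have [/existsP[x /existsP[z /and4P[xR zR nxz nxz']]]|H] :=
  boolP [exists x, exists z, [&& x \in R, z \in R, x != z & ~~ e x z]].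
  right; exists [set w in R | ~~ e x w], [set w in R | e x w].
  have b := rm_conn_bip rR cR xR zR nxz nxz'.
  have E : R = [set w in R | ~~ e x w] :|: [set w in R | e x w].
    by apply/setP=> w; rewrite !inE; case: (w \in R) => //=; case: (e x w).
  split=> //; case: b => _ iP iQ _.
  have sR : R \subset [set w in R | ~~ e x w] :|: [set w in R | e x w].
    by rewrite -E.
  have := pm_bip_inv e_irr iP iQ sR (rm_pm rR).
  by rewrite !(setIidPr _) //; apply/subsetP=> w; rewrite inE => /andP[].
left=> x z xR zR nxz; apply/negPn/negP=> nxz'; case/negP: H.
by apply/existsP; exists x; apply/existsP; exists z; rewrite xR zR nxz.
Qed.

End RM.

(** * Cuts of two vertices *)

Section Cut.
Variables (T : finType) (e : rel T).
Hypotheses (e_sym : symmetric e) (e_irr : irreflexive e).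
Implicit Types (X Y A B C D P Q R U I W : {set T}) (x y z u v w : T).
Hypotheses (FC : fc e) (EQ : eqm e) (CR : crit e).
Hypothesis TC : forall v, conn e (~: [set v]).

(** B is the odd side; in a factor-critical graph A is then even. The sides are unions of components
    and need not be connected. *)
Definition cut s1 s2 A B :=
  [/\ s1 != s2, A :|: B = ~: [set s1; s2], [disjoint A & B],
      anticomplete_to e A B & A != set0 /\ odd #|B|].

Lemma cut_sym s1 s2 A B : cut s1 s2 A B -> cut s2 s1 A B.
Proof. by case=> *; split=> //; rewrite 1?eq_sym 1?(setUC [set s2]). Qed.

Lemma pm_odd X : odd #|X| -> pm e X -> False.
Proof. by move=> o /(pm_even e_irr); rewrite o. Qed.

Lemma odd_rem1 X x : x \in X -> odd #|X :\ x| = ~~ odd #|X|.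
Proof. by move=> xX; rewrite (cardsD1 x X) xX /= negbK. Qed.

Lemma independent3 x y z : ~~ e x y -> ~~ e x z -> ~~ e y z ->
  independent e [set x; y; z].
Proof.
move=> xy xz yz a b; rewrite !inE.
move=> /orP[/orP[]|] /eqP -> /orP[/orP[]|] /eqP ->;
  by rewrite ?e_irr // e_sym.
Qed.

Lemma cards3 x y z : x != y -> x != z -> y != z -> #|[set x; y; z]| = 3.
Proof.
move=> xy xz yz; rewrite -setUA !cardsU1 cards1 !inE.
by rewrite !negb_or xy xz yz.
Qed.

Lemma no_exposed_triple x y z : x != y -> x != z -> y != z ->
  ~~ e x y -> ~~ e x z -> ~~ e y z -> pm e (~: [set x; y; z]) -> False.
Proof.
move=> nxy nxz nyz xy xz yz p.
by have := EQ (independent3 xy xz yz) p; rewrite cards3.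
Qed.

(** Every maximal matching of the odd graph G[Y] exposes a vertex. Together with the set exposed in
    X this must be a single vertex, so X exposes none. *)
Lemma eq_split X Y : [disjoint X & Y] -> anticomplete_to e X Y ->
  pm e (~: (X :|: Y)) -> odd #|Y| -> rm e X.
Proof.
move=> dXY aXY pXY oY U sU iU pU.
have [V [sV iV pV]] := max_ext e_irr Y.
have H : #|U :|: V| = 1.
  apply: EQ => [x y|].
    rewrite !inE => /orP[xU|xV] /orP[yU|yV]; [exact: iU| | |exact: iV].
      by apply: aXY; [apply: (subsetP sU)|apply: (subsetP sV)].
    by rewrite e_sym; apply: aXY; [apply: (subsetP sU)|apply: (subsetP sV)].
  have -> : ~: (U :|: V) = ~: (X :|: Y) :|: ((X :\: U) :|: (Y :\: V)) by sets.
  by apply: pm_union => //; [sets|apply: pm_union => //; sets].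
have dUV : [disjoint U & V] by sets.
have : V != set0.
  by apply/eqP=> V0; apply: (pm_odd oY); rewrite V0 setD0 in pV.
rewrite -card_gt0 => V0; apply/eqP; rewrite -cards_eq0.
by move: H; rewrite cardsU disjoint_setI0 // cards0; lia.
Qed.

Section Facts.
Variables (s1 s2 : T) (A B : {set T}).
Hypothesis cutAB : cut s1 s2 A B.
Let n12 : s1 != s2. Proof. by case: cutAB. Qed.
Let AB : A :|: B = ~: [set s1; s2]. Proof. by case: cutAB. Qed.
Let dAB : [disjoint A & B]. Proof. by case: cutAB. Qed.
Let aAB : anticomplete_to e A B. Proof. by case: cutAB. Qed.
Let A0 : A != set0. Proof. by case: cutAB => ? ? ? ? []. Qed.
Let oB : odd #|B|. Proof. by case: cutAB => ? ? ? ? []. Qed.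

Lemma cut_case x : [\/ x = s1, x = s2, x \in A | x \in B].
Proof.
have [->|n1] := eqVneq x s1; first by constructor 1.
have [->|n2] := eqVneq x s2; first by constructor 2.
have : x \in A :|: B by rewrite AB; sets.
by rewrite inE => /orP[]; [constructor 3|constructor 4].
Qed.

Lemma cut_restrict X : s1 \notin X -> s2 \notin X -> pm e X ->
  pm e (X :&: A) /\ pm e (X :&: B).
Proof.
move=> s1X s2X pX; split; apply: (pm_restrict e_sym) pX => // x y.
  rewrite !inE => /andP[xX xA] /andP[yA yX]; apply: aAB => //.
  by sets.
rewrite !inE => /andP[xX xB] /andP[yB yX]; rewrite e_sym; apply: aAB => //.
by sets.
Qed.

(** In a matching missing only s1, the odd side B needs s2 as a partner, so A is matched within
    itself. *)
Lemma cut_pmA : pm e A.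
Proof.
have s2X : s2 \in ~: [set s1] by sets.
have [t [tX s2t p]] := pm_rem e_sym e_irr (FC s1) s2X.
have n2t := adj_neq e_irr s2t.
have [||pA pB] := cut_restrict _ _ p; [by sets|by sets|].
have [E|E|tA|tB] := cut_case t; [by move: tX; rewrite E !inE eqxx|by move: n2t; rewrite E eqxx| |].
  by case: (pm_odd oB); apply: (pm_eq pB); sets.
by apply: (pm_eq pA); sets.
Qed.

Lemma cut_evA : ~~ odd #|A|.
Proof. exact: pm_even cut_pmA. Qed.

Lemma cut_A2 : 2 <= #|A|.
Proof. by move: A0 cut_evA; rewrite -card_gt0; case: #|A| => [|[|]]. Qed.

(** Otherwise s2 alone would separate C from s1. *)
Lemma cut_attach C : closed_in e (~: [set s1; s2]) C -> C != set0 ->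
  exists2 c, c \in C & e s1 c.
Proof.
case=> sC aC C0.
have [/existsP[c /andP[cC s1c]]|H] := boolP [exists c, (c \in C) && e s1 c]; first by exists c.
have s1C : s1 \notin C by sets.
case/negP: s1C.
suff -> : C = ~: [set s2] by sets.
apply: TC => //; split; first by sets.
move=> c d cC; rewrite !inE => /andP[dC d2].
have [->|nd1] := eqVneq d s1.
  by apply: contra H => cs; apply/existsP; exists c; rewrite cC e_sym.
by apply: aC => //; sets.
Qed.

Lemma closed_in_cut C : closed_in e A C \/ closed_in e B C ->
  closed_in e (~: [set s1; s2]) C.
Proof.
case=> -[sC aC]; split; [by sets| |by sets|]; move=> c d cC dC.
  have [dA|dA] := boolP (d \in A); first by apply: aC => //; sets.
  by apply: aAB; [apply: (subsetP sC)|sets].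
have [dB|dB] := boolP (d \in B); first by apply: aC => //; sets.
by rewrite e_sym; apply: aAB; [sets|apply: (subsetP sC)].
Qed.

Lemma closed_in_refl X : closed_in e X X.
Proof. by split=> // x y _; rewrite setDv inE. Qed.

End Facts.

(** Without distinct representatives a single vertex of C carries all edges to the cut, and it
    separates the rest of C from s1. *)
Lemma cut_two s1 s2 A B C : cut s1 s2 A B ->
  closed_in e (~: [set s1; s2]) C -> 2 <= #|C| ->
  exists c1 c2, [/\ c1 \in C, c2 \in C, c1 != c2, e s1 c1 & e s2 c2].
Proof.
move=> cutAB cC C2; have C0 : C != set0 by rewrite -card_gt0; lia.
have [c1 c1C s1c1] := cut_attach cutAB cC C0.
have cC' : closed_in e (~: [set s2; s1]) C by rewrite setUC.
have [c2 c2C s2c2] := cut_attach (cut_sym cutAB) cC' C0.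
have [E|nE] := eqVneq c1 c2; last by exists c1, c2.
rewrite -{}E in s2c2 c2C *.
have [/existsP[x /andP[+ /orP[s1x|s2x]]]|H] :=
  boolP [exists x, (x \in C :\ c1) && (e s1 x || e s2 x)].
- by rewrite !inE => /andP[nx xC]; exists x, c1.
- by rewrite !inE => /andP[nx xC]; exists c1, x; split=> //; rewrite eq_sym.
have [n12 _ _ _ _] := cutAB; case: cC => sC aC.
have s1C : s1 \notin C by sets.
have s1c : s1 != c1 by apply: contraNneq s1C => ->.
have : s1 \in ~: [set c1] by sets.
have <- : C :\ c1 = ~: [set c1]; last by rewrite !inE (negbTE s1C) andbF.
apply: TC; last first.
  by rewrite -card_gt0; move: C2; rewrite (cardsD1 c1) c1C.
split; first by sets.
move=> c d cC; rewrite !inE => /andP[dC dc]; rewrite dc /= in dC.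
have nad : ~~ (e s1 c || e s2 c).
  by apply: contra H => nad; apply/existsP; exists c; rewrite cC.
rewrite negb_or in nad; case/andP: nad => n1 n2.
have [->|nd1] := eqVneq d s1; first by rewrite e_sym.
have [->|nd2] := eqVneq d s2; first by rewrite e_sym.
by apply: aC; sets.
Qed.

Lemma cut_twoA s1 s2 A B : cut s1 s2 A B ->
  exists a1 a2, [/\ a1 \in A, a2 \in A, a1 != a2, e s1 a1 & e s2 a2].
Proof.
move=> c; apply: (cut_two c); last exact: (cut_A2 c).
by apply: (closed_in_cut c); left; exact: closed_in_refl.
Qed.

Lemma cut_twoB s1 s2 A B : cut s1 s2 A B -> 3 <= #|B| ->
  exists b1 b2, [/\ b1 \in B, b2 \in B, b1 != b2, e s1 b1 & e s2 b2].
Proof.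
move=> c B3; apply: (cut_two c); last exact: ltnW.
by apply: (closed_in_cut c); right; exact: closed_in_refl.
Qed.

Lemma odd_rem2 X x y : x \in X -> y \in X -> x != y ->
  odd #|X :\ x :\ y| = odd #|X|.
Proof.
by move=> xX yX nxy; rewrite !odd_rem1 ?negbK // !inE eq_sym nxy.
Qed.

Lemma anticompleteS X Y X' Y' : X' \subset X -> Y' \subset Y ->
  anticomplete_to e X Y -> anticomplete_to e X' Y'.
Proof. by move=> /subsetP sX /subsetP sY a x y /sX xX /sY; apply: a. Qed.

Lemma anticomplete_sym X Y : anticomplete_to e X Y -> anticomplete_to e Y X.
Proof. by move=> a x y xY yX; rewrite e_sym; apply: a. Qed.

(** The odd set that absorbs the exposed vertex is B without b1 and b2, which are matched to the
    cut. *)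
Lemma cut_rmA s1 s2 A B : cut s1 s2 A B -> 3 <= #|B| -> rm e A.
Proof.
move=> c B3; have [b1 [b2 [b1B b2B nb s1b1 s2b2]]] := cut_twoB c B3.
have [n12 AB dAB aAB [_ oB]] := c.
apply: (@eq_split A (B :\ b1 :\ b2)); [by sets| | |by rewrite odd_rem2].
  by apply: anticompleteS aAB => //; sets.
pmadd s1 b1; pmadd s2 b2; by apply: (pm_eq (pm0 e)); sets.
Qed.

(* [s1 a1] and [s2 a2] in the matching leave the odd set [B] an exposed vertex,
   hence none to [A :\ a1 :\ a2]. *)
Lemma cut_rmAaa s1 s2 A B a1 a2 : cut s1 s2 A B -> a1 \in A -> a2 \in A ->
  a1 != a2 -> e s1 a1 -> e s2 a2 -> rm e (A :\ a1 :\ a2).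
Proof.
move=> [n12 AB dAB aAB [_ oB]] a1A a2A na s1a1 s2a2.
apply: (@eq_split _ B); [by sets| | |by []].
  by apply: anticompleteS aAB => //; sets.
pmadd s1 a1; pmadd s2 a2; by apply: (pm_eq (pm0 e)); sets.
Qed.

(** Here s2 takes one vertex of the even side A, and the odd remainder of A absorbs the exposed
    vertex. *)
Lemma cut_rmBb1 s1 s2 A B b : cut s1 s2 A B -> b \in B -> e s1 b ->
  rm e (B :\ b).
Proof.
move=> c bB s1b; have [a1 [a2 [a1A a2A na s1a1 s2a2]]] := cut_twoA c.
have evA := cut_evA c; have [n12 AB dAB aAB [_ oB]] := c.
apply: (@eq_split _ (A :\ a2)); [by sets| | |by rewrite odd_rem1].
  by apply: anticompleteS (anticomplete_sym aAB) => //; sets.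
pmadd s1 b; pmadd s2 a2; by apply: (pm_eq (pm0 e)); sets.
Qed.

Lemma cut_rmBb s1 s2 A B b : cut s1 s2 A B -> b \in B -> e s1 b || e s2 b ->
  rm e (B :\ b).
Proof.
by move=> c bB /orP[]; [exact: cut_rmBb1 c _|exact: cut_rmBb1 (cut_sym c) _].
Qed.

(** Two parts of A would see the cut, one at c1 and the other at c2. The parts are even, so removing
    c1 and c2 leaves odd parts, whereas A - c1 - c2 has a perfect matching. *)
Lemma cut_connA s1 s2 A B : cut s1 s2 A B -> conn e A.
Proof.
move=> c C [sC aC] C0; apply/eqP; apply/negPn/negP=> CA.
have [n12 AB dAB aAB [_ oB]] := c.
have cC : closed_in e (~: [set s1; s2]) C by apply: (closed_in_cut c); left.
have [c1 c1C s1c1] := cut_attach c cC C0.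
have cC' : closed_in e (~: [set s2; s1]) (A :\: C).
  rewrite setUC; apply: (closed_in_cut c); left; split; first by sets.
  have -> : A :\: (A :\: C) = C by sets.
  exact: anticomplete_sym.
have C'0 : A :\: C != set0.
  by rewrite setD_eq0; apply: contra CA => AC; rewrite eqEsubset sC.
have [c2 c2C s2c2] := cut_attach (cut_sym c) cC' C'0.
have nc : c1 != c2 by sets.
have pC : pm e C.
  have -> : C = A :&: C by sets.
  by apply: (pm_restrict e_sym) (cut_pmA c) => // x y; rewrite (setIidPr sC); apply: aC.
have r : rm e (A :\ c1 :\ c2) by apply: (cut_rmAaa c) => //; sets.
have pC1 : pm e (C :\ c1).
  have -> : C :\ c1 = (A :\ c1 :\ c2) :&: C by sets.
  apply: (pm_restrict e_sym) (rm_pm e_irr r) => // x y xC yC.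
  by apply: aC; [sets|sets].
by apply: (pm_odd _ pC1); rewrite odd_rem1 //; apply: pm_even pC.
Qed.

(** The alternatives are the places of the witness w for s1 b: either w = s2, or w lies in A and s2
    is matched to some t in A. Other places fail by parity or, with w and t both in B, by random
    matchability of B - t. *)
Lemma cut_edgeSB s1 s2 A B b : cut s1 s2 A B -> b \in B -> e s1 b ->
  (~~ e s1 s2 /\ ~~ e s2 b) \/
  exists w t, [/\ w \in A, t \in A, w != t, ~~ e s1 w &
     e s2 t /\ pm e (A :\ w :\ t)].
Proof.
move=> c bB s1b; have [w [nw1 nwb s1w bw p]] := CR s1b.
have [n12 AB dAB aAB [_ oB]] := c; have evA := cut_evA c.
have [E|nw2] := eqVneq w s2; first by left; rewrite -E s1w e_sym bw.
right.
have s2X : s2 \in ~: [set s1; b; w] by sets.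
have [t [tX s2t pt]] := pm_rem e_sym e_irr p s2X.
have n2t := adj_neq e_irr s2t.
have [||pA pB] := cut_restrict c _ _ pt; [by sets|by sets|].
have nwt : w != t by sets.
have nbt : b != t by sets.
have [E|E|wA|wB] := cut_case c w; [by rewrite E eqxx in nw1|by rewrite E eqxx in nw2| |];
  (have [E|E|tA|tB] := cut_case c t; [by rewrite E !inE eqxx in tX|by rewrite E eqxx in n2t| |]).
- exists w, t; split=> //; split=> //; apply: (pm_eq pA); sets.
- case: (@pm_odd (B :\ b :\ t)); first by rewrite odd_rem2.
  by apply: (pm_eq pB); sets.
- case: (@pm_odd (A :\ t)); first by rewrite odd_rem1.
  by apply: (pm_eq pA); sets.
- have r : rm e (B :\ t) by apply: (cut_rmBb c) => //; rewrite s2t orbT.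
  case/negP: bw; apply: (rm_adj e_sym e_irr r); [by sets|by sets|by sets|].
  by apply: (pm_eq pB); sets.
Qed.

(** Otherwise w, s1 and x would be three pairwise non-adjacent exposed vertices. *)
Lemma cut_exposedB s1 s2 A B w t x : cut s1 s2 A B -> w \in A -> t \in A ->
  w != t -> ~~ e s1 w -> e s2 t -> pm e (A :\ w :\ t) ->
  x \in B -> pm e (B :\ x) -> e s1 x.
Proof.
move=> [n12 AB dAB aAB [_ oB]] wA tA nwt s1w s2t pA xB pB.
apply/negPn/negP=> s1x.
apply: (@no_exposed_triple w s1 x); [by sets|by sets|by sets|by rewrite e_sym|exact: aAB|by []|].
pmadd s2 t; apply: (pm_eq (pm_union _ pA pB)); by sets.
Qed.

(** A vertex x seeing neither cut vertex could be exposed with both of them; if s1 and s2 are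
    adjacent, criticality of an edge from s1 to B yields the configuration of [cut_exposedB]
    instead. *)
Lemma cut_adjB s1 s2 A B x : cut s1 s2 A B -> 3 <= #|B| -> x \in B ->
  pm e (B :\ x) -> e s1 x || e s2 x.
Proof.
move=> c B3 xB px; have [n12 AB dAB aAB [_ oB]] := c.
apply/negPn; rewrite negb_or; apply/negP=> /andP[s1x s2x].
have [e12|n12'] := boolP (e s1 s2); last first.
  apply: (@no_exposed_triple s1 s2 x) => //; [by sets|by sets|].
  by apply: (pm_eq (pm_union _ (cut_pmA c) px)); sets.
have [b1 [_ [b1B _ _ s1b1 _]]] := cut_twoB c B3.
have [[]|[w [t [wA tA nwt s1w [s2t pA]]]]] := cut_edgeSB c b1B s1b1; first by rewrite e12.
by have := cut_exposedB c wA tA nwt s1w s2t pA xB px; rewrite (negbTE s1x).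
Qed.

(** In this configuration s1 sees every x in B for which B - x is matchable. The witness v for
    criticality of an edge s1 a1 into A then has no place left, wherever the partner u of s2
    lies. *)
Lemma cut_full s1 s2 A B w t : cut s1 s2 A B -> 3 <= #|B| ->
  w \in A -> t \in A -> w != t -> ~~ e s1 w -> e s2 t ->
  pm e (A :\ w :\ t) -> False.
Proof.
move=> c B3 wA tA nwt s1w s2t pA.
have N x := cut_exposedB c wA tA nwt s1w s2t pA (x := x).
have rA := cut_rmA c B3.
have [n12 AB dAB aAB [_ oB]] := c; have evA := cut_evA c.
have [a1 [_ [a1A _ _ s1a1 _]]] := cut_twoA c.
have [v [nv1 nva s1v av p]] := CR s1a1.
have [E|nv2] := eqVneq v s2.
  rewrite E in p; have [||p' _] := cut_restrict c _ _ p; [by sets|by sets|].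
  apply: (@pm_odd (A :\ a1)); first by rewrite odd_rem1.
  by apply: (pm_eq p'); sets.
have s2X : s2 \in ~: [set s1; a1; v] by sets.
have [u [uX s2u pu]] := pm_rem e_sym e_irr p s2X.
have n2u := adj_neq e_irr s2u.
have [||p1 p2] := cut_restrict c _ _ pu; [by sets|by sets|].
have nvu : v != u by sets.
have nau : a1 != u by sets.
have nav : a1 != v by rewrite eq_sym.
have [E|E|vA|vB] := cut_case c v; [by rewrite E eqxx in nv1|by rewrite E eqxx in nv2| |];
  (have [E|E|uA|uB] := cut_case c u; [by rewrite E !inE eqxx in uX|by rewrite E eqxx in n2u| |]).
- apply: (pm_odd oB); by apply: (pm_eq p2); sets.
- case/negP: av; apply: (rm_adj e_sym e_irr rA) => //.
  by apply: (pm_eq p1); sets.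
- case/negP: s1v; apply: N => //; by apply: (pm_eq p2); sets.
- apply: (@pm_odd (A :\ a1)); first by rewrite odd_rem1.
  by apply: (pm_eq p1); sets.
Qed.

Lemma cut_SB s1 s2 A B b : cut s1 s2 A B -> 3 <= #|B| -> b \in B -> e s1 b ->
  ~~ e s1 s2 /\ ~~ e s2 b.
Proof.
move=> c B3 bB s1b; case: (cut_edgeSB c bB s1b) => // -[w [t [wA tA nwt s1w [s2t pA]]]].
by case: (cut_full c B3 wA tA nwt s1w s2t pA).
Qed.

(** The part C' cannot see b: an edge bx with x in C' extends to a perfect matching of B - b', which
    would match the odd set C - b'. So C' is a union of components of G[B], s1 sees some d in it,
    and C' - d is odd although B - d is matchable. *)
Lemma cut_connBb_aux s1 s2 A B b b' C : cut s1 s2 A B -> b \in B ->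
  e s1 b || e s2 b -> e s1 b' || e s2 b' -> closed_in e (B :\ b) C ->
  b' \in C -> B :\ b :\: C != set0 -> False.
Proof.
move=> c bB bS b'S [sC aC] b'C C'0; set C' := _ :\: C in C'0 aC.
have b'B : b' \in B by sets.
have nbb' : b != b' by sets.
have [n12 AB dAB aAB [_ oB]] := c.
have rb := cut_rmBb c bB bS; have rb' := cut_rmBb c b'B b'S.
have pC : pm e C.
  have -> : C = (B :\ b) :&: C by sets.
  apply: (pm_restrict e_sym) (rm_pm e_irr rb) => // x y; rewrite (setIidPr sC); exact: aC.
have sC' : C' \subset B :\ b by rewrite /C'; sets.
have pC' : pm e C'.
  have -> : C' = (B :\ b) :&: C' by sets.
  apply: (pm_restrict e_sym) (rm_pm e_irr rb) => // x y; rewrite (setIidPr sC') => xC' yC.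
  by rewrite e_sym; apply: aC => //; move: yC; rewrite /C'; sets.
have noC' x : x \in C' -> ~~ e b x.
  move=> xC'; have xB : x \in B :\ b :\: C by [].
  apply/negP=> bx.
  have p : pm e (B :\ b' :\ b :\ x) by apply: (rm_ext e_irr rb') => //; sets.
  apply: (@pm_odd (C :\ b')); first by rewrite odd_rem1 //; apply: pm_even pC.
  have -> : C :\ b' = (B :\ b' :\ b :\ x) :&: C by sets.
  apply: (pm_restrict e_sym) p => // y z yC zC.
  apply: aC; first by move: yC; sets.
  by move: zC; rewrite /C'; sets.
have cC' : closed_in e (~: [set s1; s2]) C'.
  apply: (closed_in_cut c); right; split; first by sets.
  move=> x y xC'; rewrite inE => /andP[yC' yB].
  have [->|nyb] := eqVneq y b; first by rewrite e_sym; apply: noC'.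
  by rewrite e_sym; apply: aC => //; move: yC'; rewrite /C'; sets.
have [d dC' s1d] := cut_attach c cC' C'0.
have dB : d \in B by sets.
have rd : rm e (B :\ d) by apply: (cut_rmBb c) => //; rewrite s1d.
apply: (@pm_odd (C' :\ d)); first by rewrite odd_rem1 //; apply: pm_even pC'.
have -> : C' :\ d = (B :\ d) :&: C' by sets.
apply: (pm_restrict e_sym) (rm_pm e_irr rd) => // y z yC zC.
by apply: (proj2 cC'); sets.
Qed.

Lemma cut_connBb s1 s2 A B b : cut s1 s2 A B -> 3 <= #|B| -> b \in B ->
  e s1 b || e s2 b -> conn e (B :\ b).
Proof.
move=> c B3 bB bS C [sC aC] C0; apply/eqP; apply/negPn/negP=> CB.
have C'0 : B :\ b :\: C != set0.
  by rewrite setD_eq0; apply: contra CB => AC; rewrite eqEsubset sC.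
have [b' [b'B nb b'S]] : exists b', [/\ b' \in B, b' != b & e s1 b' || e s2 b'].
  have [b1 [b2 [b1B b2B nb s1b1 s2b2]]] := cut_twoB c B3.
  have [E|] := eqVneq b1 b.
    by exists b2; split=> //; rewrite ?s2b2 ?orbT // -E eq_sym.
  by exists b1; split=> //; rewrite s1b1.
have [b'C|b'C] := boolP (b' \in C); first by apply: (cut_connBb_aux c bB bS b'S _ b'C C'0).
have E : B :\ b :\: (B :\ b :\: C) = C by sets.
apply: (@cut_connBb_aux _ _ _ _ b b' (B :\ b :\: C) c) => //; [split; first by sets| |].
- by rewrite E; exact: anticomplete_sym.
- by sets.
- by rewrite E.
Qed.

End Cut.

(** * Shapes of the two sides of a cut *)

Section Gadgets.
Variables (T : finType) (e : rel T).
Hypotheses (e_sym : symmetric e) (e_irr : irreflexive e).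
Implicit Types (X Y A B C D P Q R U I W N : {set T}) (x y z u v w : T).

(* The two possible shapes of [A] and of [B] in types I to IV: [N1] and [N2] are
   the neighbourhoods of [s1] and [s2] in [A], [D] is that of [{s1, s2}] in [B]. *)
Definition gadgetA A N1 N2 :=
  [/\ clique e A, ~~ odd #|A|, A != set0, N1 = A & N2 = A] \/
  [/\ bip e N1 N2, #|N1| = #|N2|, N1 != set0 & A = N1 :|: N2].

Definition gadgetB B D :=
  [/\ clique e B, odd #|B|, 3 <= #|B| & D = B] \/
  exists P, [/\ bip e P D, #|D| = #|P|.+1, P != set0 & B = P :|: D].

Lemma card_le1_eq X u v : #|X| <= 1 -> u \in X -> v \in X -> u = v.
Proof. by move=> /card_le1_eqP H uX vX; exact: H. Qed.

Lemma bip_sym P Q : bip e P Q -> bip e Q P.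
Proof.
case=> d iP iQ c; split=> //; first by rewrite disjoint_sym.
by move=> x y xQ yP; rewrite e_sym; apply: c.
Qed.

Lemma pm_bip_rem P Q x y : bip e P Q -> #|P| = #|Q| -> x \in P -> y \in Q ->
  pm e ((P :|: Q) :\ x :\ y).
Proof.
move=> [d iP iQ c] E xP yQ.
have -> : (P :|: Q) :\ x :\ y = (P :\ x) :|: (Q :\ y) by sets.
apply: pm_bip => //; [|by sets|].
  by move=> a b; rewrite !inE => /andP[_ aP] /andP[_ bQ]; apply: c.
by have := cardsD1 x P; have := cardsD1 y Q; rewrite xP yQ; nlia.
Qed.

Lemma pm_bip_same P Q x y : bip e P Q -> #|P| = #|Q| -> x \in P -> y \in P ->
  x != y -> ~ pm e ((P :|: Q) :\ x :\ y).
Proof.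
move=> [d iP iQ c] E xP yP nxy p.
have sX : (P :|: Q) :\ x :\ y \subset P :|: Q by sets.
have := pm_bip_inv e_irr iP iQ sX p.
have -> : ((P :|: Q) :\ x :\ y) :&: P = P :\ x :\ y by sets.
have -> : ((P :|: Q) :\ x :\ y) :&: Q = Q by sets.
by have := card_rem2 nxy xP yP; nlia.
Qed.

(** A vertex of P outside N1 and a2 have opposite colours, so their removal leaves a perfect
    matching, which is forbidden; hence P lies in N1, and similarly Q in N2. A vertex of N1 in Q
    could be removed with a second vertex of Q, which destroys the balance. *)
Lemma gadgetA_bip A N1 N2 P Q a1 a2 :
  N1 \subset A -> N2 \subset A -> a1 \in N1 -> a2 \in N2 -> a1 != a2 ->
  bip e P Q -> #|P| = #|Q| -> A = P :|: Q -> 2 <= #|P| ->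
  (forall x y, x \in N1 -> y \in N2 -> x != y -> pm e (A :\ x :\ y)) ->
  (forall w t, w \in A -> w \notin N1 -> t \in N2 -> w != t ->
     ~ pm e (A :\ w :\ t)) ->
  (forall w t, w \in A -> w \notin N2 -> t \in N1 -> w != t ->
     ~ pm e (A :\ w :\ t)) ->
  a2 \in Q -> N1 = P /\ N2 = Q.
Proof.
move=> s1 s2 a1N a2N na bPQ cPQ EA P2 pN full1 full2 a2Q.
have [d _ _ _] := bPQ.
have bQP := bip_sym bPQ.
have sP : P \subset N1.
  apply/subsetP=> w wP; apply/negPn/negP=> wN.
  apply: (full1 w a2) => //; [by rewrite EA; sets|by sets|].
  by rewrite EA; apply: pm_bip_rem.
have [p pP] : exists p, p \in P by apply/set0Pn; rewrite -card_gt0; nlia.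
have sQ : Q \subset N2.
  apply/subsetP=> w wQ; apply/negPn/negP=> wN.
  apply: (full2 w p) => //; [by rewrite EA; sets|by sets|by sets|].
  by rewrite EA setUC; apply: pm_bip_rem.
have other X x : 2 <= #|X| -> exists2 y, y \in X & x != y.
  move=> X2; have /set0Pn[y] : X :\ x != set0.
    by rewrite -card_gt0; move: X2; rewrite (cardsD1 x X); case: (x \in X); nlia.
  by rewrite !inE => /andP[nyx yX]; exists y => //; rewrite eq_sym.
split; apply/eqP; rewrite eqEsubset; [rewrite sP andbT|rewrite sQ andbT];
  apply/subsetP=> x xN; apply/negPn/negP=> xn.
- have xQ : x \in Q by have := subsetP s1 x xN; rewrite EA !inE (negbTE xn).
  have [y yQ nxy] := other Q x (etrans (congr1 (leq 2) (esym cPQ)) P2).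
  apply: (pm_bip_same bQP (esym cPQ) xQ yQ nxy); rewrite setUC -EA.
  by apply: pN => //; sets.
- have xP : x \in P by have := subsetP s2 x xN; rewrite EA !inE (negbTE xn) orbF.
  have [y yP nxy] := other P x P2.
  rewrite eq_sym in nxy.
  apply: (pm_bip_same bPQ cPQ yP xP nxy); rewrite -EA.
  by apply: pN => //; sets.
Qed.

(** In a complete A any two vertices can be removed, so the last two hypotheses force N1 = N2 = A
    unless both are singletons; then A is a single edge and is read as K_{1,1}. *)
Lemma gadgetA_intro A N1 N2 a1 a2 :
  N1 \subset A -> N2 \subset A -> a1 \in N1 -> a2 \in N2 -> a1 != a2 ->
  rm e A -> conn e A ->
  (forall x y, x \in N1 -> y \in N2 -> x != y -> pm e (A :\ x :\ y)) ->
  (forall w t, w \in A -> w \notin N1 -> t \in N2 -> w != t ->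
     ~ pm e (A :\ w :\ t)) ->
  (forall w t, w \in A -> w \notin N2 -> t \in N1 -> w != t ->
     ~ pm e (A :\ w :\ t)) ->
  gadgetA A N1 N2.
Proof.
move=> s1 s2 a1N a2N na rA cA pN full1 full2.
have a1A : a1 \in A by sets. have a2A : a2 \in A by sets.
have evA := pm_even e_irr (rm_pm e_irr rA).
have kk : clique e A -> gadgetA A N1 N2.
  move=> kA.
  have kp x y : x \in A -> y \in A -> x != y -> pm e (A :\ x :\ y).
    move=> xA yA nxy; apply: pm_clique => //; first by apply: cliqueS kA; sets.
    by have := card_rem2 nxy xA yA => E; move: evA; rewrite -E /= negbK.
  have [/eqP E1|n1] := boolP (N1 == A); have [/eqP E2|n2] := boolP (N2 == A).
  - by left; split=> //; apply/set0Pn; exists a1.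
  - have [w wA wN] : exists2 w, w \in A & w \notin N2.
      by apply/subsetPn; apply: contra n2 => sA; rewrite eqEsubset s2.
    have H t : t \in N1 -> w = t.
      move=> tN; apply/eqP; apply/negPn/negP=> nwt.
      by apply: (full2 w t wA wN tN nwt); apply: kp => //; rewrite -E1.
    have ca : a2 = a1 by rewrite -(H a1) // -(H a2) // E1.
    by rewrite ca eqxx in na.
  - have [w wA wN] : exists2 w, w \in A & w \notin N1.
      by apply/subsetPn; apply: contra n1 => sA; rewrite eqEsubset s1.
    have H t : t \in N2 -> w = t.
      move=> tN; apply/eqP; apply/negPn/negP=> nwt.
      by apply: (full1 w t wA wN tN nwt); apply: kp => //; rewrite -E2.
    have ca : a2 = a1 by rewrite -(H a1) ?E2 // -(H a2).
    by rewrite ca eqxx in na.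
  - have H1 w t : w \in A -> w \notin N1 -> t \in N2 -> w = t.
      move=> wA wN tN; apply/eqP; apply/negPn/negP=> nwt.
      by apply: (full1 w t wA wN tN nwt); apply: kp => //; sets.
    have H2 w t : w \in A -> w \notin N2 -> t \in N1 -> w = t.
      move=> wA wN tN; apply/eqP; apply/negPn/negP=> nwt.
      by apply: (full2 w t wA wN tN nwt); apply: kp => //; sets.
    have [w wA wN] : exists2 w, w \in A & w \notin N1.
      by apply/subsetPn; apply: contra n1 => sA; rewrite eqEsubset s1.
    have [v vA vN] : exists2 w, w \in A & w \notin N2.
      by apply/subsetPn; apply: contra n2 => sA; rewrite eqEsubset s2.
    have E2 : N2 = [set a2].
      apply/setP=> t; rewrite !inE; apply/idP/eqP=> [tN|-> //].
      by rewrite -(H1 w t) // (H1 w a2).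
    have E1 : N1 = [set a1].
      apply/setP=> t; rewrite !inE; apply/idP/eqP=> [tN|-> //].
      by rewrite -(H2 v t) // (H2 v a1).
    right; split.
    + split; rewrite ?E1 ?E2; [by sets|exact: independent1|exact: independent1|].
      by move=> x y; rewrite !inE => /eqP -> /eqP ->; apply: kA.
    + by rewrite E1 E2 !cards1.
    + by apply/set0Pn; exists a1.
    + apply/eqP; rewrite eqEsubset subUset s1 s2 !andbT.
      apply/subsetP=> x xA; rewrite !inE; apply/negPn; rewrite negb_or; apply/negP=> /andP[x1 x2].
      by move: x2; rewrite (H1 x a2) ?a2N.
case: (sumner e_sym e_irr rA cA) => [//|[P [Q [bPQ EA cPQ]]]].
have [P2|P1] := leqP 2 #|P|; last first.
  apply: kk => x y xA yA nxy.
  have [d _ _ c] := bPQ.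
  have Q1 : #|Q| < 2 by rewrite -cPQ.
  move: xA yA; rewrite EA !inE => /orP[xP|xQ] /orP[yP|yQ].
  - by rewrite (@card_le1_eq P x y) ?eqxx in nxy.
  - exact: c.
  - by rewrite e_sym; apply: c.
  - by rewrite (@card_le1_eq Q x y) ?eqxx in nxy.
have bQP := bip_sym bPQ.
have fin P' Q' : bip e P' Q' -> #|P'| = #|Q'| -> 2 <= #|P'| -> A = P' :|: Q' ->
    a2 \in Q' -> gadgetA A N1 N2.
  move=> bP' cP' P'2 EA' a2Q.
  have [E1 E2] := gadgetA_bip s1 s2 a1N a2N na bP' cP' EA' P'2 pN full1 full2 a2Q.
  right; rewrite E1 E2; split=> //; by rewrite -card_gt0; nlia.
have : a2 \in P :|: Q by rewrite -EA.
rewrite inE => /orP[a2P|a2Q]; last exact: (fin P Q).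
by apply: (fin Q P) => //; [rewrite -cPQ|rewrite setUC].
Qed.

(** B - b and B - c are both complete or both balanced complete bipartite, and B is assembled from
    them. The hypotheses make D the set of vertices whose removal leaves a perfect matching. *)
Lemma gadgetB_intro B D b c :
  D \subset B -> odd #|B| -> 3 <= #|B| -> b \in D -> c \in D -> b != c ->
  (forall x, x \in D -> rm e (B :\ x)) ->
  (forall x, x \in D -> conn e (B :\ x)) ->
  (forall x, x \in B -> pm e (B :\ x) -> x \in D) ->
  gadgetB B D.
Proof.
move=> sD oB B3 bD cD nbc rD kD BD.
have bB : b \in B by sets. have cB : c \in B by sets.
have big : 4 <= #|B| -> 5 <= #|B| by move: oB; case: #|B| => [|[|[|[|[|]]]]].
have ev2 x y z : x \in B -> y \in B -> z \in B -> x != y -> x != z -> y != z ->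
    ~~ odd #|B :\ x :\ y :\ z|.
  move=> xB yB zB xy xz yz; rewrite odd_rem1 ?odd_rem2 ?oB //.
  by rewrite !inE zB andbT andbC eq_sym xz eq_sym yz.
(* Only the edge bc is undecided. If it is missing, a third vertex x cannot be in D, since random
   matchability of B - x would create it; this leaves three vertices, the path K_{1,2}. *)
have cliq2 : clique e (B :\ b) -> clique e (B :\ c) -> gadgetB B D.
  move=> kb kc; have [ebc|nbc'] := boolP (e b c).
    have kB : clique e B.
      move=> x y xB yB nxy.
      have [Ex|nx] := eqVneq x b.
        rewrite {}Ex {x} in xB nxy *.
        have [-> //|ny] := eqVneq y c.
        by apply: kc => //; sets.
      have [Ey|ny] := eqVneq y b; last by apply: kb => //; sets.
      rewrite {}Ey {y} in yB nxy *.
      have [-> |nx'] := eqVneq x c; first by rewrite e_sym.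
      by apply: kc => //; sets.
    left; split=> //; apply/eqP; rewrite eqEsubset sD; apply/subsetP=> x xB.
    apply: BD => //; apply: pm_clique => //; first by apply: cliqueS kB; sets.
    by rewrite odd_rem1 // oB.
  have [x xB] : exists x, x \in B :\ b :\ c.
    by apply/set0Pn; rewrite -card_gt0; have := card_rem2 nbc bB cB; nlia.
  have xB' : x \in B by move: xB; sets.
  have nxb : x != b by sets. have nxc : x != c by sets.
  have xb : e x b by apply: kc => //; sets.
  have xc : e x c by apply: kb => //; sets.
  have rest : clique e (B :\ x :\ b :\ c).
    by apply: cliqueS kb; sets.
  have xD : x \notin D.
    apply/negP=> xD; case/negP: nbc'.
    apply: (rm_adj e_sym e_irr (rD x xD)); [by sets|by sets|by []|].
    by apply: pm_clique => //; apply: ev2.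
  (* With two further vertices y and z, the edges yb and zc start a perfect matching of B - x and
     put x into D. *)
  have B4 : #|B| <= 4.
    rewrite leqNgt; apply/negP => B5; case/negP: xD; apply: BD => //.
    have c3 : #|B :\ x :\ b :\ c| >= 2.
      have := card_rem2 nbc bB cB; have -> : B :\ x :\ b :\ c = B :\ b :\ c :\ x by sets.
      have := cardsD1 x (B :\ b :\ c); rewrite xB; nlia.
    have [y yB] : exists y, y \in B :\ x :\ b :\ c.
      by apply/set0Pn; rewrite -card_gt0; nlia.
    have [z zB] : exists z, z \in B :\ x :\ b :\ c :\ y.
      by apply/set0Pn; rewrite -card_gt0; move: c3; rewrite (cardsD1 y) yB; nlia.
    have yb : e y b by apply: kc => //; sets.
    have zc : e z c by apply: kb => //; sets.
    pmadd y b; pmadd z c; apply: pm_clique => //; first by apply: cliqueS rest; sets.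
    have -> : B :\ x :\ y :\ b :\ z :\ c = B :\ x :\ b :\ c :\ y :\ z by sets.
    rewrite odd_rem2; [by apply: ev2|by []| |]; first by move: zB; sets.
    by rewrite eq_sym; move: zB; rewrite !inE => /andP[].
  have E3 : B = [set x] :|: [set b; c].
    apply/eqP; rewrite eq_sym eqEcard; apply/andP; split; first by sets.
    rewrite setUC cards3 //; [|by rewrite eq_sym|by rewrite eq_sym].
    by move: B4 oB; case: #|B| => [|[|[|[|[|]]]]].
  have ED : D = [set b; c].
    apply/eqP; rewrite eqEsubset; apply/andP; split; last by sets.
    apply/subsetP=> y yD; have := subsetP sD y yD; rewrite E3 !inE.
    by case: eqVneq => // yx; rewrite -yx yD in xD.
  right; exists [set x]; rewrite ED; split=> //.
  - split; [by sets|exact: independent1|exact: independent2|].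
    by move=> u v; rewrite !inE => /eqP -> /orP[] /eqP ->.
  - by rewrite cards1 cards2 nbc.
  - by apply/set0Pn; exists x; rewrite inE.
(* A colour class of B - v has at most one vertex in the complete graph B - u, so the classes are
   singletons and B - v is complete anyway. *)
have mixed u v : u \in D -> v \in D -> u != v -> clique e (B :\ u) -> clique e (B :\ v).
  move=> uD vD nuv ku; have uB : u \in B by sets. have vB : v \in B by sets.
  case: (sumner e_sym e_irr (rD v vD) (kD v vD)) => // -[P [Q [bPQ EPQ cPQ]]].
  have cB' : #|B| = #|P| + #|Q| + 1.
    rewrite (cardsD1 v B) vB EPQ cardsU disjoint_setI0 ?cards0; last by case: bPQ.
    nlia.
  have le1 X : X \subset B :\ v -> independent e X -> #|X :\ u| <= 1.
    move=> sX iX; rewrite leqNgt; apply/negP => /card_gt1P[y [z [yX zX nyz]]].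
    have := iX y z; rewrite ku //; [|by sets|by sets].
    by move=> /(_ _ _)/negP; apply; [by sets|by sets|].
  have sP : P \subset B :\ v by rewrite EPQ; sets.
  have sQ : Q \subset B :\ v by rewrite EPQ; sets.
  have [dPQ iP iQ c'] := bPQ.
  have P1 := le1 P sP iP; have Q1 := le1 Q sQ iQ.
  have small : #|P| <= 1.
    have [uP|uP] := boolP (u \in P).
      rewrite cPQ; suff -> : Q = Q :\ u by []. by sets.
    by suff -> : P = P :\ u by []; sets.
  move=> y z; rewrite EPQ !inE => /orP[yP|yQ] /orP[zP|zQ] nyz.
  - by rewrite (@card_le1_eq P y z) ?eqxx in nyz.
  - exact: c'.
  - by rewrite e_sym; apply: c'.
  - by rewrite (@card_le1_eq Q y z) -?cPQ ?eqxx in nyz.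
case: (sumner e_sym e_irr (rD b bD) (kD b bD)) => [kb|[P [Q [bPQ EPQ cPQ]]]].
  by apply: cliq2 => //; apply: (mixed b c).
case: (sumner e_sym e_irr (rD c cD) (kD c cD)) => [kc|[P' [Q' [bPQ' EPQ' cPQ']]]].
  by apply: cliq2 => //; apply: (mixed c b) => //; rewrite eq_sym.
have fin P1 Q1 P2 Q2 : bip e P1 Q1 -> B :\ b = P1 :|: Q1 -> #|P1| = #|Q1| ->
    bip e P2 Q2 -> B :\ c = P2 :|: Q2 -> #|P2| = #|Q2| -> c \in Q1 -> b \in Q2 ->
    gadgetB B D.
  move=> {P Q bPQ EPQ cPQ P' Q' bPQ' EPQ' cPQ'} b1 E1 c1 b2 E2 c2 cQ bQ.
  have [d1 iP1 iQ1 k1] := b1; have [d2 iP2 iQ2 k2] := b2.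
  have cB' : #|B| = #|P1| + #|Q1| + 1.
    rewrite (cardsD1 b B) bB E1 cardsU disjoint_setI0 ?cards0 //; nlia.
  have cB2 : #|B| = #|P2| + #|Q2| + 1.
    rewrite (cardsD1 c B) cB E2 cardsU disjoint_setI0 ?cards0 //; nlia.
  have [p1|p1] := leqP #|P1| 1.
    have q1 : #|Q1| <= 1 by rewrite -c1.
    have p2 : #|P2| <= 1 by move: cB' cB2 p1; rewrite -c1 -c2; clear; nlia.
    have q2 : #|Q2| <= 1 by rewrite -c2.
    apply: cliq2 => y z.
      rewrite E1 !inE => /orP[yP|yQ] /orP[zP|zQ] nyz.
      - by rewrite (@card_le1_eq P1 y z) ?eqxx in nyz.
      - exact: k1.
      - by rewrite e_sym; apply: k1.
      - by rewrite (@card_le1_eq Q1 y z) ?eqxx in nyz.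
    rewrite E2 !inE => /orP[yP|yQ] /orP[zP|zQ] nyz.
    - by rewrite (@card_le1_eq P2 y z) ?eqxx in nyz.
    - exact: k2.
    - by rewrite e_sym; apply: k2.
    - by rewrite (@card_le1_eq Q2 y z) ?eqxx in nyz.
  have [y yQ1] : exists y, y \in Q1 :\ c.
    by apply/set0Pn; rewrite -card_gt0; have := cardsD1 c Q1; rewrite cQ; nlia.
  have H x : (x \in B) && (x != b) = (x \in P1) || (x \in Q1).
    by have /setP/(_ x) := E1; rewrite !inE andbC.
  have H' x : (x \in B) && (x != c) = (x \in P2) || (x \in Q2).
    by have /setP/(_ x) := E2; rewrite !inE andbC.
  (* If y lay in P2, all of P1 and b would lie in Q2, which has only as many vertices as P1. *)
  have yQ2 : y \in Q2.
    apply/negPn/negP=> yQ2.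
    have yP2 : y \in P2 by have := H' y; have := H y; move: yQ1 yQ2; rewrite !inE => /andP[-> ->] /negbTE ->; rewrite orbT orbF !andbT => /andP[-> _] <-.
    have sub : P1 :|: [set b] \subset Q2.
      apply/subsetP=> x; rewrite !inE => /orP[xP|/eqP -> //].
      apply/negPn/negP=> xQ2.
      have xy : e x y by apply: k1 => //; move: yQ1; sets.
      have xB : (x \in B) && (x != b) by rewrite H xP.
      have xc : x != c by sets.
      have xP2 : x \in P2 by have := H' x; rewrite xc; case/andP: xB => -> _; rewrite (negbTE xQ2) orbF.
      by move: (iP2 x y xP2 yP2); rewrite xy.
    have := subset_leq_card sub; rewrite setUC cardsU1.
    have -> : b \notin P1 by apply/negP=> bP; have := H b; rewrite bP eqxx andbF.
    nlia.
  have yB : y \in B by have := H' y; rewrite yQ2 orbT => /andP[].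
  have nyc : y != c by sets.
  have nyb : y != b by apply/eqP=> E; have := H b; rewrite -E; move: yQ1; rewrite !inE => /andP[_ ->]; rewrite orbT eqxx andbF.
  have yQ1' : y \in Q1 by move: yQ1; sets.
  have bP x : x \in P1 -> e x b.
    move=> xP; apply: k2 => //.
    have xy : e x y by apply: k1.
    have xB : (x \in B) && (x != b) by rewrite H xP.
    have xc : x != c by sets.
    have := H' x; rewrite xc; case/andP: xB => -> _ /= /esym/orP[//|xQ2].
    by have := iQ2 x y xQ2 yQ2; rewrite xy.
  have bQ1 x : x \in Q1 :\ c -> ~~ e b x.
    rewrite !inE => /andP[xc xQ]; have [p pP] : exists p, p \in P1.
      by apply/set0Pn; rewrite -card_gt0; nlia.
    have xB : (x \in B) && (x != b) by rewrite H xQ orbT.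
    have := H' x; rewrite xc; case/andP: xB => -> _ /= /esym/orP[xP2|xQ2]; last exact: iQ2.
    have pB : (p \in B) && (p != b) by rewrite H pP.
    have pc : p != c by sets.
    have := H' p; rewrite pc; case/andP: pB => -> _ /= /esym/orP[pP2|pQ2].
      by have := iP2 p x pP2 xP2; rewrite k1.
    by have := iQ2 p b pQ2 bQ; rewrite bP.
  have bnQ : b \notin Q1 by apply/negP=> bQ'; have := H b; rewrite bQ' orbT eqxx andbF.
  have bnP : b \notin P1 by apply/negP=> bQ'; have := H b; rewrite bQ' eqxx andbF.
  have EB : B = P1 :|: (b |: Q1).
    by apply/setP=> x; have := H x; rewrite !inE; case: (eqVneq x b) => [->|]; rewrite ?bB ?orbT ?andbT.
  (* The edge bc would put a vertex p of P1 into D, and random matchability of B - p would make b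
     adjacent to y. *)
  have bc : ~~ e b c.
    apply/negP=> bc; have [p pP] : exists p, p \in P1.
      by apply/set0Pn; rewrite -card_gt0; nlia.
    have cP := cardsD1 p P1; have cQ' := cardsD1 c Q1; have cQy := cardsD1 y Q1.
    rewrite pP in cP; rewrite cQ in cQ'; rewrite yQ1' in cQy.
    have kk X Y : X \subset P1 -> Y \subset Q1 -> #|X| = #|Y| -> pm e (X :|: Y).
      move=> sX sY E; apply: pm_bip => //; last by sets.
      by move=> u v /(subsetP sX) uP /(subsetP sY); apply: k1.
    have pB : p \in B by rewrite EB; sets.
    have pD : p \in D.
      apply: BD => //; pmadd b c.
      apply: (pm_eq (kk (P1 :\ p) (Q1 :\ c) _ _ _)); [by sets|by sets|nlia|].
      by rewrite EB; sets.
    have := bQ1 y yQ1; rewrite (rm_adj e_sym e_irr (rD p pD)) //; [by sets|by sets|by rewrite eq_sym|].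
    apply: (pm_eq (kk (P1 :\ p) (Q1 :\ y) _ _ _)); [by sets|by sets|nlia|].
    by rewrite EB; sets.
  have b3 : bip e P1 (b |: Q1).
    split; [by sets|by []| |].
      move=> u v; rewrite !inE.
      have bQ' x : x \in Q1 -> ~~ e b x.
        by move=> xQ; have [-> //|nxc] := eqVneq x c; apply: bQ1; sets.
      move=> /orP[/eqP ->|uQ] /orP[/eqP ->|vQ]; rewrite ?e_irr //; [exact: bQ'|by rewrite e_sym; apply: bQ'|exact: iQ1].
    by move=> u v uP; rewrite !inE => /orP[/eqP ->|vQ]; [exact: bP|exact: k1].
  have [d3 iP3 iQ3 k3] := b3.
  have c3 : #|b |: Q1| = #|P1|.+1 by rewrite cardsU1 bnQ; nlia.
  have ED : D = b |: Q1.
    apply/eqP; rewrite eqEsubset; apply/andP; split; apply/subsetP=> x xX.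
      apply/negPn/negP=> xn; have xB := subsetP sD x xX.
      have xP : x \in P1 by move: xB; rewrite EB inE (negbTE xn) orbF.
      have sX : B :\ x \subset P1 :|: (b |: Q1) by rewrite EB; sets.
      have := pm_bip_inv e_irr iP3 iQ3 sX (rm_pm e_irr (rD x xX)).
      have -> : (B :\ x) :&: P1 = P1 :\ x by rewrite EB; sets.
      have -> : (B :\ x) :&: (b |: Q1) = b |: Q1 by rewrite EB; sets.
      by have := cardsD1 x P1; rewrite xP; nlia.
    have xB : x \in B by rewrite EB inE xX orbT.
    apply: BD => //; have -> : B :\ x = P1 :|: ((b |: Q1) :\ x) by rewrite EB; sets.
    apply: pm_bip => //; [|by sets|].
      by move=> u v uP; rewrite inE => /andP[_]; apply: k3.
    by have := cardsD1 x (b |: Q1); rewrite xX; nlia.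
  right; exists P1; rewrite ED; split=> //.
  by rewrite -card_gt0; nlia.
have cPQ1 : c \in P :|: Q by rewrite -EPQ; sets.
have bPQ1 : b \in P' :|: Q' by rewrite -EPQ'; sets.
have bQP := bip_sym bPQ; have bQP' := bip_sym bPQ'.
move: cPQ1 bPQ1; rewrite !inE => /orP[cP|cQ] /orP[bP|bQ].
- by apply: (fin Q P Q' P') => //; rewrite setUC.
- by apply: (fin Q P P' Q') => //; rewrite setUC.
- by apply: (fin P Q Q' P') => //; rewrite setUC.
- exact: (fin P Q P' Q').
Qed.

End Gadgets.

(** * A cut isolating a single vertex *)

(* What [A] retains of the situation [B = {b}]; [p1] and [p2] are adjacency to
   [s1] and to [s2]. *)
Record pendant (T : finType) (e : rel T) (p1 p2 : pred T) (A : {set T}) : Prop := Pendant {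
  pd_rm : forall x y, x \in A -> y \in A -> x != y -> p1 x -> p2 y ->
    rm e (A :\ x :\ y) /\ conn e (A :\ x :\ y);
  pd_pm : pm e A;
  pd_ge4 : 4 <= #|A|;
  pd_two1 : exists x x', [/\ x \in A, x' \in A, x != x', p1 x & p1 x'];
  pd_two2 : exists x x', [/\ x \in A, x' \in A, x != x', p2 x & p2 x'];
  pd_edge1 : forall a, a \in A -> p1 a -> exists w,
    [/\ w \in A, w != a, ~~ p1 w, ~~ e a w & pm e (A :\ a :\ w)];
  pd_edge2 : forall a, a \in A -> p2 a -> exists w,
    [/\ w \in A, w != a, ~~ p2 w, ~~ e a w & pm e (A :\ a :\ w)];
  pd_exp1 : forall x y, x \in A -> y \in A -> x != y -> ~~ e x y ->
    ~~ p1 x -> ~~ p1 y -> ~ pm e (A :\ x :\ y);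
  pd_exp2 : forall x y, x \in A -> y \in A -> x != y -> ~~ e x y ->
    ~~ p2 x -> ~~ p2 y -> ~ pm e (A :\ x :\ y);
  pd_inner : forall a a', a \in A -> a' \in A -> e a a' ->
    [\/ ~~ p1 a /\ ~~ p1 a', ~~ p2 a /\ ~~ p2 a',
      exists t1 t2, [/\ p1 t1, p2 t2, t1 \in A :\ a :\ a', t2 \in A :\ a :\ a' :\ t1 &
                      pm e (A :\ a :\ a' :\ t1 :\ t2)]
    | exists w t, [/\ ~~ e a w, w \in A :\ a :\ a', t \in A :\ a :\ a' :\ w,
        p1 t || p2 t & pm e (A :\ a :\ a' :\ w :\ t)]];
  pd_spread : forall z z', z \in A -> z' \in A -> z != z' ->
    (forall x, x \in A -> p1 x || p2 x -> x \in [set z; z']) -> False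
}.

Section Analysis.
Variables (T : finType) (e : rel T).
Hypotheses (e_sym : symmetric e) (e_irr : irreflexive e).
Implicit Types (X Y A B C D P Q R U I W N : {set T}) (x y z u v w b : T).

Definition nbr s A := [set x in A | e s x].

(** Types I to IV at once, freed from the parameters p and q. *)
Definition gadget_cut s1 s2 A B :=
  [/\ cut e s1 s2 A B, ~~ e s1 s2, gadgetA e A (nbr s1 A) (nbr s2 A),
      gadgetB e B (nbr s1 B :|: nbr s2 B) &
      [/\ [disjoint nbr s1 B & nbr s2 B], nbr s1 B != set0 & nbr s2 B != set0]].

Definition gadget_family := exists s1 s2 A B, gadget_cut s1 s2 A B.

Hypotheses (FC : fc e) (EQ : eqm e) (CR : crit e).
Hypothesis TC : forall v, conn e (~: [set v]).

Lemma cut_gadgets s1 s2 A B : cut e s1 s2 A B -> 3 <= #|B| -> gadget_family.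
Proof.
move=> c B3; exists s1, s2, A, B.
have [b1 [b2 [b1B b2B nb s1b1 s2b2]]] := cut_twoB e_sym TC c B3.
have [a1 [a2 [a1A a2A na s1a1 s2a2]]] := cut_twoA e_sym e_irr FC TC c.
have cs := cut_sym c.
have SB := cut_SB e_sym e_irr FC EQ CR TC c B3.
have [n12 n2b1] := SB b1 b1B s1b1.
split=> //.
- have full := cut_full e_sym e_irr FC EQ CR TC c B3.
  have full' := cut_full e_sym e_irr FC EQ CR TC cs B3.
  apply: (@gadgetA_intro T e e_sym e_irr A _ _ a1 a2); rewrite ?inE ?a1A ?a2A //.
  + by apply/subsetP=> x; rewrite inE => /andP[].
  + by apply/subsetP=> x; rewrite inE => /andP[].
  + exact: (cut_rmA e_sym e_irr EQ TC c B3).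
  + exact: (cut_connA e_sym e_irr FC EQ TC c).
  + move=> x y; rewrite !inE => /andP[xA s1x] /andP[yA s2y] nxy.
    by apply: (rm_pm e_irr); apply: (cut_rmAaa e_sym e_irr EQ c).
  + move=> w t wA; rewrite !inE wA /= => s1w /andP[tA s2t] nwt p.
    exact: (full w t).
  + move=> w t wA; rewrite !inE wA /= => s1w /andP[tA s2t] nwt p.
    exact: (full' w t).
- have nbP x : x \in nbr s1 B :|: nbr s2 B = (x \in B) && (e s1 x || e s2 x).
    by rewrite !inE -andb_orr.
  apply: (@gadgetB_intro T e e_sym e_irr B _ b1 b2) => //.
  + by apply/subsetP=> x; rewrite nbP => /andP[].
  + by case: c => _ _ _ _ [].
  + by rewrite nbP b1B s1b1.
  + by rewrite nbP b2B s2b2 orbT.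
  + by move=> x; rewrite nbP => /andP[xB xS]; apply: (cut_rmBb e_sym e_irr FC EQ TC c).
  + by move=> x; rewrite nbP => /andP[xB xS]; apply: (cut_connBb e_sym e_irr FC EQ TC c).
  + move=> x xB px; rewrite nbP xB.
    exact: (cut_adjB e_sym e_irr FC EQ CR TC c B3).
split.
- apply: disjointI => x; rewrite !inE => /andP[xB s1x] /andP[_ s2x].
  by have [_] := SB x xB s1x; rewrite s2x.
- by apply/set0Pn; exists b1; rewrite inE b1B.
- by apply/set0Pn; exists b2; rewrite inE b2B.
Qed.

(** Decided by a finite search, so that a cut with a large odd side can be chosen whenever there is
    one. *)
Lemma cut_dec : (exists s1 s2 A B, cut e s1 s2 A B /\ 3 <= #|B|) \/
  (forall s1 s2 A B, cut e s1 s2 A B -> 3 <= #|B| -> False).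
Proof.
pose cutb s1 s2 A B := [&& s1 != s2, A :|: B == ~: [set s1; s2], [disjoint A & B],
  [forall x in A, forall y in B, ~~ e x y], A != set0 & odd #|B|].
have cutP s1 s2 A B : cut e s1 s2 A B <-> cutb s1 s2 A B.
  split=> [[n AB d a [A0 o]]|/and5P[n /eqP AB d /forall_inP a /andP[A0 o]]].
    rewrite /cutb n AB eqxx d A0 o /= andbT.
    by apply/forall_inP=> x xA; apply/forall_inP=> y; apply: a.
  by split=> // x y xA; move: y; apply/forall_inP/a.
have [/existsP[s1 /existsP[s2 /existsP[A /existsP[B /andP[c B3]]]]]|H] := 
  boolP [exists s1, exists s2, exists A : {set T}, exists B : {set T}, cutb s1 s2 A B && (3 <= #|B|)].
  by left; exists s1, s2, A, B; split=> //; apply/cutP.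
right=> s1 s2 A B /cutP c B3; case/negP: H.
apply/existsP; exists s1; apply/existsP; exists s2.
by apply/existsP; exists A; apply/existsP; exists B; rewrite c.
Qed.

Lemma odd_order : T -> odd #|T|.
Proof.
move=> v; have := pm_even e_irr (FC v); rewrite cardsC1.
have : 0 < #|T| by apply/card_gt0P; exists v.
by case: #|T| => //= n _; rewrite negbK.
Qed.

(** * Graphs in which every 2-cut isolates a vertex *)

Section Small.
Hypothesis small : forall s1 s2 A B, cut e s1 s2 A B -> 3 <= #|B| -> False.

(** {x, y} is a cut with even side C; as the order is odd, the other side is odd, and it is too
    large. The arguments below apply [small] in this form. *)
Lemma no_even_part x y C : x != y -> x \notin C -> y \notin C -> C != set0 ->
  ~~ odd #|C| -> anticomplete_to e C (~: (C :|: [set x; y])) ->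
  3 <= #|~: (C :|: [set x; y])| -> False.
Proof.
move=> nxy xC yC C0 evC aC c3; apply: (small _ c3).
have dC : [disjoint C & ~: (C :|: [set x; y])] by sets.
have EC : C :|: ~: (C :|: [set x; y]) = ~: [set x; y] by sets.
split; [exact: nxy|exact: EC|exact: dC|exact: aC|split=> //].
have := odd_order x; rewrite -(cardsC [set x; y]) cards2 nxy -EC.
by rewrite cardsU disjoint_setI0 // cards0 subn0 !oddD (negbTE evC).
Qed.

Section PendantFacts.
Variables (s1 s2 b : T) (A : {set T}).
Hypothesis c : cut e s1 s2 A [set b].
Let n12 : s1 != s2. Proof. by case: c. Qed.
Let AB : A :|: [set b] = ~: [set s1; s2]. Proof. by case: c. Qed.
Let dAB : [disjoint A & [set b]]. Proof. by case: c. Qed.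

Lemma s1_notin : s1 \notin A. Proof. by sets. Qed.
Lemma b_notin : b \notin A. Proof. by sets. Qed.
Lemma b_neq1 : b != s1. Proof. by sets. Qed.

Lemma b_A x : x \in A -> ~~ e b x.
Proof. by case: c => _ _ _ a _ xA; rewrite e_sym; apply: a; rewrite ?inE. Qed.

Lemma adj_s1b : e s1 b.
Proof.
have := cut_attach e_sym TC c (C := [set b]).
case; [|by apply/set0Pn; exists b; rewrite inE|by move=> x; rewrite inE => /eqP ->].
by apply: (closed_in_cut e_sym c); right; exact: closed_in_refl.
Qed.

Lemma pm_b X : s1 \notin X -> s2 \notin X -> b \in X -> pm e X -> False.
Proof.
move=> s1X s2X bX p; have [_ pB] := cut_restrict e_sym e_irr c s1X s2X p.
apply: (@pm_odd _ _ e_irr (X :&: [set b])) => //.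
by have -> : X :&: [set b] = [set b] by [sets]; rewrite cards1.
Qed.

Lemma pm_A X Y : s1 \notin X -> s2 \notin X -> pm e X -> X :&: A = Y -> pm e Y.
Proof.
by move=> s1X s2X p <-; have [] := cut_restrict e_sym e_irr c s1X s2X p.
Qed.

(** A witness for criticality of s1 s2 would leave b without a partner. *)
Lemma s1s2_nonadj : ~~ e s1 s2.
Proof.
apply/negP=> e12; have [w [w1 w2 n1 n2 p]] := CR e12.
have wb : w != b by apply: contraNneq n1 => ->; exact: adj_s1b.
have nb1 := b_neq1; have nb2 : b != s2 by sets.
apply: (pm_b _ _ _ p); by sets.
Qed.

Lemma no_exposed_s2 x y : x \in A -> y \in A -> x != y -> ~~ e x y ->
  ~~ e s2 x -> ~~ e s2 y -> ~ pm e (A :\ x :\ y).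
Proof.
move=> xA yA nxy xy s2x s2y p.
apply: (@no_exposed_triple _ _ e_sym e_irr EQ s2 x y) => //; [by sets|by sets|].
have s1b := adj_s1b; have nbs := b_neq1.
pmadd s1 b; apply: (pm_eq p); by sets.
Qed.

End PendantFacts.

Section Pendant.
Variables (s1 s2 b : T) (A : {set T}).
Hypothesis c : cut e s1 s2 A [set b].
Let n12 : s1 != s2. Proof. by case: c. Qed.
Let AB : A :|: [set b] = ~: [set s1; s2]. Proof. by case: c. Qed.
Let dAB : [disjoint A & [set b]]. Proof. by case: c. Qed.
Let n1A : s1 \notin A. Proof. exact: s1_notin c. Qed.
Let n2A : s2 \notin A. Proof. exact: s1_notin (cut_sym c). Qed.
Let nbA : b \notin A. Proof. exact: b_notin c. Qed.
Let nb1 : b != s1. Proof. exact: b_neq1 c. Qed.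
Let nb2 : b != s2. Proof. exact: b_neq1 (cut_sym c). Qed.
Let s1b : e s1 b. Proof. exact: adj_s1b c. Qed.
Let s2b : e s2 b. Proof. exact: adj_s1b (cut_sym c). Qed.
Let ns12 : ~~ e s1 s2. Proof. exact: s1s2_nonadj c. Qed.
Let evA : ~~ odd #|A|. Proof. exact (cut_evA e_sym e_irr FC c). Qed.
Let pA : pm e A. Proof. exact (cut_pmA e_sym e_irr FC c). Qed.

Lemma pcase x : [\/ x = s1, x = s2, x \in A | x = b].
Proof.
by case: (cut_case c x) => [?|?|?|/set1P ?]; [constructor 1|constructor 2|constructor 3|constructor 4].
Qed.

(** The witness for s1 a is not b, a neighbour of s1, and not s2, which would isolate b. So it lies
    in A, b is matched to s2, and the rest of A is matched within itself. *)
Lemma edge_s1A a : a \in A -> e s1 a -> exists w,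
  [/\ w \in A, w != a, ~~ e s1 w, ~~ e a w & pm e (A :\ a :\ w)].
Proof.
move=> aA s1a; have [w [w1 wa n1 na p]] := CR s1a.
have nab : a != b by sets.
have n1a : s1 != a by sets.
have n2a : s2 != a by sets.
have [E|E|wA|E] := pcase w; [by rewrite E eqxx in w1| | |by rewrite E s1b in n1].
  by case: (pm_b c _ _ _ p); rewrite ?E; sets.
have [|t [tX s2t pt]] := pm_rem e_sym e_irr p (x := s2); first by sets.
exists w; split=> //.
have nwb : w != b by sets.
have [E|E|tA|E] := pcase t.
- by rewrite E !inE eqxx in tX.
- by rewrite E e_irr in s2t.
- have ntb : t != b by sets.
  by case: (pm_b c _ _ _ pt); sets.
- by rewrite E in pt tX; apply: (pm_A c _ _ pt); sets.
Qed.

(** With two vertices in A, the non-neighbour w of a would be the only possible partner of a. *)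
Lemma A_ge4 : 4 <= #|A|.
Proof.
have [a [_ [aA _ _ s1a _]]] := cut_twoA e_sym e_irr FC TC c.
have [w [wA wa n1 na p]] := edge_s1A aA s1a.
rewrite leqNgt; apply/negP=> A4.
have nwa : a != w by rewrite eq_sym.
have c2 := card_rem2 nwa aA wA.
have /eqP : #|A :\ a :\ w| = 0 by move: c2 A4 evA; case: #|A| => [|[|[|[|]]]] //=; clear; lia.
rewrite cards_eq0 => /eqP E.
have [t [tA at_ pt]] := pm_rem e_sym e_irr pA aA.
have nat' := adj_neq e_irr at_.
have ntw : t != w by apply: contraNneq na => <-.
by have : t \in A :\ a :\ w; [sets|rewrite E inE].
Qed.

(** Otherwise {a, s2} is a cut with even side {s1, b}. *)
Lemma s1_two a : a \in A -> e s1 a -> exists2 a', a' \in A & e s1 a' && (a' != a).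
Proof.
move=> aA s1a; have A4 := A_ge4.
have [/existsP[a' /and3P[a'A s1a' n]]|H] := boolP [exists a', [&& a' \in A, e s1 a' & a' != a]].
  by exists a' => //; rewrite s1a'.
have N a' : a' \in A -> a' != a -> ~~ e s1 a'.
  by move=> a'A n; apply: contra H => s1a'; apply/existsP; exists a'; rewrite a'A s1a'.
have n1a : s1 != a by sets. have nba : b != a by sets.
have n2a : a != s2 by sets.
have E : ~: ([set s1; b] :|: [set a; s2]) = A :\ a by sets.
case: (@no_even_part a s2 [set s1; b]) => //; [by sets|by sets| | | |].
- by apply/set0Pn; exists b; rewrite !inE eqxx orbT.
- by rewrite cards2 eq_sym nb1.
- rewrite E => x y; rewrite !inE => /orP[] /eqP -> /andP[ya yA]; first exact: N.
  exact: (b_A c).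
- by rewrite E; move: A4; rewrite (cardsD1 a) aA; clear; lia.
Qed.

(** The cases are the places s1, s2, b and A of the witness, in this order. In the last one b is
    matched to one cut vertex and t is the partner of the other. *)
Lemma edge_AA a a' : a \in A -> a' \in A -> e a a' ->
  [\/ ~~ e s1 a /\ ~~ e s1 a', ~~ e s2 a /\ ~~ e s2 a',
      exists t1 t2, [/\ e s1 t1, e s2 t2, t1 \in A :\ a :\ a', t2 \in A :\ a :\ a' :\ t1 &
                      pm e (A :\ a :\ a' :\ t1 :\ t2)]
    | exists w t, [/\ ~~ e a w, w \in A :\ a :\ a', t \in A :\ a :\ a' :\ w,
        e s1 t || e s2 t & pm e (A :\ a :\ a' :\ w :\ t)]].
Proof.
move=> aA a'A aa'; have [w [wa wa' na na' p]] := CR aa'.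
have naa' := adj_neq e_irr aa'.
have nab : a != b by sets. have na1 : a != s1 by sets. have na2 : a != s2 by sets.
have nab' : a' != b by sets. have na1' : a' != s1 by sets. have na2' : a' != s2 by sets.
have [E|E|wA|E] := pcase w.
- by constructor 1; rewrite !(e_sym s1) -E.
- by constructor 2; rewrite !(e_sym s2) -E.
- constructor 4.
  have nwb : w != b by sets. have nw1 : w != s1 by sets. have nw2 : w != s2 by sets.
  have [|u [uX bu pu]] := pm_rem e_sym e_irr p (x := b); first by sets.
  have [E|E|uA|E] := pcase u.
  + rewrite {}E in uX bu pu.
    have [|t [tX s2t pt]] := pm_rem e_sym e_irr pu (x := s2); first by sets.
    have [E|E|tA|E] := pcase t; [by rewrite E !inE eqxx in tX|by rewrite E e_irr in s2t| |by rewrite E !inE eqxx ?orbT ?andbF in tX].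
    exists w, t; split=> //; [by sets|by sets|by rewrite s2t orbT|].
    by apply: (pm_A c _ _ pt); sets.
  + rewrite {}E in uX bu pu.
    have [|t [tX s1t pt]] := pm_rem e_sym e_irr pu (x := s1); first by sets.
    have [E|E|tA|E] := pcase t; [by rewrite E e_irr in s1t|by rewrite E !inE eqxx in tX| |by rewrite E !inE eqxx ?orbT ?andbF in tX].
    exists w, t; split=> //; [by sets|by sets|by rewrite s1t|].
    by apply: (pm_A c _ _ pt); sets.
  + by have := b_A c uA; rewrite bu.
  + by rewrite E e_irr in bu.
- constructor 3; rewrite {}E in wa wa' na na' p.
  have [|t1 [t1X s1t1 pt]] := pm_rem e_sym e_irr p (x := s1); first by sets.
  have [E|E|t1A|E] := pcase t1.
  + by rewrite E e_irr in s1t1.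
  + by case/negP: ns12; rewrite -E.
  + have t12 : t1 != s2 by sets.
    have [|t2 [t2X s2t2 pt2]] := pm_rem e_sym e_irr pt (x := s2); first by sets.
    have [E|E|t2A|E] := pcase t2.
    * by rewrite E !inE eqxx ?orbT ?andbF in t2X.
    * by rewrite E e_irr in s2t2.
    * exists t1, t2; split=> //; [by sets|by sets|].
      by apply: (pm_A c _ _ pt2); sets.
    * by rewrite E !inE eqxx ?orbT ?andbF in t2X.
  + by rewrite E !inE eqxx ?orbT ?andbF in t1X.
Qed.

End Pendant.

(** c0 can replace x as the partner of s1, so A - c0 - y is randomly matchable. An edge from x to a
    vertex outside C would extend to a perfect matching there and match the odd set C - c0; hence
    the partner of x lies in C. *)
Lemma pendant_anti s1 s2 b A x y C c0 : cut e s1 s2 A [set b] ->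
  x \in A -> y \in A -> x != y -> e s1 x -> e s2 y ->
  closed_in e (A :\ x :\ y) C -> c0 \in C -> e s1 c0 ->
  anticomplete_to e [set x] (A :\ x :\ y :\: C) /\ exists2 d, d \in C & e x d.
Proof.
move=> c xA yA nxy s1x s2y [sC aC] c0C s1c0.
have rxy := cut_rmAaa e_sym e_irr EQ c xA yA nxy s1x s2y.
have c0A : c0 \in A by sets. have nc0x : c0 != x by sets. have nc0y : c0 != y by sets.
have r := cut_rmAaa e_sym e_irr EQ c c0A yA nc0y s1c0 s2y.
have pC : pm e C.
  have -> : C = (A :\ x :\ y) :&: C by sets.
  by apply: (pm_restrict e_sym e_irr) (rm_pm e_irr rxy) => // u v; rewrite (setIidPr sC); apply: aC.
have oC : odd #|C :\ c0| by rewrite odd_rem1 //; exact: (pm_even e_irr pC).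
have anti : anticomplete_to e [set x] (A :\ x :\ y :\: C).
  move=> _ d /set1P -> dC; apply/negP=> xd.
  have p : pm e (A :\ c0 :\ y :\ x :\ d) by apply: (rm_ext e_irr r) => //; sets.
  apply: (pm_odd e_irr oC).
  have -> : C :\ c0 = (A :\ c0 :\ y :\ x :\ d) :&: C by sets.
  by apply: (pm_restrict e_sym e_irr) p => u v uC vC; apply: aC; sets.
split=> //.
have xR : x \in A :\ c0 :\ y by sets.
have [d [dR xd _]] := pm_rem e_sym e_irr (rm_pm e_irr r) xR.
have nxd := adj_neq e_irr xd.
exists d => //; apply/negPn/negP=> dC; have := anti x d; rewrite set11 xd => /(_ isT) H.
by apply/negP: isT; apply: H; sets.
Qed.

Lemma cards3_le X s1 s2 b : s1 != s2 -> s1 != b -> s2 != b ->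
  s1 \in X -> s2 \in X -> b \in X -> 3 <= #|X|.
Proof.
by move=> n1 n2 n3 x1 x2 x3; rewrite -(cards3 n1 n2 n3); apply: subset_leq_card; sets.
Qed.

(* If [A :\ x :\ y] is disconnected, then [{x, y}] or [{x, s1}] is a cut whose
   odd side has at least three vertices. *)
Lemma pendant_conn s1 s2 b A x y : cut e s1 s2 A [set b] ->
  x \in A -> y \in A -> x != y -> e s1 x -> e s2 y -> conn e (A :\ x :\ y).
Proof.
move=> c xA yA nxy s1x s2y C cC C0; apply/eqP; apply/negPn/negP=> CA.
have cs := cut_sym c.
have rxy := cut_rmAaa e_sym e_irr EQ c xA yA nxy s1x s2y.
have [n12 AB dAB _ _] := c.
have nb1 := b_neq1 c; have nb2 := b_neq1 cs.
have bA := b_A c; have n1A := s1_notin c; have n2A := s1_notin cs; have nbA := b_notin c.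
set C' := A :\ x :\ y :\: C.
have [sC aC] := cC.
have EC' : A :\ x :\ y :\: C' = C by rewrite /C'; sets.
have cC' : closed_in e (A :\ x :\ y) C'.
  by split; [rewrite /C'; sets|rewrite EC'; apply: anticomplete_sym].
have C'0 : C' != set0.
  by rewrite setD_eq0; apply: contra CA => AC; rewrite eqEsubset sC.
have ev D : closed_in e (A :\ x :\ y) D -> ~~ odd #|D|.
  move=> [sD aD]; apply: (pm_even e_irr).
  have -> : D = (A :\ x :\ y) :&: D by sets.
  by apply: (pm_restrict e_sym e_irr) (rm_pm e_irr rxy) => // u v; rewrite (setIidPr sD); apply: aD.
have out D d v : D \subset A -> d \in D -> v \notin A -> v = s1 \/ v = s2 \/ ~~ e d v.
  move=> sD dD vA; case: (cut_case c v) => [|| |/set1P ->]; [by left|by right; left| |].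
    by move=> vA'; rewrite vA' in vA.
  by right; right; rewrite e_sym; apply: bA; sets.
have comm : A :\ x :\ y = A :\ y :\ x by sets.
have nyx : y != x by rewrite eq_sym.
(* A part seeing neither s1 nor s2 is cut off by {x, y}. *)
have free D : closed_in e (A :\ x :\ y) D -> D != set0 ->
    (forall d, d \in D -> ~~ e s1 d /\ ~~ e s2 d) -> False.
  move=> cD D0 H; have [sD aD] := cD.
  apply: (@no_even_part x y D nxy) => //; [by sets|by sets|exact: ev| |].
    move=> d v dD; rewrite !inE !negb_or => /and3P[vD vx vy].
    have [h1 h2] := H d dD.
    have [vA|vA] := boolP (v \in A); first by apply: aD => //; sets.
    have sDA : D \subset A by sets.
    by case: (out D d v sDA dD vA) => [->|[->|//]]; rewrite e_sym.
  have h1 : x != s1 by sets. have h2 : x != s2 by sets. have h3 : x != b by sets.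
  have h4 : y != s1 by sets. have h5 : y != s2 by sets. have h6 : y != b by sets.
  by apply: (@cards3_le _ s1 s2 b) => //; [by rewrite eq_sym|by rewrite eq_sym|by sets|by sets|by sets].
(* Here y and s2 see nothing in D, so {x, s1} cuts D off. *)
have mixed D d d' : closed_in e (A :\ x :\ y) D -> D != set0 -> 
    d \in D -> e s1 d -> d' \in A :\ x :\ y :\: D -> e s2 d' -> False.
  move=> cD D0 dD s1d d'D s2d'; have [sD aD] := cD.
  have cD' : closed_in e (A :\ y :\ x) (A :\ x :\ y :\: D).
    rewrite -comm; split; first by sets.
    have -> : A :\ x :\ y :\: (A :\ x :\ y :\: D) = D by sets.
    exact: anticomplete_sym.
  have [a1 _] := pendant_anti c xA yA nxy s1x s2y cD dD s1d.
  have [a2 [d2 d2D yd2]] := pendant_anti cs yA xA nyx s2y s1x cD' d'D s2d'.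
  have E : A :\ y :\ x :\: (A :\ x :\ y :\: D) = D by sets.
  rewrite E in a2.
  have noD2 v : v \in D -> ~~ e s2 v.
    move=> vD; apply/negP=> s2v.
    have cD2 : closed_in e (A :\ y :\ x) D by rewrite -comm.
    have [a3 _] := pendant_anti cs yA xA nyx s2y s1x cD2 vD s2v.
    have := a3 y d2; rewrite set11 yd2 => /(_ isT) H.
    by apply/negP: isT; apply: H; rewrite -comm.
  have nx1 : x != s1 by sets.
  have n1D : s1 \notin D by sets.
  apply: (@no_even_part x s1 D nx1) => //; [by sets|exact: ev| |].
    move=> v u vD; rewrite !inE !negb_or => /and3P[uD ux u1].
    have [uA|uA] := boolP (u \in A); last first.
      have sDA : D \subset A by sets.
      case: (out D v u sDA vD uA) => [E1|[->|//]]; first by rewrite E1 eqxx in u1.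
      by rewrite e_sym; apply: noD2.
    have [->|uy] := eqVneq u y; first by rewrite e_sym; apply: a2; rewrite ?set11.
    by apply: aD => //; sets.
  have h1 : y != b by sets. have h2 : y != s2 by sets. have h3 : y != s1 by sets.
  have h4 : b != x by sets. have h5 : s2 != x by sets.
  by apply: (@cards3_le _ y s2 b) => //; [by rewrite eq_sym|by sets|by sets|by sets].
have meets D : (exists2 d, d \in D & e s1 d) \/ (forall d, d \in D -> ~~ e s1 d).
  have [/existsP[d /andP[dD h]]|H] := boolP [exists d, (d \in D) && e s1 d].
    by left; exists d.
  by right=> d dD; apply: contra H => h; apply/existsP; exists d; rewrite dD.
have meets2 D : (exists2 d, d \in D & e s2 d) \/ (forall d, d \in D -> ~~ e s2 d).
  have [/existsP[d /andP[dD h]]|H] := boolP [exists d, (d \in D) && e s2 d].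
    by left; exists d.
  by right=> d dD; apply: contra H => h; apply/existsP; exists d; rewrite dD.
(* Applied to both parts, [pendant_anti] would give x a neighbour in C' and forbid it. *)
have notboth d d' : d \in C -> d' \in C' -> e s1 d -> e s1 d' -> False.
  move=> dC d'C s1d s1d'.
  have [a1 _] := pendant_anti c xA yA nxy s1x s2y cC dC s1d.
  have [_ [d2 d2C xd2]] := pendant_anti c xA yA nxy s1x s2y cC' d'C s1d'.
  have := a1 x d2; rewrite set11 xd2 => /(_ isT) H.
  by apply/negP: isT; apply: H.
have [[d dC s1d]|H1] := meets C.
  have [[d' d'C s2d']|H2'] := meets2 C'; first exact: (mixed C d d').
  apply: (free C') => // v vC'; split; last exact: H2'.
  by apply/negP=> s1v; apply: (notboth d v).
have [[d dC s2d]|H2] := meets2 C; last first.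
  by apply: (free C) => // v vC; split; [exact: H1|exact: H2].
have [[d' d'C s1d']|H1'] := meets C'.
  by apply: (mixed C' d' d) => //; rewrite EC'.
have [[d' d'C s2d']|H2'] := meets2 C'; last first.
  by apply: (free C') => // v vC; split; [exact: H1'|exact: H2'].
have cC2 : closed_in e (A :\ y :\ x) C by rewrite -comm.
have cC2' : closed_in e (A :\ y :\ x) C' by rewrite -comm.
have [a1 _] := pendant_anti cs yA xA nyx s2y s1x cC2 dC s2d.
have [_ [d2 d2C xd2]] := pendant_anti cs yA xA nyx s2y s1x cC2' d'C s2d'.
have := a1 y d2; rewrite set11 xd2 => /(_ isT) H.
by apply/negP: isT; apply: H; rewrite -comm.
Qed.

(** Otherwise {z, z'} separates the even rest of A from {s1, s2, b}. *)
Lemma pendant_not_equal s1 s2 b A z z' : cut e s1 s2 A [set b] -> z \in A -> z' \in A ->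
  z != z' -> (forall x, x \in A -> e s1 x || e s2 x -> x \in [set z; z']) -> False.
Proof.
move=> c zA z'A nzz' H; have cs := cut_sym c.
have [n12 AB dAB _ _] := c.
have evA := cut_evA e_sym e_irr FC c.
have nb1 := b_neq1 c; have nb2 := b_neq1 cs.
have bA := b_A c; have n1A := s1_notin c; have n2A := s1_notin cs; have nbA := b_notin c.
have A4 := A_ge4 c.
apply: (@no_even_part z z' (A :\ z :\ z')) => //; [by sets|by sets| | | |].
- by rewrite -card_gt0; move: A4; rewrite -(card_rem2 nzz' zA z'A); case: #|A :\ z :\ z'|.
- by move: evA; rewrite -(card_rem2 nzz' zA z'A) /= negbK.
- move=> u v; rewrite !inE => /and3P[uz' uz uA] vn.
  have nS : ~~ (e s1 u || e s2 u).
    by apply/negP=> h; have := H u uA h; rewrite !inE (negbTE uz) (negbTE uz').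
  rewrite negb_or in nS; case/andP: nS => h1 h2.
  case: (cut_case c v) => [->|->|vA|/set1P ->].
  + by rewrite e_sym.
  + by rewrite e_sym.
  + by move: vn; rewrite vA andbT !negb_or negb_and !negbK => /and3P[]; do 2 case: (_ == _).
  + by rewrite e_sym; apply: bA.
- have h1 : z != b by sets. have h2 : z != s2 by sets. have h3 : z != s1 by sets.
  have h4 : z' != b by sets. have h5 : z' != s2 by sets. have h6 : z' != s1 by sets.
  by apply: (@cards3_le _ s1 s2 b) => //; [by rewrite eq_sym|by rewrite eq_sym|by sets|by sets|by sets].
Qed.

Lemma cut_pendant s1 s2 b A : cut e s1 s2 A [set b] -> pendant e (e s1) (e s2) A.
Proof.
move=> c; have cs := cut_sym c.
have [a1 [a2 [a1A a2A na s1a1 s2a2]]] := cut_twoA e_sym e_irr FC TC c.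
split.
- move=> x y xA yA nxy s1x s2y; split; first exact: (cut_rmAaa e_sym e_irr EQ c).
  exact: (pendant_conn c).
- exact (cut_pmA e_sym e_irr FC c).
- exact: (A_ge4 c).
- by have [x xA /andP[s1x n]] := s1_two c a1A s1a1; exists x, a1.
- by have [x xA /andP[s1x n]] := s1_two cs a2A s2a2; exists x, a2.
- exact: (edge_s1A c).
- exact: (edge_s1A cs).
- exact: (no_exposed_s2 cs).
- exact: (no_exposed_s2 c).
- exact: (edge_AA c).
- move=> z z' zA z'A nzz' H; exact (pendant_not_equal c zA z'A nzz' H).
Qed.

End Small.
End Analysis.

(** * From a pendant vertex to a complete graph minus a triangle *)

Section Spike.
Variables (T : finType) (e : rel T).
Hypotheses (e_sym : symmetric e) (e_irr : irreflexive e).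
Implicit Types (X Y A B C D P Q R U I W N : {set T}) (x y z u v w b t : T).
Implicit Types (p : pred T).

(** The part of type V inside A: a complete graph minus the triangle a1, a2, w, where p1 and p2
    select the ends of the missing edges a1 w and a2 w. *)
Definition spike (p1 p2 : pred T) A := exists a1 a2 w,
  [/\ [/\ a1 \in A, a2 \in A & w \in A], [/\ a1 != a2, a1 != w & a2 != w],
      [/\ ~~ e a1 a2, ~~ e a1 w & ~~ e a2 w],
      {in A, forall x, p1 x = (x \in [set a1; w]) /\ p2 x = (x \in [set a2; w])} &
      6 <= #|A| /\ (forall x y, x \in A -> y \in A -> x != y -> ~~ e x y ->
         x \in [set a1; a2; w] /\ y \in [set a1; a2; w])].

(** Classes of at least two vertices make this shape exclude the complete one; K_{1,1} counts as
    complete. *)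
Definition balanced R := exists P Q,
  [/\ bip e P Q, R = P :|: Q, #|P| = #|Q| & 2 <= #|P|].

Lemma balanced_tf R u v w : balanced R -> u \in R -> v \in R -> w \in R ->
  e u v -> e v w -> e u w -> False.
Proof.
move=> [P [Q [[d iP iQ _] -> _ _]]]; rewrite !inE.
by move=> /orP[uP|uQ] /orP[vP|vQ] /orP[wP|wQ] uv vw uw;
  first [ by move: (iP u v uP vP); rewrite uv | by move: (iQ u v uQ vQ); rewrite uv
        | by move: (iP v w vP wP); rewrite vw | by move: (iQ v w vQ wQ); rewrite vw
        | by move: (iP u w uP wP); rewrite uw | by move: (iQ u w uQ wQ); rewrite uw].
Qed.

Lemma balanced_twin R u v t : balanced R -> u \in R -> v \in R -> t \in R ->
  ~~ e u v -> e u t -> e v t.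
Proof.
move=> [P [Q [[d iP iQ c] -> _ _]]]; rewrite !inE.
move=> /orP[uP|uQ] /orP[vP|vQ] /orP[tP|tQ] uv ut; first
  [ by move: uv; rewrite c | by move: uv; rewrite e_sym c
  | by rewrite c | by rewrite e_sym c
  | by move: (iP u t uP tP); rewrite ut | by move: (iQ u t uQ tQ); rewrite ut].
Qed.

Lemma balanced_deg R u : balanced R -> u \in R ->
  #|[set q in R | e u q]|.*2 = #|R|.
Proof.
move=> [P [Q [[d iP iQ c] -> E _]]]; have cR : #|P :|: Q| = #|P| + #|Q|.
  by rewrite cardsU disjoint_setI0 // cards0 subn0.
rewrite cR => uPQ; have {uPQ} [uP|uQ] : u \in P \/ u \in Q by apply/orP; move: uPQ; rewrite inE.
  have -> : [set q in P :|: Q | e u q] = Q; last by lia.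
  apply/setP=> q; rewrite !inE; have [qQ|qQ] := boolP (q \in Q); first by rewrite orbT c.
  by rewrite orbF; have [qP|//] := boolP (q \in P); apply: negbTE; apply: iP.
have -> : [set q in P :|: Q | e u q] = P; last by lia.
apply/setP=> q; rewrite !inE; have [qP|qP] := boolP (q \in P); first by rewrite /= e_sym c.
by have [qQ|//] := boolP (q \in Q); apply: negbTE; apply: iQ.
Qed.

(** Each class contains two non-adjacent vertices, so z would have to lie in both. *)
Lemma balanced_not_clique R z : balanced R -> clique e (R :\ z) -> False.
Proof.
move=> [P [Q [[d iP iQ c] -> E P2]]] k.
have le X : X \subset P :|: Q -> 2 <= #|X| -> independent e X -> z \in X.
  move=> sX /card_gt1P[x [y [xX yX nxy]]] iX; apply/negPn/negP=> zX.
  have nxz : x != z by apply: contraNneq zX => <-.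
  have nyz : y != z by apply: contraNneq zX => <-.
  by have := iX x y xX yX; rewrite k //; sets.
have zP : z \in P by apply: le => //; sets.
have zQ : z \in Q by apply: le => //; [sets|rewrite -E].
by have := disjoint_notin d zP; rewrite zQ.
Qed.

Lemma pendant_sym p1 p2 A : pendant e p1 p2 A -> pendant e p2 p1 A.
Proof.
case=> h1 h2 h3 h4 h5 h6 h7 h8 h9 h10 h11; split=> //.
- move=> x y xA yA nxy px py; have -> : A :\ x :\ y = A :\ y :\ x by sets.
  by apply: h1 => //; rewrite eq_sym.
- move=> a a' aA a'A aa'; case: (h10 a a' aA a'A aa').
  + by constructor 2.
  + by constructor 1.
  + move=> [t1 [t2 [pt1 pt2 t1A t2A p]]]; constructor 3; exists t2, t1.
    have n12 : t1 != t2 by sets.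
    by split=> //; [sets|sets|apply: (pm_eq p); sets].
  + move=> [w [t [aw wA tA pt p]]]; constructor 4; exists w, t; split=> //.
    by rewrite orbC.
- by move=> z z' zA z'A n H; apply: (h11 z z') => // x xA px; apply: H => //; rewrite orbC.
Qed.

Section Cases.
Variables (A : {set T}).
Let K x y := clique e (A :\ x :\ y).

Lemma pd_shape p1 p2 x y : pendant e p1 p2 A ->
  x \in A -> y \in A -> x != y -> p1 x -> p2 y ->
  K x y \/ balanced (A :\ x :\ y).
Proof.
move=> H xA yA nxy px py; have [r c] := pd_rm H xA yA nxy px py.
case: (sumner e_sym e_irr r c) => [|[P [Q [b E cPQ]]]]; first by left.
have [P2|P1] := leqP 2 #|P|; first by right; exists P, Q.
left=> u v; have [d _ _ k] := b.
rewrite E !inE => /orP[uP|uQ] /orP[vP|vQ] nuv.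
- by rewrite (@card_le1_eq _ P u v) ?eqxx in nuv.
- exact: k.
- by rewrite e_sym; apply: k.
- by rewrite (@card_le1_eq _ Q u v) -?cPQ ?eqxx in nuv.
Qed.

(** The remainders A - x - y and A - x - y' share all but one vertex of each, and a balanced graph
    stays incomplete when a single vertex is removed. *)
Lemma pd_step p1 p2 x y y' : pendant e p1 p2 A ->
  x \in A -> y \in A -> y' \in A -> x != y -> x != y' -> p1 x -> p2 y -> p2 y' ->
  K x y -> K x y'.
Proof.
move=> H xA yA y'A nxy nxy' px py py' k.
case: (pd_shape H xA y'A nxy' px py') => // b.
by case: (balanced_not_clique (z := y) b); apply: cliqueS k; sets.
Qed.

Lemma K_sym x y : K x y -> K y x.
Proof. by rewrite /K => k; apply: cliqueS k; sets. Qed.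

(** The shape is carried over by changing one entry of the pair at a time, in an order that avoids a
    pair of equal vertices. *)
Lemma pd_all p1 p2 x y x' y' : pendant e p1 p2 A ->
  x \in A -> y \in A -> x != y -> p1 x -> p2 y -> K x y ->
  x' \in A -> y' \in A -> x' != y' -> p1 x' -> p2 y' -> K x' y'.
Proof.
move=> H xA yA nxy px py k x'A y'A nxy' px' py'.
have Hs := pendant_sym H.
have step2 u v u' : u \in A -> v \in A -> u' \in A -> u != v -> u' != v ->
    p1 u -> p2 v -> p1 u' -> K u v -> K u' v.
  move=> uA vA u'A nuv nu'v pu pv pu' /K_sym k'; apply: K_sym.
  by apply: (pd_step Hs vA uA u'A) => //; rewrite eq_sym.
have [E|n1] := eqVneq x y'; last first.
  by apply: (step2 x) => //; apply: (pd_step H xA yA).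
have [E'|n2] := eqVneq x' y.
  by rewrite E' -E; apply: K_sym.
apply: (pd_step H x'A yA) => //; exact: (step2 x).
Qed.

Lemma other_pair p a : (exists x x', [/\ x \in A, x' \in A, x != x', p x & p x']) ->
  exists2 x, x \in A & p x && (x != a).
Proof.
move=> [x [x' [xA x'A n px px']]]; have [E|n'] := eqVneq x a.
  by exists x' => //; rewrite px' -E eq_sym.
by exists x => //; rewrite px.
Qed.

Section Clique.
Variables (p1 p2 : pred T).
Hypothesis H : pendant e p1 p2 A.
Hypothesis allK : forall x y, x \in A -> y \in A -> x != y -> p1 x -> p2 y -> K x y.

Lemma pd_cover u v x y : u \in A -> v \in A -> u != v -> ~~ e u v ->
  x \in A -> y \in A -> x != y -> p1 x -> p2 y ->
  [\/ x = u, x = v, y = u | y = v].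
Proof.
move=> uA vA nuv uv xA yA nxy px py; have k := allK xA yA nxy px py.
have [->|n1] := eqVneq x u; first by constructor 1.
have [->|n2] := eqVneq x v; first by constructor 2.
have [->|n3] := eqVneq y u; first by constructor 3.
have [->|n4] := eqVneq y v; first by constructor 4.
by move: uv; rewrite k //; sets.
Qed.

Lemma pd_common : exists2 z, z \in A & p1 z && p2 z.
Proof.
have [x [x' [xA x'A nxx' px px']]] := pd_two1 H.
have [w [wA nwx pw xw _]] := pd_edge1 H xA px.
have nxw : x != w by rewrite eq_sym.
have [y yA /andP[py nyw]] := other_pair w (pd_two2 H).
have [yx|nyx] := eqVneq y x; first by exists y => //; rewrite {1}yx px.
have [yx'|nyx'] := eqVneq y x'; first by exists y => //; rewrite {1}yx' px'.
rewrite eq_sym in nyx'.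
case: (pd_cover xA wA nxw xw x'A yA nyx' px' py) => E.
- by rewrite E eqxx in nxx'.
- by rewrite -E px' in pw.
- by rewrite E eqxx in nyx.
- by rewrite E eqxx in nyw.
Qed.

(** Let z satisfy both p1 and p2. Its non-neighbour w supplied by [pd_edge1] turns out to be the
    other vertex of p2, and its non-neighbour w' supplied by [pd_edge2] the other vertex of p1. *)
Lemma clique_spike : spike p1 p2 A.
Proof.
have [z zA /andP[p1z p2z]] := pd_common.
have [w [wA nwz p1w zw _]] := pd_edge1 H zA p1z.
have [w' [w'A nw'z p2w' zw' _]] := pd_edge2 H zA p2z.
have nzw : z != w by rewrite eq_sym. have nzw' : z != w' by rewrite eq_sym.
have N2 x y : x \in A -> p1 x -> x != z -> y \in A -> p2 y -> [\/ y = z, y = w | y = x].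
  move=> xA px nxz yA py; have [->|nxy] := eqVneq y x; first by constructor 3.
  rewrite eq_sym in nxy.
  case: (pd_cover zA wA nzw zw xA yA nxy px py) => E; [by rewrite E eqxx in nxz| |by constructor 1|by constructor 2].
  by rewrite -E px in p1w.
have N1 y x : y \in A -> p2 y -> y != z -> x \in A -> p1 x -> [\/ x = z, x = w' | x = y].
  move=> yA py nyz xA px; have [->|nxy] := eqVneq x y; first by constructor 3.
  case: (pd_cover zA w'A nzw' zw' xA yA nxy px py) => E; [by constructor 1|by constructor 2|by rewrite E eqxx in nyz|].
  by rewrite -E py in p2w'.
(* Two common vertices z and z' would exhaust p1 and p2 in A, which [pd_spread] excludes. *)
have [/existsP[z' /and4P[z'A nz'z p1z' p2z']]|uz] := boolP [exists z', [&& z' \in A, z' != z, p1 z' & p2 z']].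
  have nzz' : z != z' by rewrite eq_sym.
  exfalso; apply: (pd_spread H zA z'A nzz') => x xA /orP[px|px]; rewrite !inE.
    case: (N1 z' x z'A p2z' nz'z xA px) => E; rewrite E ?eqxx ?orbT //.
    rewrite {x}E in xA px *; exfalso.
    have [v [vA nv pv wv _]] := pd_edge1 H w'A px.
    have nw'v : w' != v by rewrite eq_sym.
    case: (pd_cover w'A vA nw'v wv zA z'A nzz' p1z p2z') => E.
    - by rewrite E eqxx in nzw'.
    - by rewrite -E p1z in pv.
    - by rewrite -E p2z' in p2w'.
    - by rewrite -E p1z' in pv.
  case: (N2 z' x z'A p1z' nz'z xA px) => E; rewrite E ?eqxx ?orbT //.
  rewrite {x}E in xA px *; exfalso.
  have [v [vA nv pv wv _]] := pd_edge2 H wA px.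
  have nwv : w != v by rewrite eq_sym.
  case: (pd_cover wA vA nwv wv z'A zA nz'z p1z' p2z) => E.
  - by rewrite -E p1z' in p1w.
  - by rewrite -E p2z' in pv.
  - by rewrite E eqxx in nzw.
  - by rewrite -E p2z in pv.
have uz' x : x \in A -> x != z -> p1 x -> p2 x -> False.
  by move=> xA nx px px'; case/negP: uz; apply/existsP; exists x; rewrite xA nx px.
have [x xA /andP[p1x nxz]] := other_pair z (pd_two1 H).
have [y yA /andP[p2y nyz]] := other_pair z (pd_two2 H).
have Ey : y = w.
  case: (N2 x y xA p1x nxz yA p2y) => // E; first by rewrite E eqxx in nyz.
  by case: (uz' x) => //; rewrite -E.
have Ex : x = w'.
  case: (N1 y x yA p2y nyz xA p1x) => // E; first by rewrite E eqxx in nxz.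
  by case: (uz' x) => //; rewrite E.
rewrite {x}Ex in xA p1x nxz; rewrite {y}Ey in yA p2y nyz.
have nww' : w' != w by apply: contraNneq p1w => <-.
have w'w : ~~ e w' w.
  have [v [vA nv pv wv _]] := pd_edge1 H w'A p1x.
  have nw'v : w' != v by rewrite eq_sym.
  case: (pd_cover w'A vA nw'v wv zA wA nzw p1z p2y) => E.
  - by rewrite E eqxx in nzw'.
  - by rewrite -E p1z in pv.
  - by rewrite E eqxx in nww'.
  - by rewrite E.
exists w', w, z; split=> //.
- by split=> //; rewrite e_sym.
- move=> u uA; rewrite !inE; split; apply/idP/idP.
  + move=> pu; case: (N1 w u wA p2y nwz uA pu) => E; rewrite E ?eqxx ?orbT //.
    by rewrite -E pu in p1w.
  + by move=> /orP[] /eqP ->.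
  + move=> pu; case: (N2 w' u w'A p1x nw'z uA pu) => E; rewrite E ?eqxx ?orbT //.
    by rewrite -E pu in p2w'.
  + by move=> /orP[] /eqP ->.
split.
  (* The three independent vertices w', w, z make up at most half of the matchable set A. *)
  have A4 := pd_ge4 H; have evA := pm_even e_irr (pd_pm H).
  rewrite ltnNge; apply/negP => A5.
  have zw'' : ~~ e w' z by rewrite e_sym.
  have wz : ~~ e w z by rewrite e_sym.
  have sI : [set w'; w; z] \subset A by sets.
  have := pm_indep e_irr (pd_pm H) sI (independent3 e_sym e_irr w'w zw'' wz).
  rewrite cards3 //; move: A4 A5 evA; clear; case: #|A| => [|[|[|[|[|[|]]]]]] //.
move=> u v uA vA nuv uv.
(* A missing edge meets each of the three pairs inside {w', w, z}, so both its ends are among these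
   vertices. *)
have c1 := pd_cover uA vA nuv uv w'A zA nw'z p1x p2z.
have c2 := pd_cover uA vA nuv uv w'A wA nww' p1x p2y.
have c3 := pd_cover uA vA nuv uv zA wA nzw p1z p2y.
have in3 s : s = w' \/ s = w \/ s = z -> s \in [set w'; w; z].
  by rewrite !inE => -[->|[->|->]]; rewrite eqxx ?orbT.
move/eqP: nw'z => d1; move/eqP: nww' => d2; move/eqP: nzw => d3.
split; apply: in3; case: c1 => E1; case: c2 => E2; case: c3 => E3;
  clear - d1 d2 d3 E1 E2 E3; intuition congruence.
Qed.

End Clique.
(** The unordered form of a pair of distinct neighbours, one for each cut vertex. *)
Definition cross (p1 p2 : pred T) x y :=
  [/\ x \in A, y \in A, x != y & (p1 x /\ p2 y) \/ (p1 y /\ p2 x)].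

Lemma cross_sym p1 p2 x y : cross p1 p2 x y -> cross p1 p2 y x.
Proof. by case=> *; split=> //; [rewrite eq_sym|tauto]. Qed.

Lemma cross_swap p1 p2 x y : cross p1 p2 x y -> cross p2 p1 x y.
Proof. by case=> *; split=> //; tauto. Qed.

Lemma cross_rm p1 p2 x y : pendant e p1 p2 A -> cross p1 p2 x y -> rm e (A :\ x :\ y).
Proof.
move=> H [xA yA nxy [[px py]|[py px]]]; first by have [] := pd_rm H xA yA nxy px py.
have nyx : y != x by rewrite eq_sym.
have -> : A :\ x :\ y = A :\ y :\ x by sets.
by have [] := pd_rm H yA xA nyx py px.
Qed.

Definition all_balanced p1 p2 := forall x y, cross p1 p2 x y -> balanced (A :\ x :\ y).

(** The first three cases of [pd_inner] for an edge uv demand two distinct neighbours of the cut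
    besides u and v, and only t is left. In the last case t goes with a vertex w, and random
    matchability of A - v - t makes u adjacent to w. *)
Lemma triple_nonadj p1 p2 u v t : pendant e p1 p2 A -> 
  cross p1 p2 u v -> cross p1 p2 v t ->
  (forall x, x \in A -> p1 x || p2 x -> x \in [set u; v; t]) -> ~~ e u v.
Proof.
move=> H uv vt D; have [uA vA nuv _] := uv; have [_ tA nvt _] := vt.
have only p x y : (forall z, p z -> p1 z || p2 z) -> x \in A -> y \in A -> p x -> p y ->
    ~~ p u -> ~~ p v -> x = y.
  move=> sp xA yA px py pu pv.
  have E z : z \in A -> p z -> z = t.
    move=> zA pz; have := D z zA (sp z pz); rewrite !inE => /orP[/orP[]|] /eqP E //.
      by rewrite -E pz in pu.
    by rewrite -E pz in pv.
  by rewrite (E x) // (E y).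
apply/negP=> euv; case: (pd_inner H uA vA euv).
- move=> [pu pv]; have [x [x' [xA x'A /eqP n px px']]] := pd_two1 H.
  by apply: n; apply: (only p1) => // z ->.
- move=> [pu pv]; have [x [x' [xA x'A /eqP n px px']]] := pd_two2 H.
  by apply: n; apply: (only p2) => // z ->; rewrite orbT.
- move=> [t1 [t2 [pt1 pt2 t1A t2A _]]].
  have t1A' : t1 \in A by sets. have t2A' : t2 \in A by sets.
  have n12 : t1 != t2 by sets.
  have h1 := D t1 t1A'; rewrite pt1 in h1. have h2 := D t2 t2A'; rewrite pt2 orbT in h2.
  have E1 : t1 = t by move: (h1 isT) t1A; rewrite !inE => /orP[/orP[]|] /eqP -> //; rewrite eqxx ?andbF.
  have E2 : t2 = t by move: (h2 isT) t2A; rewrite !inE => /orP[/orP[]|] /eqP -> //; rewrite eqxx ?andbF.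
  by rewrite E1 E2 eqxx in n12.
- move=> [w [z [uw wA zA pz p]]]; have zA' : z \in A by sets.
  have E : z = t by move: (D z zA' pz) zA; rewrite !inE => /orP[/orP[]|] /eqP -> //; rewrite eqxx ?andbF.
  rewrite {z}E in zA pz p zA'; have nut : u != t by sets.
  case/negP: uw; apply: (rm_adj e_sym e_irr (cross_rm H vt)); [by sets|by sets|by sets|].
  by apply: (pm_eq p); sets.
Qed.

(** The three vertices are pairwise non-adjacent. Their partners in a perfect matching of A become
    pairwise adjacent by exchange, a triangle in the bipartite graph A - u - v. *)
Lemma triple_absurd p1 p2 u v t : pendant e p1 p2 A -> all_balanced p1 p2 ->
  cross p1 p2 u v -> cross p1 p2 v t -> cross p1 p2 u t ->
  (forall x, x \in A -> p1 x || p2 x -> x \in [set u; v; t]) -> False.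
Proof.
move=> H B uv vt ut D.
have D' a b c x : [set u; v; t] = [set a; b; c] -> x \in A -> p1 x || p2 x -> x \in [set a; b; c].
  by move=> <-; apply: D.
have nuv := triple_nonadj H uv vt D.
have nvt : ~~ e v t.
  by apply: (triple_nonadj H vt (cross_sym ut)) => x; apply: D'; sets.
have nut : ~~ e u t.
  by apply: (triple_nonadj H ut (cross_sym vt)) => x; apply: D'; sets.
have [uA vA duv _] := uv; have [_ tA dvt _] := vt; have [_ _ dut _] := ut.
have [u1 [u1A uu1 q1]] := pm_rem e_sym e_irr (pd_pm H) uA.
have n1 := adj_neq e_irr uu1.
have nu1v : u1 != v by apply: contraNneq nuv => <-.
have nu1t : u1 != t by apply: contraNneq nut => <-.
have vA1 : v \in A :\ u :\ u1 by sets.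
have [v1 [v1A vv1 q2]] := pm_rem e_sym e_irr q1 vA1.
have n2 := adj_neq e_irr vv1.
have nv1t : v1 != t by apply: contraNneq nvt => <-.
have tA2 : t \in A :\ u :\ u1 :\ v :\ v1 by sets.
have [t1 [t1A tt1 q3]] := pm_rem e_sym e_irr q2 tA2.
have n3 := adj_neq e_irr tt1.
have e1 : e u1 v1.
  apply: (rm_adj e_sym e_irr (cross_rm H uv)); [by sets|by sets|by sets|].
  by pmadd t t1; apply: (pm_eq q3); sets.
have e2 : e v1 t1.
  apply: (rm_adj e_sym e_irr (cross_rm H vt)); [by sets|by sets|by sets|].
  by pmadd u u1; apply: (pm_eq q3); sets.
have e3 : e u1 t1.
  apply: (rm_adj e_sym e_irr (cross_rm H ut)); [by sets|by sets|by sets|].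
  by pmadd v v1; apply: (pm_eq q3); sets.
by apply: (balanced_tf (B u v uv) _ _ _ e1 e2 e3); sets.
Qed.

(** Here x sees y and y', and the non-neighbour w from [pd_edge1] is a twin of x in A - x' - y'. The
    neighbours of x there, together with y', form an independent set of |A|/2 vertices, too large
    for the matchable set A - x - w. *)
Lemma four_adjacent p1 p2 x x' y y' : pendant e p1 p2 A -> all_balanced p1 p2 ->
  x \in A -> x' \in A -> y \in A -> y' \in A -> p1 x -> p1 x' -> p2 y -> p2 y' ->
  x != x' -> y != y' -> x != y -> x != y' -> x' != y -> x' != y' ->
  pm e (A :\ x :\ x' :\ y :\ y') -> False.
Proof.
move=> H B xA x'A yA y'A px px' py py' nxx nyy nxy nxy' nx'y nx'y' pC.
have hxy : cross p1 p2 x y by split=> //; left.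
have hxy' : cross p1 p2 x y' by split=> //; left.
have hx'y : cross p1 p2 x' y by split=> //; left.
have hx'y' : cross p1 p2 x' y' by split=> //; left.
have exy : e x y.
  apply: (rm_adj e_sym e_irr (cross_rm H hx'y')) => //; [by sets|by sets|by apply: (pm_eq pC); sets].
have exy' : e x y'.
  apply: (rm_adj e_sym e_irr (cross_rm H hx'y)) => //; [by sets|by sets|by apply: (pm_eq pC); sets].
have [w [wA nwx pw xw q]] := pd_edge1 H xA px.
have nwx' : w != x' by apply: contraNneq pw => ->.
have nwy : w != y by apply: contraNneq xw => ->.
have nwy' : w != y' by apply: contraNneq xw => ->.
have p2xw : p2 x || p2 w.
  apply/negPn; rewrite negb_or; apply/negP=> /andP[h1 h2].
  have nxw : x != w by rewrite eq_sym.
  exact: (pd_exp2 H xA wA nxw xw h1 h2).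
have B1 := B _ _ hx'y'. have B2 := B _ _ hx'y.
have wy : e w y by apply: (balanced_twin B1 _ _ _ xw exy); sets.
have wy' : e w y' by apply: (balanced_twin B2 _ _ _ xw exy'); sets.
have nyy' : ~~ e y y'.
  apply/negP=> yy'; case/orP: p2xw => h.
    have h' : cross p1 p2 x' x by split=> //; [by rewrite eq_sym|by left].
    by apply: (balanced_tf (B _ _ h') _ _ _ wy yy' wy'); sets.
  have h' : cross p1 p2 x' w by split=> //; [by rewrite eq_sym|by left].
  by apply: (balanced_tf (B _ _ h') _ _ _ exy yy' exy'); sets.
have dg := balanced_deg B1 (u := x).
set Q := [set q in A :\ x' :\ y' | e x q] in dg.
have Qx q0 : q0 \in Q -> q0 \in A :\ x' :\ y' /\ e x q0 by rewrite inE => /andP[].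
have iI : independent e (y' |: Q).
  have one q0 : q0 \in Q -> ~~ e q0 y'.
    move=> /Qx[qR xq]; have [->//|nqy] := eqVneq q0 y.
    by apply/negP=> qy'; apply: (balanced_tf B2 _ _ _ xq qy' exy'); sets.
  move=> a a'; rewrite !in_setU1 => /orP[/eqP->|aQ] /orP[/eqP->|a'Q].
  - by rewrite e_irr.
  - by rewrite e_sym; apply: one.
  - exact: one.
  - have [aR xa] := Qx a aQ; have [a'R xa'] := Qx a' a'Q.
    by apply/negP=> aa'; apply: (balanced_tf B1 _ _ _ xa aa' xa'); sets.
have xQ : x \notin Q by apply/negP=> /Qx[]; rewrite e_irr.
have wQ : w \notin Q by apply/negP=> /Qx[_]; rewrite (negbTE xw).
have y'Q : y' \notin Q by apply/negP=> /Qx[]; rewrite !inE eqxx.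
have sQ : Q \subset A by apply/subsetP=> z /Qx[]; sets.
have sI : y' |: Q \subset A :\ x :\ w by clearbody Q; sets.
have := pm_indep e_irr q sI iI; rewrite cardsU1 y'Q.
have nxw : x != w by rewrite eq_sym.
have := card_rem2 nxw xA wA; have := card_rem2 nx'y' x'A y'A.
rewrite -dg; last by sets. clear; lia.
Qed.

(** Since the rest is not matchable, no edge joins {x, x'} to {y, y'}. Q is the set of neighbours of
    x in A - x' - y'; twin arguments in the four balanced remainders make it complete to everything
    else. Only xx' and yy' stay undecided, as each remainder omits one end of both. *)
Lemma four_nonadjacent p1 p2 x x' y y' : pendant e p1 p2 A -> all_balanced p1 p2 ->
  x \in A -> x' \in A -> y \in A -> y' \in A -> p1 x -> p1 x' -> p2 y -> p2 y' ->
  x != x' -> y != y' -> x != y -> x != y' -> x' != y -> x' != y' ->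
  ~ pm e (A :\ x :\ x' :\ y :\ y') ->
  exists Q, [/\ Q \subset A :\ x :\ x' :\ y :\ y', #|Q|.*2.+2 = #|A|, 2 <= #|Q|, independent e Q &
    complete_to e Q (A :\: Q) /\
    (forall g h, g \in A :\: Q -> h \in A :\: Q -> e g h ->
      [\/ g = x /\ h = x', g = x' /\ h = x, g = y /\ h = y' | g = y' /\ h = y])].
Proof.
move=> H B xA x'A yA y'A px px' py py' nxx nyy nxy nxy' nx'y nx'y' pC.
have hxy : cross p1 p2 x y by split=> //; left.
have hxy' : cross p1 p2 x y' by split=> //; left.
have hx'y : cross p1 p2 x' y by split=> //; left.
have hx'y' : cross p1 p2 x' y' by split=> //; left.
have B1 := B _ _ hx'y'. have B2 := B _ _ hx'y. have B3 := B _ _ hxy'. have B4 := B _ _ hxy.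
have exy : ~~ e x y.
  apply/negP=> E; apply: pC; have := rm_ext e_irr (cross_rm H hx'y') _ _ E.
  by move=> q; apply: (pm_eq (q _ _)); sets.
have exy' : ~~ e x y'.
  apply/negP=> E; apply: pC; have := rm_ext e_irr (cross_rm H hx'y) _ _ E.
  by move=> q; apply: (pm_eq (q _ _)); sets.
have ex'y : ~~ e x' y.
  apply/negP=> E; apply: pC; have := rm_ext e_irr (cross_rm H hxy') _ _ E.
  by move=> q; apply: (pm_eq (q _ _)); sets.
have ex'y' : ~~ e x' y'.
  apply/negP=> E; apply: pC; have := rm_ext e_irr (cross_rm H hxy) _ _ E.
  by move=> q; apply: (pm_eq (q _ _)); sets.
have dg : #|[set q in A :\ x' :\ y' | e x q]|.*2 = #|A :\ x' :\ y'|.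
  by apply: balanced_deg => //; sets.
set Q := [set q in A :\ x' :\ y' | e x q] in dg.
have R4 : 4 <= #|A :\ x' :\ y'|.
  have [P1 [P2 [[d _ _ _] E cP P12]]] := B1.
  by rewrite E cardsU disjoint_setI0 // cards0 -cP; move: P12; clear; lia.
have Qx q0 : q0 \in Q -> q0 \in A :\ x' :\ y' /\ e x q0 by rewrite inE => /andP[].
have Qi q0 : q0 \in A :\ x' :\ y' -> q0 \notin Q -> ~~ e x q0.
  by move=> qR; rewrite inE qR.
have xQ : x \notin Q by apply/negP=> /Qx[]; rewrite e_irr.
have yQ : y \notin Q by apply/negP=> /Qx[_]; rewrite (negbTE exy).
have x'Q : x' \notin Q by apply/negP=> /Qx[]; rewrite !inE eqxx ?andbF.
have y'Q : y' \notin Q by apply/negP=> /Qx[]; rewrite !inE eqxx.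
have sQ : Q \subset A by apply/subsetP=> z /Qx[]; sets.
clearbody Q.
have eyx : ~~ e y x by rewrite e_sym. have ey'x : ~~ e y' x by rewrite e_sym.
have eyx' : ~~ e y x' by rewrite e_sym. have ey'x' : ~~ e y' x' by rewrite e_sym.
have Qy q : q \in Q -> e y q.
  by move=> qQ; have [qR xq] := Qx q qQ; apply: (balanced_twin B1 _ _ _ exy xq); sets.
have Qy' q : q \in Q -> e y' q.
  by move=> qQ; have [qR xq] := Qx q qQ; apply: (balanced_twin B2 _ _ _ exy' xq); sets.
have Qx' q : q \in Q -> e x' q.
  by move=> qQ; have yq := Qy q qQ; apply: (balanced_twin B3 _ _ _ eyx' yq); sets.
have Qp q (p : T) : p \in A :\ x :\ x' :\ y :\ y' -> p \notin Q -> q \in Q -> e p q.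
  move=> pC' pQ qQ; have [qR xq] := Qx q qQ.
  have xp : ~~ e x p by apply: Qi => //; sets.
  by apply: (balanced_twin B1 _ _ _ xp xq); sets.
have px_ (p : T) : p \in A :\ x :\ x' :\ y :\ y' -> p \notin Q -> 
    [/\ ~~ e p x, ~~ e p x', ~~ e p y & ~~ e p y'].
  move=> pC' pQ; have xp : ~~ e x p by apply: Qi => //; sets.
  have py_ : ~~ e p y.
    by apply/negP=> E; case/negP: exy; apply: (balanced_twin B1 _ _ _ _ E); [sets|sets|sets|rewrite e_sym].
  split=> //; first by rewrite e_sym.
    by apply/negP=> E; case/negP: eyx'; apply: (balanced_twin B3 _ _ _ py_ E); sets.
  by apply/negP=> E; case/negP: exy'; apply: (balanced_twin B2 _ _ _ _ E); [sets|sets|sets|rewrite e_sym].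
exists Q; split.
- by sets.
- by rewrite dg card_rem2.
- by move: dg R4; clear; lia.
- move=> a a' /Qx[aR xa] /Qx[a'R xa'].
  by apply/negP=> aa'; apply: (balanced_tf B1 _ _ _ xa aa' xa'); sets.
have classify g : g \in A :\: Q -> [\/ g = x, g = x', g = y | g = y' \/ 
    g \in A :\ x :\ x' :\ y :\ y' /\ g \notin Q].
  rewrite inE => /andP[gQ gA].
  have [->|g1] := eqVneq g x; first by constructor 1.
  have [->|g2] := eqVneq g x'; first by constructor 2.
  have [->|g3] := eqVneq g y; first by constructor 3.
  have [->|g4] := eqVneq g y'; first by constructor 4; left.
  by constructor 4; right; split=> //; sets.
split.
  move=> q g qQ /classify[->|->|->|[->|[gC gQ]]]; rewrite e_sym;
    [by have [] := Qx q qQ|exact: Qx'|exact: Qy|exact: Qy'|exact: Qp].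
move=> g h gW hW gh.
case: (classify g gW) => [E|E|E|[E|[gC gQ]]]; case: (classify h hW) => [E'|E'|E'|[E'|[hC hQ]]];
  rewrite ?E ?E' ?e_irr ?(negbTE exy) ?(negbTE exy') ?(negbTE ex'y) ?(negbTE ex'y')
    ?(negbTE eyx) ?(negbTE ey'x) ?(negbTE eyx') ?(negbTE ey'x') // in gh;
  try (by [constructor 1|constructor 2|constructor 3|constructor 4]);
  try (by have [h1 h2 h3 h4] := px_ h hC hQ; move: gh; rewrite e_sym ?(negbTE h1) ?(negbTE h2) ?(negbTE h3) ?(negbTE h4));
  try (by have [h1 h2 h3 h4] := px_ g gC gQ; move: gh; rewrite ?(negbTE h1) ?(negbTE h2) ?(negbTE h3) ?(negbTE h4)).
have [h1 _ _ _] := px_ g gC gQ; have xh : ~~ e x h by apply: Qi => //; sets.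
by case/negP: xh; apply: (balanced_twin B1 _ _ _ _ gh); [sets|sets|sets|rewrite e_sym; rewrite e_sym].
Qed.

(** Let W be A without Q; it has two vertices more than Q. The edge xx' forms a triangle with each
    vertex of Q, and every [cross] pair must destroy all of them, which helps to keep p1 and p2 out
    of Q. Criticality of xx' then forces W = {x, x', y, y'} and |Q| = 2, and the edges xx' and yy'
    leave Q exposed against [pd_exp1]. *)
Lemma four_edge p1 p2 x x' y y' : pendant e p1 p2 A -> all_balanced p1 p2 ->
  x \in A -> x' \in A -> y \in A -> y' \in A -> p1 x -> p1 x' -> p2 y -> p2 y' ->
  x != x' -> y != y' -> x != y -> x != y' -> x' != y -> x' != y' ->
  ~ pm e (A :\ x :\ x' :\ y :\ y') -> e x x' -> False.
Proof.
move=> H B xA x'A yA y'A px px' py py' nxx nyy nxy nxy' nx'y nx'y' pC exx'.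
have [Q [sQ cQ Q2 iQ [kQ adjW]]] := four_nonadjacent H B xA x'A yA y'A px px' py py' nxx nyy nxy nxy' nx'y nx'y' pC.
have xW : x \in A :\: Q by sets. have x'W : x' \in A :\: Q by sets.
have yW : y \in A :\: Q by sets. have y'W : y' \in A :\: Q by sets.
have sQA : Q \subset A by sets.
have cW : #|A :\: Q| = #|Q| + 2.
  by have := cardsID Q A; rewrite (setIidPr sQA); move: cQ; clear; lia.
have pmW g h : g \in A :\: Q -> h \in A :\: Q -> g != h -> pm e (A :\ g :\ h).
  move=> gW hW ngh.
  have -> : A :\ g :\ h = Q :|: ((A :\: Q) :\ g :\ h) by sets.
  apply: pm_bip => //; [|by sets|].
    by move=> q w qQ; rewrite !inE => /and3P[_ _ wW]; apply: kQ => //; rewrite inE.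
  by have := card_rem2 ngh gW hW; rewrite cW; clear; lia.
have otherQ g : exists2 q, q \in Q & q != g.
  have [q1 [q2 [q1Q q2Q n]]] := card_gt1P Q2.
  have [E|n'] := eqVneq q1 g; last by exists q1.
  by exists q2 => //; rewrite -E eq_sym.
have tri u v g h q : u \in A :\: Q -> v \in A :\: Q -> e u v -> cross p1 p2 g h -> 
    u \notin [set g; h] -> v \notin [set g; h] -> q \in Q -> q \notin [set g; h] -> False.
  move=> uW vW uv hgh ugh vgh qQ qgh.
  have uq : e u q by rewrite e_sym; apply: kQ.
  have vq : e v q by rewrite e_sym; apply: kQ.
  have uR : u \in A :\ g :\ h by sets.
  have vR : v \in A :\ g :\ h by sets.
  have qR : q \in A :\ g :\ h by sets.
  exact: (balanced_tf (B _ _ hgh) uR vR qR uv vq uq).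
have noW g : g \in A :\: Q -> g \notin [set x; x'] -> ~~ e g x.
  move=> gW gx; apply/negP=> E; case: (adjW g x gW xW E) => -[E1 E2]; subst.
  - by rewrite eqxx in nxx.
  - by move: gx; rewrite !inE eqxx orbT.
  - by rewrite eqxx in nxy'.
  - by rewrite eqxx in nxy.
have p1Q d : d \in Q -> ~~ p1 d.
  move=> dQ; apply/negP=> pd; have [q qQ nqd] := otherQ d.
  have ndy : d != y by sets.
  have hdy : cross p1 p2 d y by split=> //; [sets|left].
  by apply: (tri x x' d y q) => //; sets.
have p2Q d : d \in Q -> ~~ p2 d.
  move=> dQ; apply/negP=> pd; have [q qQ nqd] := otherQ d.
  have nxd : x != d by sets.
  have hxd : cross p1 p2 x d by split=> //; [sets|left].
  have [yy'|nyy'] := boolP (e y y').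
    by apply: (tri y y' x d q) => //; sets.
  (* W - x is independent with |Q| + 1 vertices, inside the matchable set A - x - d of only 2|Q|
     vertices. *)
  have iW : independent e ((A :\: Q) :\ x).
    move=> g h; rewrite !in_setD1 => /andP[gx gW] /andP[hx hW]; apply/negP=> E.
    case: (adjW g h gW hW E) => -[E1 E2]; subst.
    - by rewrite eqxx in gx.
    - by rewrite eqxx in hx.
    - by rewrite E in nyy'.
    - by rewrite e_sym E in nyy'.
  have dA : d \in A by sets.
  have sI : (A :\: Q) :\ x \subset A :\ x :\ d by sets.
  have := pm_indep e_irr (rm_pm e_irr (cross_rm H hxd)) sI iW.
  have := card_rem2 nxd xA dA; have := cardsD1 x (A :\: Q); rewrite xW cW.
  by move: cQ; clear; lia.
(* Removing four vertices of W makes Q more than half of what remains. *)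
have few g h : g \in A :\ x :\ x' -> h \in A :\ x :\ x' :\ g -> g \notin Q -> h \notin Q ->
    pm e (A :\ x :\ x' :\ g :\ h) -> False.
  move=> gA hA gQ hQ q.
  have sI : Q \subset A :\ x :\ x' :\ g :\ h by sets.
  have := pm_indep e_irr q sI iQ.
  have ngh : g != h by sets. have hA' : h \in A :\ x :\ x' by sets.
  have := card_rem2 ngh gA hA'; have := card_rem2 nxx xA x'A.
  by move: cQ; clear; lia.
have [p2x p2x'] : ~~ p2 x /\ ~~ p2 x'.
  case: (pd_inner H xA x'A exx') => //.
  - by move=> []; rewrite px.
  - move=> [t1 [t2 [pt1 pt2 t1A t2A q]]]; case: (few t1 t2) => //.
      by apply: contraL pt1; apply: p1Q.
    by apply: contraL pt2; apply: p2Q.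
  - move=> [w [t [xw wA tA pt q]]]; case: (few w t) => //.
      by apply: contra xw => wQ; rewrite e_sym; apply: kQ.
    by apply/negP=> tQ; move: pt; rewrite (negbTE (p1Q t tQ)) (negbTE (p2Q t tQ)).
have p2W g : g \in A :\: Q -> g \notin [set x; x'] -> p2 g.
  move=> gW gx; apply/negPn/negP=> pg.
  have ngx : g != x by sets. have gA : g \in A by sets.
  by apply: (pd_exp2 H gA xA ngx (noW g gW gx) pg p2x); apply: pmW.
have adj g h : g \in A :\: Q -> h \in A :\: Q -> g != h ->
    g \notin [set x; x'] -> h \notin [set x; x'] -> e g h.
  move=> gW hW ngh gx hx; apply/negPn/negP=> gh.
  have gA : g \in A by sets. have hA : h \in A by sets.
  have [q qQ nq] := otherQ g.
  have nqg : q \notin [set g; h] by sets.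
  have nqh : q \notin [set h; g] by sets.
  have [pg|pg] := boolP (p1 g).
    have hgh : cross p1 p2 g h by split=> //; left; split=> //; apply: p2W.
    by apply: (tri x x' g h q) => //; sets.
  have [ph|ph] := boolP (p1 h); last by apply: (pd_exp1 H gA hA ngh gh pg ph); apply: pmW.
  have hgh : cross p1 p2 h g by split=> //; [by rewrite eq_sym|left; split=> //; apply: p2W].
  by apply: (tri x x' h g q) => //; sets.
have yx : y \notin [set x; x'] by sets. have y'x : y' \notin [set x; x'] by sets.
have yy' := adj y y' yW y'W nyy yx y'x.
have sW : A :\: Q \subset [set x; x'; y; y'].
  apply/subsetP=> g gW; apply/negPn/negP=> gn.
  have gx : g \notin [set x; x'] by sets.
  have nyg : y != g by sets.
  have E := adj y g yW gW nyg yx gx.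
  case: (adjW y g yW gW E) => -[E1 E2]; subst.
  - by rewrite eqxx in nxy.
  - by rewrite eqxx in nx'y.
  - by move: gn; rewrite !inE eqxx orbT.
  - by rewrite eqxx in nyy.
have [d1 [d2 [d1Q d2Q nd]]] := card_gt1P Q2.
have EQ2 : Q = [set d1; d2].
  apply/eqP; rewrite eq_sym eqEcard cards2 nd /=; apply/andP; split; first by sets.
  have := subset_leq_card sW; rewrite cW -!setUA !cardsU1 cards1.
  by clear; do 3 case: (_ \notin _); lia.
have d1A : d1 \in A by sets. have d2A : d2 \in A by sets.
apply: (pd_exp1 H d1A d2A nd (iQ _ _ d1Q d2Q) (p1Q _ d1Q) (p1Q _ d2Q)).
have nx1 : x != d1 by sets. have nx2 : x != d2 by sets.
have nx1' : x' != d1 by sets. have nx2' : x' != d2 by sets.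
have ny1 : y != d1 by sets. have ny2 : y != d2 by sets.
have ny1' : y' != d1 by sets. have ny2' : y' != d2 by sets.
pmadd x x'; pmadd y y'; apply: (pm_eq (pm0 e)).
apply/setP=> z; have := subsetP sW z; rewrite EQ2 !inE.
case: (z == d1); rewrite /= ?andbF //; case: (z == d2); rewrite /= ?andbF //.
case: (z \in A); rewrite /= ?andbF // => /(_ isT).
by case: (z == x); case: (z == x'); case: (z == y); case: (z == y').
Qed.

(** Once xx' and yy' are missing too, A without Q is independent and exceeds half of the matchable
    set A. *)
Lemma balanced_absurd p1 p2 x x' y y' : pendant e p1 p2 A -> all_balanced p1 p2 ->
  x \in A -> x' \in A -> y \in A -> y' \in A -> p1 x -> p1 x' -> p2 y -> p2 y' ->
  x != x' -> y != y' -> x != y -> x != y' -> x' != y -> x' != y' -> False.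
Proof.
move=> H B xA x'A yA y'A px px' py py' nxx nyy nxy nxy' nx'y nx'y'.
have [/pmP pC|npC] := boolP [exists M, matching e M && (cover M == A :\ x :\ x' :\ y :\ y')].
  exact: (four_adjacent H B xA x'A yA y'A px px' py py').
have pC : ~ pm e (A :\ x :\ x' :\ y :\ y') by move=> /pmP; apply/negP.
have [Q [sQ cQ Q2 iQ [kQ adjW]]] := four_nonadjacent H B xA x'A yA y'A px px' py py' nxx nyy nxy nxy' nx'y nx'y' pC.
have nexx' : ~~ e x x'.
  by apply/negP=> exx'; apply: (four_edge H B xA x'A yA y'A px px' py py' nxx nyy nxy nxy' nx'y nx'y' pC exx').
have neyy' : ~~ e y y'.
  apply/negP=> eyy'; have B' : all_balanced p2 p1 by move=> u v /cross_swap; apply: B.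
  have pC' : ~ pm e (A :\ y :\ y' :\ x :\ x').
    move=> q; apply: pC; apply: (pm_eq q); sets.
  by apply: (four_edge (pendant_sym H) B' yA y'A xA x'A py py' px px' nyy nxx _ _ _ _ pC' eyy'); rewrite eq_sym.
have sQA : Q \subset A by sets.
have iW : independent e (A :\: Q).
  move=> g h gW hW; apply/negP=> E.
  case: (adjW g h gW hW E) => -[E1 E2]; subst.
  - by rewrite E in nexx'.
  - by rewrite e_sym E in nexx'.
  - by rewrite E in neyy'.
  - by rewrite e_sym E in neyy'.
have sW : A :\: Q \subset A by sets.
have := pm_indep e_irr (pd_pm H) sW iW; have := cardsID Q A.
by rewrite (setIidPr sQA); move: cQ; clear; lia.
Qed.

(** All remainders have the same shape. In the balanced one, either p1 and p2 offer two vertices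
    each, all distinct, or together they cover only three or two vertices of A; each possibility is
    excluded. *)
Lemma pendant_spike p1 p2 : pendant e p1 p2 A -> spike p1 p2 A.
Proof.
move=> H; have [x0 [_ [x0A _ _ px0 _]]] := pd_two1 H.
have [y0 y0A /andP[py0 n]] := other_pair x0 (pd_two2 H); rewrite eq_sym in n.
case: (pd_shape H x0A y0A n px0 py0) => [k|b].
  by apply: clique_spike => // x y xA yA nxy px py; apply: (pd_all H x0A y0A n px0 py0 k).
exfalso.
have B' x y : x \in A -> y \in A -> x != y -> p1 x -> p2 y -> balanced (A :\ x :\ y).
  move=> xA yA nxy px py; case: (pd_shape H xA yA nxy px py) => // k.
  have k0 := pd_all H xA yA nxy px py k x0A y0A n px0 py0.
  by case: (balanced_not_clique (z := x0) b); apply: cliqueS k0; sets.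
have B : all_balanced p1 p2.
  move=> x y [xA yA nxy [[px py]|[py px]]]; first exact: B'.
  by have -> : A :\ x :\ y = A :\ y :\ x; [sets|apply: B' => //; rewrite eq_sym].
have [x [x' [xA x'A nxx' px px']]] := pd_two1 H.
have nx'x : x' != x by rewrite eq_sym.
have ex2 p (I : {set T}) : (exists2 z, z \in A & p z && (z \notin I)) \/ 
    (forall z, z \in A -> p z -> z \in I).
  have [/existsP[z /and3P[zA pz zI]]|E] := boolP [exists z, [&& z \in A, p z & z \notin I]].
    by left; exists z => //; rewrite pz.
  right=> z zA pz; apply/negPn/negP=> zI; case/negP: E; apply/existsP; exists z.
  by rewrite zA pz.
have [[y yA /andP[py yI]]|N2] := ex2 p2 [set x; x'].
  have nxy : x != y by sets. have nx'y : x' != y by sets.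
  have [[y' y'A /andP[py' y'I]]|N2'] := ex2 p2 [set x; x'; y].
    have nyy' : y != y' by sets. have nxy' : x != y' by sets. have nx'y' : x' != y' by sets.
    exact: (balanced_absurd H B xA x'A yA y'A px px' py py').
  have main u v : u \in A -> v \in A -> p1 u -> p1 v -> u != v -> u != y -> v != y ->
      [set u; v] = [set x; x'] -> p2 u -> False.
    move=> uA vA pu pv nuv nuy nvy Euv p2u.
    have Euvy : [set u; v; y] = [set x; x'; y] by rewrite Euv.
    have nvu : v != u by rewrite eq_sym. have nyu : y != u by rewrite eq_sym.
    have [[z zA /andP[pz zI]]|N1] := ex2 p1 [set u; v; y].
      have nvz : v != z by sets. have nzu : z != u by sets. have nzy : z != y by sets.
      exact: (balanced_absurd H B vA zA uA yA pv pz p2u py nvz nuy nvu nvy nzu nzy).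
    apply: (triple_absurd H B (u := u) (v := v) (t := y)).
    - by split=> //; right.
    - by split=> //; left.
    - by split=> //; left.
    - move=> z zA /orP[pz|pz]; first exact: N1.
      by rewrite Euvy; apply: N2'.
  have [z zA /andP[pz nzy]] := other_pair y (pd_two2 H).
  have := N2' z zA pz; rewrite !inE (negbTE nzy) orbF => /orP[] /eqP E.
    by rewrite E in pz; apply: (main x x').
  rewrite E in pz; apply: (main x' x) => //; exact: setUC.
have p2x : p2 x && p2 x'.
  have [z [z' [zA z'A nzz' pz pz']]] := pd_two2 H.
  have := N2 z zA pz; have := N2 z' z'A pz'; rewrite !inE.
  by case/orP=> /eqP E; case/orP=> /eqP E'; subst; rewrite ?pz ?pz' //; rewrite eqxx in nzz'.
have [p2x1 p2x'] := andP p2x.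
have [[u uA /andP[pu uI]]|N1] := ex2 p1 [set x; x'].
  have nux : u != x by sets. have nux' : u != x' by sets.
  have [[v vA /andP[pv vI]]|N1'] := ex2 p1 [set x; x'; u].
    have nuv : u != v by sets. have nvx : v != x by sets. have nvx' : v != x' by sets.
    exact: (balanced_absurd H B uA vA xA x'A pu pv p2x1 p2x' nuv nxx' nux nux' nvx nvx').
  have nxu : x != u by rewrite eq_sym. have nx'u : x' != u by rewrite eq_sym.
  apply: (triple_absurd H B (u := x) (v := x') (t := u)).
  - by split=> //; left.
  - by split=> //; right.
  - by split=> //; right.
  - move=> z zA /orP[pz|pz]; first exact: N1'.
    by have := N2 z zA pz; rewrite !inE => ->.
apply: (pd_spread H xA x'A nxx') => z zA /orP[pz|pz]; [exact: N1|exact: N2].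
Qed.

End Cases.
End Spike.

(** * Types I to IV satisfy the three conditions *)

Section Converse.
Variables (T : finType) (e : rel T).
Hypotheses (e_sym : symmetric e) (e_irr : irreflexive e).
Implicit Types (X Y A B C D P Q R U I W N M : {set T}) (x y z u v w b t : T).

Lemma clique_indep X U : clique e X -> U \subset X -> independent e U -> #|U| <= 1.
Proof.
move=> k sU iU; apply/card_le1_eqP => x y xU yU; apply/eqP/negPn/negP=> n.
by have := iU x y xU yU; rewrite k //; sets.
Qed.

Lemma bip_indep P Q U : bip e P Q -> U \subset P :|: Q -> independent e U ->
  #|U :&: P| = 0 \/ #|U :&: Q| = 0.
Proof.
move=> [d _ _ c] sU iU; have [->|/set0Pn[x]] := eqVneq (U :&: P) set0; first by left; rewrite cards0.
rewrite inE => /andP[xU xP]; right; apply/eqP; rewrite cards_eq0; apply/eqP/setP=> y.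
rewrite !inE; apply/negP=> /andP[yU yQ]; have := iU x y xU yU.
by rewrite c.
Qed.

Lemma card_bip P Q X : [disjoint P & Q] -> X \subset P :|: Q ->
  #|X| = #|X :&: P| + #|X :&: Q|.
Proof.
move=> d sX; have := cardsUI (X :&: P) (X :&: Q).
have -> : X :&: P :&: (X :&: Q) = set0 by sets.
have -> : X :&: P :|: X :&: Q = X by sets.
by rewrite cards0; lia.
Qed.

Lemma pm_bip_count P Q X : bip e P Q -> X \subset P :|: Q -> 
  (pm e X <-> #|X :&: P| = #|X :&: Q|).
Proof.
move=> [d iP iQ c] sX; split; first exact: pm_bip_inv.
move=> E; have -> : X = (X :&: P) :|: (X :&: Q) by sets.
apply: pm_bip => //; last by sets.
by move=> x y; rewrite !inE => /andP[_ xP] /andP[_ yQ]; apply: c.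
Qed.

Lemma set1_of_card X : #|X| = 1 -> exists x, X = [set x].
Proof. by move/eqP/cards1P. Qed.

Lemma card_split Z X Y : [disjoint X & Y] -> Z = X :|: Y -> #|Z| = #|X| + #|Y|.
Proof. by move=> d ->; rewrite cardsU disjoint_setI0 // cards0 subn0. Qed.

Lemma card_rem1 X x : x \in X -> #|X| = #|X :\ x|.+1.
Proof. by move=> xX; rewrite (cardsD1 x X) xX. Qed.

Section A.
Variables (A N1 N2 : {set T}).
Hypothesis gA : gadgetA e A N1 N2.

Lemma gadgetA_sym : gadgetA e A N2 N1.
Proof.
case: gA => [[? ? ? -> ->]|[b E N E']]; first by left; split.
right; split; [exact: bip_sym|by []| |by rewrite setUC].
by rewrite -card_gt0 -E card_gt0.
Qed.

Lemma gadgetA_cover : A = N1 :|: N2.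
Proof. by case: gA => [[? ? ? -> ->]|[]]; rewrite ?setUid. Qed.

Lemma gadgetA_ne : N1 != set0.
Proof. by case: gA => [[? ? ? -> _]|[]]. Qed.

Lemma gadgetA_pm : pm e A.
Proof.
case: gA => [[k o _ _ _]|[[d _ _ c] E _ ->]]; first exact: pm_clique.
exact: pm_bip.
Qed.

(** First of three counts of the set exposed in A, according to the number of vertices of A matched
    to the cut. Parity settles the complete shape, balance the bipartite one. *)
Lemma gadgetA_0 U : U \subset A -> independent e U -> pm e (A :\: U) -> #|U| = 0.
Proof.
move=> sU iU p; case: gA => [[k o _ _ _]|[b E _ EA]].
  have := clique_indep k sU iU; have := cardsID U A; rewrite (setIidPr sU).
  move: (pm_even e_irr p) o; case: #|U| => [|[|]] //= H1 H2 H3 _.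
  by move: H2; rewrite -H3 oddD (negbTE H1).
have [d _ _ _] := b.
have sX : A :\: U \subset N1 :|: N2 by rewrite EA; sets.
have sUX : U \subset N1 :|: N2 by rewrite -EA.
have := (pm_bip_count b sX).1 p.
have h1 : #|N1| = #|(A :\: U) :&: N1| + #|U :&: N1|.
  by apply: card_split; rewrite ?EA; sets.
have h2 : #|N2| = #|(A :\: U) :&: N2| + #|U :&: N2|.
  by apply: card_split; rewrite ?EA; sets.
rewrite (card_bip d sUX); have := bip_indep b sUX iU; clear - h1 h2 E; lia.
Qed.

(** The exposed u restores the balance disturbed by a, hence lies on the other side. Being adjacent
    to s2, it prevents s2 from being exposed as well. *)
Lemma gadgetA_1 U a : U \subset A -> independent e U -> a \in N1 -> a \notin U ->
  pm e (A :\: U :\ a) -> exists2 u, U = [set u] & u \in N2.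
Proof.
move=> sU iU aN aU p; case: gA => [[k o _ E1 E2]|[b E _ EA]].
  have c1 := clique_indep k sU iU; have := cardsID U A; rewrite (setIidPr sU).
  have aX : a \in A :\: U by rewrite -E1; sets.
  move: (pm_even e_irr p) o; rewrite (card_rem1 aX); move: c1.
  case c : #|U| => [|[|]] //= _ H1 H2 H3.
    by move: H2; rewrite -H3 add0n /= (negbTE H1).
  have [u Eu] := set1_of_card c; exists u => //; rewrite E2.
  by apply: (subsetP sU); rewrite Eu inE.
have [d _ _ _] := b.
have aA : a \in A by rewrite EA inE aN.
have sX : A :\: U :\ a \subset N1 :|: N2 by rewrite EA; sets.
have sUX : U \subset N1 :|: N2 by rewrite -EA.
have := (pm_bip_count b sX).1 p.
have h1 : #|N1| = #|(A :\: U :\ a) :&: N1|.+1 + #|U :&: N1|.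
  have aX : a \in (A :\: U) :&: N1 by sets.
  have -> : (A :\: U :\ a) :&: N1 = ((A :\: U) :&: N1) :\ a by sets.
  by rewrite -(card_rem1 aX); apply: card_split; rewrite ?EA; sets.
have h2 : #|N2| = #|(A :\: U :\ a) :&: N2| + #|U :&: N2|.
  by apply: card_split; rewrite ?EA; sets.
move=> h3; have h4 := bip_indep b sUX iU; have h5 := card_bip d sUX.
have [u Eu] : exists u, U = [set u].
  by apply: set1_of_card; move: h4; clear - h1 h2 h3 h5 E; lia.
exists u => //.
have uU : u \in U by rewrite Eu inE.
have : #|U :&: N2| != 0 by apply/eqP; move: h4; clear - h1 h2 h3 h5 E; lia.
rewrite cards_eq0 => /set0Pn[x]; rewrite inE Eu => /andP[/set1P -> //].
Qed.

Lemma gadgetA_2 U a a' : U \subset A -> independent e U -> a \in N1 -> a \notin U ->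
  a' \in N2 -> a' \notin U -> a != a' ->
  pm e (A :\: U :\ a :\ a') -> #|U| = 0.
Proof.
move=> sU iU aN aU a'N a'U n p; case: gA => [[k o _ E1 E2]|[b E _ EA]].
  have c1 := clique_indep k sU iU; have := cardsID U A; rewrite (setIidPr sU).
  have aX : a \in A :\: U by rewrite -E1; sets.
  have a'X : a' \in A :\: U by rewrite -E2; sets.
  move: (pm_even e_irr p) o; rewrite -(card_rem2 n aX a'X); move: c1.
  case c : #|U| => [|[|]] //= _ H1 H2 H3.
  by move: H2; rewrite -H3 add1n /= !negbK (negbTE H1).
have [d _ _ _] := b.
have aA : a \in A by rewrite EA inE aN.
have a'A : a' \in A by rewrite EA inE a'N orbT.
have sX : A :\: U :\ a :\ a' \subset N1 :|: N2 by rewrite EA; sets.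
have sUX : U \subset N1 :|: N2 by rewrite -EA.
have := (pm_bip_count b sX).1 p.
have h1 : #|N1| = #|(A :\: U :\ a :\ a') :&: N1|.+1 + #|U :&: N1|.
  have aX : a \in (A :\: U) :&: N1 by sets.
  have -> : (A :\: U :\ a :\ a') :&: N1 = ((A :\: U) :&: N1) :\ a by sets.
  by rewrite -(card_rem1 aX); apply: card_split; rewrite ?EA; sets.
have h2 : #|N2| = #|(A :\: U :\ a :\ a') :&: N2|.+1 + #|U :&: N2|.
  have aX : a' \in (A :\: U) :&: N2 by sets.
  have -> : (A :\: U :\ a :\ a') :&: N2 = ((A :\: U) :&: N2) :\ a' by sets.
  by rewrite -(card_rem1 aX); apply: card_split; rewrite ?EA; sets.
move=> h3; have h4 := bip_indep b sUX iU; have h5 := card_bip d sUX.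
by move: h4; clear - h1 h2 h3 h5 E; lia.
Qed.

Lemma gadgetA_pair a a' : a \in N1 -> a' \in N2 -> a != a' -> pm e (A :\ a :\ a').
Proof.
move=> aN a'N n; case: gA => [[k o _ E1 E2]|[b E _ EA]]; last first.
  by rewrite EA; apply: pm_bip_rem.
rewrite E1 in aN; rewrite E2 in a'N.
apply: (pm_clique e_irr); first by apply: cliqueS k; sets.
by move: o; rewrite -(card_rem2 n aN a'N) /= negbK.
Qed.

Lemma gadgetA_partner a : a \in N1 -> exists a', [/\ a' \in N2, a != a' & pm e (A :\ a :\ a')].
Proof.
move=> aN; have aA : a \in A by rewrite gadgetA_cover inE aN.
have [a' [a'A aa' p]] := pm_rem e_sym e_irr gadgetA_pm aA.
have n := adj_neq e_irr aa'.
exists a'; split=> //; case: gA => [[k o _ E1 E2]|[[_ i1 _ _] E _ EA]]; first by rewrite E2.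
move: a'A; rewrite EA inE => /orP[a'N|//].
by have := i1 a a' aN a'N; rewrite aa'.
Qed.

Lemma gadgetA_edge a a' : a \in A -> a' \in A -> e a a' -> pm e (A :\ a :\ a').
Proof.
move=> aA a'A aa'; have n := adj_neq e_irr aa'; case: gA => [[k o _ E1 E2]|[b E _ EA]].
  by apply: gadgetA_pair; rewrite ?E1 ?E2.
have [d i1 i2 _] := b.
have sw : A :\ a' :\ a = A :\ a :\ a' by sets.
move: (aA) (a'A); rewrite {1 2}EA !inE => /orP[x1|x2] /orP[y1|y2].
- by have := i1 a a' x1 y1; rewrite aa'.
- exact: gadgetA_pair.
- by rewrite -sw; apply: gadgetA_pair => //; rewrite eq_sym.
- by have := i2 a a' x2 y2; rewrite aa'.
Qed.

Lemma gadgetA_link : exists a a', [/\ a \in N1, a' \in N2 & a = a' \/ e a a'].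
Proof.
case: gA => [[_ _ /set0Pn[a aA] -> ->]|[[_ _ _ c] E N EA]]; first by exists a, a; split=> //; left.
have [a aN] := set0Pn _ N.
have : N2 != set0 by rewrite -card_gt0 -E card_gt0.
by case/set0Pn=> a' a'N; exists a, a'; split=> //; right; apply: c.
Qed.

Lemma gadgetA_toN2 a : a \in A -> a \in N2 \/ exists2 a', a' \in N2 & e a a'.
Proof.
case: gA => [[_ _ _ _ ->]|[[_ _ _ c] E N EA]]; first by left.
have : N2 != set0 by rewrite -card_gt0 -E card_gt0.
case/set0Pn=> a' a'N; rewrite EA inE => /orP[aN|]; last by left.
by right; exists a' => //; apply: c.
Qed.

End A.

Section B.
Variables (B D : {set T}).
Hypothesis gB : gadgetB e B D.

Lemma gadgetB_sub : D \subset B.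
Proof. by case: gB => [[_ _ _ ->]|[P [_ _ _ ->]]]; [|sets]. Qed.

Lemma gadgetB_odd : odd #|B|.
Proof.
case: gB => [[]//|[P [[d _ _ _] E _ ->]]].
by rewrite cardsU disjoint_setI0 // cards0 subn0 E addnS oddS addnn odd_double.
Qed.

Lemma gadgetB_card : 3 <= #|B|.
Proof.
case: gB => [[]//|[P [[d _ _ _] E P0 ->]]].
by rewrite cardsU disjoint_setI0 // cards0 subn0 E; move: P0; rewrite -card_gt0; clear; lia.
Qed.

Lemma gadgetB_pm b : b \in D -> pm e (B :\ b).
Proof.
move=> bD; case: gB => [[k o _ E]|[P [bip_ E P0 EB]]].
  apply: (pm_clique e_irr); first by apply: cliqueS k; sets.
  by rewrite odd_rem1 ?o // -E.
have [d _ _ _] := bip_.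
have sX : B :\ b \subset P :|: D by rewrite EB; sets.
apply/(pm_bip_count bip_ sX).
have -> : (B :\ b) :&: P = P by rewrite EB; sets.
have -> : (B :\ b) :&: D = D :\ b by rewrite EB; sets.
by have := card_rem1 bD; rewrite E => -[].
Qed.

(** W stands for the vertices of B matched to the cut. There are at most two of them in use, so the
    last alternative only collects the remaining sizes. *)
Lemma gadgetB_count U W : U \subset B -> independent e U -> W \subset D ->
  [disjoint U & W] -> pm e (B :\: U :\: W) ->
  [\/ #|W| = 1 /\ #|U| = 0, #|W| = 0 /\ exists2 u, U = [set u] & u \in D,
      #|W| = 2 /\ #|U| = 1 | 3 <= #|W|].
Proof.
move=> sU iU sW dUW p.
have [|W3] := leqP 3 #|W|; first by constructor 4.
case: gB => [[k o _ E]|[P [bip_ E P0 EB]]].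
  have c1 := clique_indep k sU iU.
  have cB : #|B| = #|B :\: U :\: W| + #|W| + #|U|.
    rewrite E in sW; rewrite -addnA -(@card_split (W :|: U)) //; last by sets.
    by apply: card_split; sets.
  have ev := pm_even e_irr p.
  move: o; rewrite cB !oddD (negbTE ev) /=.
  move: W3 c1; case cW : #|W| => [|[|[|]]] //; case cU : #|U| => [|[|]] //= _ _ _.
  - constructor 2; split=> //; have [u Eu] := set1_of_card cU; exists u => //.
    by rewrite E; apply: (subsetP sU); rewrite Eu inE.
  - by constructor 1.
  - by constructor 3.
have [d _ _ _] := bip_.
have sX : B :\: U :\: W \subset P :|: D by rewrite EB; sets.
have sUX : U \subset P :|: D by rewrite -EB.
have h0 := (pm_bip_count bip_ sX).1 p.
have h1 : #|P| = #|(B :\: U :\: W) :&: P| + #|U :&: P|.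
  by apply: card_split; rewrite ?EB; sets.
have h2 : #|D| = #|(B :\: U :\: W) :&: D| + #|W| + #|U :&: D|.
  rewrite -addnA -(@card_split (W :|: (U :&: D))) //; last by sets.
  by apply: card_split; rewrite ?EB; sets.
have h4 := bip_indep bip_ sUX iU; have h5 := card_bip d sUX.
move: W3; case cW : #|W| => [|[|[|]]] // _.
- constructor 2; split=> //.
  have cU : #|U| = 1 by move: h4; clear - h0 h1 h2 h5 E cW; lia.
  have [u Eu] := set1_of_card cU; exists u => //.
  have : #|U :&: D| != 0 by apply/eqP; move: h4; clear - h0 h1 h2 h5 E cW; lia.
  by rewrite cards_eq0 => /set0Pn[x]; rewrite inE Eu => /andP[/set1P -> //].
- by constructor 1; split=> //; move: h4; clear - h0 h1 h2 h5 E cW; lia.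
- by constructor 3; split=> //; move: h4; clear - h0 h1 h2 h5 E cW; lia.
Qed.

Lemma clique_pm3 x y z : clique e B -> odd #|B| -> x \in B -> y \in B -> z \in B ->
  x != y -> x != z -> y != z -> pm e (B :\ x :\ y :\ z).
Proof.
move=> k o xB yB zB xy xz yz; apply: (pm_clique e_irr); first by apply: cliqueS k; sets.
have zX : z \in B :\ x :\ y by sets.
by rewrite odd_rem1 // odd_rem2 ?o.
Qed.

(** A vertex outside D exists only in the bipartite shape, in the smaller class; removing it with
    two vertices of D equalizes the classes. *)
Lemma gadgetB_out v b1 b2 : v \in B -> v \notin D -> b1 \in D -> b2 \in D -> b1 != b2 ->
  pm e (B :\ v :\ b1 :\ b2).
Proof.
move=> vB vD b1D b2D n; case: gB => [[k o _ E]|[P [bip_ E P0 EB]]]; first by rewrite E vB in vD.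
have [d _ _ _] := bip_; have vP : v \in P by move: vB; rewrite EB inE (negbTE vD) orbF.
have sX : B :\ v :\ b1 :\ b2 \subset P :|: D by rewrite EB; sets.
apply/(pm_bip_count bip_ sX).
have -> : (B :\ v :\ b1 :\ b2) :&: P = P :\ v by rewrite EB; sets.
have -> : (B :\ v :\ b1 :\ b2) :&: D = D :\ b1 :\ b2 by rewrite EB; sets.
by have := card_rem1 vP; have := card_rem2 n b1D b2D; rewrite E; clear; lia.
Qed.

Lemma gadgetB_spare b1 b2 : b1 \in D -> b2 \in D -> b1 != b2 ->
  exists2 w, w \in B :\ b1 :\ b2 & pm e (B :\ w :\ b1 :\ b2).
Proof.
move=> b1D b2D n; have sD := gadgetB_sub; have b1B : b1 \in B by sets. have b2B : b2 \in B by sets.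
have [v vD] : exists v, v \in B :\ b1 :\ b2.
  by apply/set0Pn; rewrite -card_gt0; have := card_rem2 n b1B b2B; have := gadgetB_card; clear; lia.
have [v' v'D] : exists2 v, v \in B :\ b1 :\ b2 & clique e B /\ odd #|B| \/ v \notin D.
  case: gB => [[k o _ E]|[P [[d _ _ _] E /set0Pn[p pP] EB]]]; first by exists v => //; left.
  by exists p; [rewrite EB; sets|right; sets].
have v'B : v' \in B by sets.
case=> [[k o]|v'nD]; exists v' => //; last exact: gadgetB_out.
by apply: clique_pm3 => //; sets.
Qed.

Lemma gadgetB_edge b b' : b \in B -> b' \in B -> e b b' ->
  exists2 c, c \in D :\ b :\ b' & pm e (B :\ b :\ b' :\ c).
Proof.
move=> bB b'B bb'; have n := adj_neq e_irr bb'; case: gB => [[k o B3 E]|[P [bip_ E P0 EB]]].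
  have [v vD] : exists v, v \in B :\ b :\ b'.
    by apply/set0Pn; rewrite -card_gt0; have := card_rem2 n bB b'B; move: B3; clear; lia.
  exists v; first by rewrite E.
  by apply: clique_pm3 => //; sets.
have [d iP iD c] := bip_.
have main x y : x \in P -> y \in D -> exists2 z, z \in D :\ y & pm e (B :\ x :\ y :\ z).
  move=> xP yD; have [z zD] : exists z, z \in D :\ y.
    by apply/set0Pn; rewrite -card_gt0; have := card_rem1 yD; move: P0; rewrite E -card_gt0; clear; lia.
  exists z => //; have zD' : z \in D by sets.
  by apply: gadgetB_out => //; [rewrite EB; sets|sets|sets].
have sw z : B :\ b' :\ b :\ z = B :\ b :\ b' :\ z by sets.
move: (bB) (b'B); rewrite {1 2}EB !inE => /orP[x1|x2] /orP[y1|y2].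
- by have := iP b b' x1 y1; rewrite bb'.
- by have [z zD p] := main b b' x1 y2; exists z => //; sets.
- have [z zD p] := main b' b y1 x2; exists z; first by sets. by rewrite -sw.
- by have := iD b b' x2 y2; rewrite bb'.
Qed.

Lemma gadgetB_link b b' : b \in D -> b' \in D ->
  b = b' \/ e b b' \/ exists2 p, p \in B & e b p /\ e p b'.
Proof.
move=> bD b'D; have [->|n] := eqVneq b b'; first by left.
right; case: gB => [[k o B3 E]|[P [[d iP iD c] E /set0Pn[p pP] EB]]].
  by left; apply: k => //; rewrite -E.
by right; exists p; rewrite ?EB ?inE ?pP //; split; [rewrite e_sym|]; apply: c.
Qed.

Lemma gadgetB_toD b d : b \in B -> b \notin D -> d \in D -> e b d.
Proof.
move=> bB bD dD; case: gB => [[k o B3 E]|[P [[_ iP iD c] E _ EB]]]; first by rewrite E bB in bD.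
by apply: c => //; move: bB; rewrite EB inE (negbTE bD) orbF.
Qed.

End B.

Lemma gadget_cut_sym s1 s2 A B : gadget_cut e s1 s2 A B -> gadget_cut e s2 s1 A B.
Proof.
case=> c n gA gB [d m1 m2]; split; rewrite 1?e_sym 1?setUC //.
- exact: cut_sym.
- exact: gadgetA_sym.
- by split=> //; rewrite disjoint_sym.
Qed.

Lemma in_nbr s X x : (x \in nbr e s X) = (x \in X) && e s x.
Proof. by rewrite inE. Qed.

Lemma nbr_ex s X : nbr e s X != set0 -> exists2 x, x \in X & e s x.
Proof. by case/set0Pn=> x; rewrite in_nbr => /andP[xX sx]; exists x. Qed.

Lemma nbr_U s t X x : x \in X -> e s x || e t x -> x \in nbr e s X :|: nbr e t X.
Proof. by rewrite inE !in_nbr => -> /=. Qed.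

Section Whole.
Variables (s1 s2 : T) (A B : {set T}).
Hypothesis g : gadget_cut e s1 s2 A B.
Let c : cut e s1 s2 A B. Proof. by case: g. Qed.
Let ns12 : ~~ e s1 s2. Proof. by case: g. Qed.
Let gA : gadgetA e A (nbr e s1 A) (nbr e s2 A). Proof. by case: g. Qed.
Let gB : gadgetB e B (nbr e s1 B :|: nbr e s2 B). Proof. by case: g. Qed.
Let n12 : s1 != s2. Proof. by case: c. Qed.
Let AB : A :|: B = ~: [set s1; s2]. Proof. by case: c. Qed.
Let dAB : [disjoint A & B]. Proof. by case: c. Qed.
Let aAB : anticomplete_to e A B. Proof. by case: c. Qed.

Lemma whole_M1 : exists2 b, b \in B & e s1 b.
Proof. by case: g => _ _ _ _ [_ m _]; apply: nbr_ex. Qed.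

Lemma whole_M2 : exists2 b, b \in B & e s2 b.
Proof. by case: g => _ _ _ _ [_ _ m]; apply: nbr_ex. Qed.

Lemma whole_excl b : b \in B -> e s1 b -> ~~ e s2 b.
Proof.
move=> bB s1b; case: g => _ _ _ _ [d _ _]; apply/negP=> s2b.
by have := disjoint_notin (z := b) d; rewrite !in_nbr bB s1b s2b => /(_ isT).
Qed.

Lemma whole_pmB b : b \in B -> e s1 b || e s2 b -> pm e (B :\ b).
Proof. by move=> bB bS; apply: (gadgetB_pm gB); apply: nbr_U. Qed.

Lemma whole_pmA : pm e A. Proof. exact: gadgetA_pm gA. Qed.

Lemma whole_fc_s : pm e (~: [set s1]).
Proof.
have [b bB s2b] := whole_M2; have pB : pm e (B :\ b) by apply: whole_pmB; rewrite ?s2b ?orbT.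
pmadd s2 b; apply: (pm_eq (pm_union _ whole_pmA pB)); by sets.
Qed.

Lemma whole_fc_A a : a \in A -> e s2 a -> pm e (~: [set a]).
Proof.
move=> aA s2a; have aN : a \in nbr e s2 A by rewrite in_nbr aA.
have [a' [+ n p]] := gadgetA_partner (gadgetA_sym gA) aN; rewrite in_nbr => /andP[a'A s1a'].
have [b bB s2b] := whole_M2; have pB : pm e (B :\ b) by apply: whole_pmB; rewrite ?s2b ?orbT.
pmadd s1 a'; pmadd s2 b; apply: (pm_eq (pm_union _ p pB)); by sets.
Qed.

Lemma whole_fc_B b : b \in B -> pm e (~: [set b]).
Proof.
move=> bB; have [bD|bD] := boolP (b \in nbr e s1 B :|: nbr e s2 B).
  have [a aN] := set0Pn _ (gadgetA_ne gA).
  have [a' [+ n p]] := gadgetA_partner gA aN.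
  move: aN; rewrite !in_nbr => /andP[aA s1a] /andP[a'A s2a'].
  have pB : pm e (B :\ b) by exact: (gadgetB_pm gB bD).
  pmadd s1 a; pmadd s2 a'; apply: (pm_eq (pm_union _ p pB)); by sets.
have [b1 b1B s1b1] := whole_M1; have [b2 b2B s2b2] := whole_M2.
have n : b1 != b2 by apply: contraTneq s2b2 => <-; exact: whole_excl.
have pB : pm e (B :\ b :\ b1 :\ b2).
  by apply: (gadgetB_out gB) => //; apply: nbr_U => //; rewrite ?s1b1 ?s2b2 ?orbT.
move: bD; rewrite inE !in_nbr bB /= negb_or => /andP[nb1 nb2].
have m1 : b != b1 by apply: contraNneq nb1 => ->.
have m2 : b != b2 by apply: contraNneq nb2 => ->.
pmadd s1 b1; pmadd s2 b2; apply: (pm_eq (pm_union _ whole_pmA pB)); by sets.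
Qed.

Lemma whole_card U : #|U| = #|U :&: A| + #|U :&: B| + #|U :&: [set s1; s2]|.
Proof.
rewrite -(@card_split ((U :&: A) :|: (U :&: B))) //; last by sets.
by apply: card_split; sets.
Qed.

Lemma indepI U X : independent e U -> independent e (U :&: X).
Proof. by apply: independentS; sets. Qed.

Lemma whole_partner X : s1 \in X -> pm e X -> exists t,
  [/\ e s1 t, pm e (X :\ s1 :\ t) & (t \in X :&: A) || (t \in X :&: B)].
Proof.
move=> s1X p; have [t [tX s1t q]] := pm_rem e_sym e_irr p s1X.
exists t; split=> //; rewrite !inE tX.
case: (cut_case c t) => [E|E|->|->]; rewrite ?orbT //; first by rewrite E e_irr in s1t.
by rewrite E (negbTE ns12) in s1t.
Qed.

Lemma whole_restrict X Y Z : s1 \notin X -> s2 \notin X -> pm e X ->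
  X :&: A = Y -> X :&: B = Z -> pm e Y /\ pm e Z.
Proof. by move=> s1X s2X p <- <-; apply: (cut_restrict e_sym e_irr c). Qed.

Lemma whole_B0 U : U \subset B -> independent e U -> pm e (B :\: U) ->
  exists2 u, U = [set u] & e s1 u || e s2 u.
Proof.
move=> sU iU p.
case: (@gadgetB_count _ _ gB U set0) => //; rewrite ?cards0 ?setD0 //; try by case.
- by sets.
- by sets.
by case=> _ [u -> +]; rewrite inE !in_nbr -andb_orr => /andP[_ ?]; exists u.
Qed.

Lemma whole_B1 U b : U \subset B -> independent e U -> b \in B -> b \notin U ->
  e s1 b || e s2 b -> pm e (B :\: U :\ b) -> #|U| = 0.
Proof.
move=> sU iU bB bU bS p.
have bD := nbr_U bB bS.
case: (@gadgetB_count _ _ gB U [set b]) => //; rewrite ?cards1 //; try by case.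
- by sets.
- by sets.
Qed.

Lemma whole_B2 U b1 b2 : U \subset B -> independent e U -> b1 \in B -> b1 \notin U ->
  b2 \in B -> b2 \notin U -> e s1 b1 -> e s2 b2 -> pm e (B :\: U :\ b1 :\ b2) -> #|U| = 1.
Proof.
move=> sU iU b1B b1U b2B b2U s1b1 s2b2 p.
have n : b1 != b2 by apply: contraTneq s2b2 => <-; exact: whole_excl.
have b1D : b1 \in nbr e s1 B :|: nbr e s2 B by apply: nbr_U => //; rewrite s1b1.
have b2D : b2 \in nbr e s1 B :|: nbr e s2 B by apply: nbr_U => //; rewrite s2b2 orbT.
case: (@gadgetB_count _ _ gB U [set b1; b2]) => //; rewrite ?cards2 ?n //; try by case.
- by sets.
- by sets.
- by apply: (pm_eq p); sets.
Qed.

(** The vertex exposed on the odd side is adjacent to s1 or s2. *)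
Lemma whole_eqm_both U : independent e U -> pm e (~: U) -> s1 \in U -> s2 \in U -> False.
Proof.
move=> iU p s1U s2U.
have [||||pA pB] := @whole_restrict _ (A :\: (U :&: A)) (B :\: (U :&: B)) _ _ p; [by sets|by sets|by sets|by sets|].
have [|u Eu uS] := whole_B0 _ (indepI iU) pB; first by sets.
have uU : u \in U by have : u \in U :&: B; [rewrite Eu inE|rewrite inE => /andP[]].
by case/orP: uS => E; [have := iU s1 u s1U uU|have := iU s2 u s2U uU]; rewrite E.
Qed.

(** If s1 were matched into A, the vertex exposed in A would be adjacent to s2. So s1 is matched
    into B, and s2 alone is exposed. *)
Lemma whole_eqm_one U : independent e U -> pm e (~: U) -> s1 \notin U -> s2 \in U -> #|U| = 1.
Proof.
move=> iU p s1U s2U.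
have [|t [s1t q]] := whole_partner _ p; first by sets.
rewrite !inE => /orP[]/andP[tU tX].
  have nt1 : t != s1 by sets.
  have [||||pA pB] := @whole_restrict _ (A :\: (U :&: A) :\ t) (B :\: (U :&: B)) _ _ q; [by sets|by sets|by sets|by sets|].
  have [|||u Eu] := gadgetA_1 gA _ (indepI iU) _ _ pA; [by sets|by rewrite in_nbr tX|by sets|].
  rewrite in_nbr => /andP[uA s2u].
  have uU : u \in U by have : u \in U :&: A; [rewrite Eu inE|rewrite inE => /andP[]].
  by have := iU s2 u s2U uU; rewrite s2u.
have [||||pA pB] := @whole_restrict _ (A :\: (U :&: A)) (B :\: (U :&: B) :\ t) _ _ q; [by sets|by sets|by sets|by sets|].
rewrite whole_card (gadgetA_0 gA _ (indepI iU) pA); last by sets.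
rewrite (whole_B1 _ (indepI iU) tX _ _ pB); [|by sets|by sets|by rewrite s1t].
by have -> : U :&: [set s1; s2] = [set s2] by [sets]; rewrite cards1.
Qed.

(** For each distribution of the partners of s1 and s2 over A and B, the counts leave exactly one
    exposed vertex. *)
Lemma whole_eqm_none U : independent e U -> pm e (~: U) -> s1 \notin U -> s2 \notin U -> #|U| = 1.
Proof.
move=> iU p s1U s2U.
have [|t [s1t q]] := whole_partner _ p; first by sets.
rewrite !inE => tX.
have nt2 : t != s2 by apply: contraNneq ns12 => <-.
have tU : t \notin U by case/orP: tX => /andP[].
have s2X : s2 \in ~: U :\ s1 :\ t by sets.
have [t' [t'X s2t' q']] := pm_rem e_sym e_irr q s2X.
have t'U : t' \notin U by sets.
have ntt : t != t' by sets.
have E0 : U :&: [set s1; s2] = set0 by sets.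
rewrite whole_card E0 cards0 addn0.
have iA := indepI (X := A) iU; have iB := indepI (X := B) iU.
have sA : U :&: A \subset A by sets. have sB : U :&: B \subset B by sets.
case: (cut_case c t') => [E|E|t'A|t'B]; [by rewrite E !inE eqxx ?andbF in t'X|by rewrite E e_irr in s2t'| |];
  case/orP: tX => /andP[_ tX].
- have [||||pA pB] := @whole_restrict _ (A :\: (U :&: A) :\ t :\ t') (B :\: (U :&: B)) _ _ q'; [by sets|by sets|by sets|by sets|].
  have [u Eu _] := whole_B0 sB iB pB; rewrite Eu cards1.
  by rewrite (gadgetA_2 gA sA iA _ _ _ _ ntt pA) // ?in_nbr ?tX ?t'A //; sets.
- have [||||pA pB] := @whole_restrict _ (A :\: (U :&: A) :\ t') (B :\: (U :&: B) :\ t) _ _ q'; [by sets|by sets|by sets|by sets|].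
  rewrite (whole_B1 sB iB tX _ _ pB); [|by sets|by rewrite s1t].
  have [||u Eu _] := gadgetA_1 (gadgetA_sym gA) sA iA _ _ pA; [by rewrite in_nbr t'A|by sets|].
  by rewrite Eu cards1.
- have [||||pA pB] := @whole_restrict _ (A :\: (U :&: A) :\ t) (B :\: (U :&: B) :\ t') _ _ q'; [by sets|by sets|by sets|by sets|].
  rewrite (whole_B1 sB iB t'B _ _ pB); [|by sets|by rewrite s2t' orbT].
  have [||u Eu _] := gadgetA_1 gA sA iA _ _ pA; [by rewrite in_nbr tX|by sets|].
  by rewrite Eu cards1.
- have [||||pA pB] := @whole_restrict _ (A :\: (U :&: A)) (B :\: (U :&: B) :\ t :\ t') _ _ q'; [by sets|by sets|by sets|by sets|].
  rewrite (gadgetA_0 gA sA iA pA).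
  by rewrite (whole_B2 sB iB tX _ t'B _ s1t s2t' pB) //; sets.
Qed.

Definition critical_at u v := exists w,
  [/\ w != u, w != v, ~~ e u w, ~~ e v w & pm e (~: [set u; v; w])].

Lemma critical_at_sym u v : critical_at u v -> critical_at v u.
Proof. by case=> w [*]; exists w; split=> //; rewrite (setUC [set v]). Qed.

(** The witness is a neighbour of s2 in B, which s1 does not see. *)
Lemma whole_crit_sA a : a \in A -> e s1 a -> critical_at s1 a.
Proof.
move=> aA s1a; have aN : a \in nbr e s1 A by rewrite in_nbr aA.
have [a' [+ n p]] := gadgetA_partner gA aN; rewrite in_nbr => /andP[a'A s2a'].
have [b bB s2b] := whole_M2; have pB : pm e (B :\ b) by apply: whole_pmB; rewrite ?s2b ?orbT.
exists b; split; [by sets|by sets|by apply: contraL s2b; apply: whole_excl|exact: aAB|].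
pmadd s2 a'; apply: (pm_eq (pm_union _ p pB)); by sets.
Qed.

Lemma whole_crit_sB b : b \in B -> e s1 b -> critical_at s1 b.
Proof.
move=> bB s1b; have pB : pm e (B :\ b) by apply: whole_pmB; rewrite ?s1b.
exists s2; split; [by rewrite eq_sym|by sets|by []|by rewrite e_sym; apply: whole_excl|].
by apply: (pm_eq (pm_union _ whole_pmA pB)); sets.
Qed.

(** The witness lies in B, left out after both cut vertices are matched into B. *)
Lemma whole_crit_AA a a' : a \in A -> a' \in A -> e a a' -> critical_at a a'.
Proof.
move=> aA a'A aa'; have p := gadgetA_edge gA aA a'A aa'.
have [b1 b1B s1b1] := whole_M1; have [b2 b2B s2b2] := whole_M2.
have n : b1 != b2 by apply: contraTneq s2b2 => <-; exact: whole_excl.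
have b1D : b1 \in nbr e s1 B :|: nbr e s2 B by apply: nbr_U => //; rewrite s1b1.
have b2D : b2 \in nbr e s1 B :|: nbr e s2 B by apply: nbr_U => //; rewrite s2b2 orbT.
have [w wB pw] := gadgetB_spare gB b1D b2D n.
have wB' : w \in B by sets.
exists w; split; [by sets|by sets|exact: aAB|exact: aAB|].
pmadd s1 b1; pmadd s2 b2; apply: (pm_eq (pm_union _ p pw)); by sets.
Qed.

(** The witness is a vertex of A, left out when s1 is matched into A and s2 to z. *)
Lemma whole_crit_BB b b' z : b \in B -> b' \in B -> z \in B :\ b :\ b' -> e s2 z ->
  pm e (B :\ b :\ b' :\ z) -> critical_at b b'.
Proof.
move=> bB b'B zB s2z pB.
have [a aN] := set0Pn _ (gadgetA_ne gA).
have [a' [+ n p]] := gadgetA_partner gA aN.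
move: aN; rewrite !in_nbr => /andP[aA s1a] /andP[a'A s2a'].
exists a'; split; [by sets|by sets|by rewrite e_sym; apply: aAB|by rewrite e_sym; apply: aAB|].
pmadd s1 a; pmadd s2 z; apply: (pm_eq (pm_union _ p pB)); by sets.
Qed.

End Whole.

Lemma gadget_cut_fc s1 s2 A B : gadget_cut e s1 s2 A B -> fc e.
Proof.
move=> g v; have gs := gadget_cut_sym g; have [c _ gA _ _] := g.
case: (cut_case c v) => [->|->|vA|vB]; [exact: (whole_fc_s g)|exact: (whole_fc_s gs)| |exact: (whole_fc_B g)].
have : v \in nbr e s1 A :|: nbr e s2 A by rewrite -(gadgetA_cover gA).
rewrite inE !in_nbr vA /= => /orP[h|h]; [exact: (whole_fc_A gs)|exact: (whole_fc_A g)].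
Qed.

Lemma gadget_cut_eqm s1 s2 A B : gadget_cut e s1 s2 A B -> eqm e.
Proof.
move=> g U iU p; have gs := gadget_cut_sym g.
have [s1U|s1U] := boolP (s1 \in U); have [s2U|s2U] := boolP (s2 \in U).
- by case: (whole_eqm_both g iU p).
- exact: (whole_eqm_one gs).
- exact: (whole_eqm_one g).
- exact: (whole_eqm_none g).
Qed.

Lemma gadget_cut_crit s1 s2 A B : gadget_cut e s1 s2 A B -> crit e.
Proof.
move=> g u v uv; have gs := gadget_cut_sym g; have [c n12 gA gB _] := g.
have [_ _ _ aAB _] := c.
have S s t x : gadget_cut e s t A B -> e s x -> critical_at s x.
  move=> g' sx; have [c' n _ _ _] := g'; case: (cut_case c' x) => [E|E|xA|xB].
  - by rewrite E e_irr in sx.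
  - by rewrite E (negbTE n) in sx.
  - exact: (whole_crit_sA g').
  - exact: (whole_crit_sB g').
case: (cut_case c u) => [E|E|uA|uB].
- by rewrite E in uv *; apply: (S _ s2).
- by rewrite E in uv *; apply: (S _ s1).
- case: (cut_case c v) => [E|E|vA|vB].
  + by rewrite E e_sym in uv *; apply/critical_at_sym/(S _ s2).
  + by rewrite E e_sym in uv *; apply/critical_at_sym/(S _ s1).
  + exact: (whole_crit_AA g).
  + by have := aAB u v uA vB; rewrite uv.
- case: (cut_case c v) => [E|E|vA|vB].
  + by rewrite E e_sym in uv *; apply/critical_at_sym/(S _ s2).
  + by rewrite E e_sym in uv *; apply/critical_at_sym/(S _ s1).
  + by have := aAB v u vA uB; rewrite e_sym uv.
  + have [z + p] := gadgetB_edge gB uB vB uv.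
    rewrite !in_setD1 inE !in_nbr -andb_orr => /and4P[zv zu zB zS].
    have zX : z \in B :\ u :\ v by sets.
    by case/orP: zS => h; [apply: (whole_crit_BB gs _ _ zX)|apply: (whole_crit_BB g _ _ zX)].
Qed.

(** A closed set is read as a boolean function constant along edges, so connectedness is proved by
    propagating one value of f. *)
Lemma conn_constant v : (forall f : T -> bool,
    (forall x y, x != v -> y != v -> e x y -> f x = f y) ->
    exists k, forall x, x != v -> f x = k) -> conn e (~: [set v]).
Proof.
move=> H C [sC aC] /set0Pn[x xC].
have [|k Hk] := H (fun z => z \in C).
  move=> y z yv zv yz; apply/idP/idP=> h; apply/negPn/negP=> h'.
    by have := aC y z h; rewrite !inE h' zv yz => /(_ isT).
  by have := aC z y h; rewrite !inE h' yv e_sym yz => /(_ isT).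
have kT : k = true by rewrite -(Hk x) //; sets.
apply/eqP; rewrite eqEsubset sC; apply/subsetP=> y; rewrite !inE => yv.
by rewrite Hk.
Qed.

(** * Absence of cut vertices in types I to IV *)

Section Connect.
Variables (s1 s2 : T) (A B : {set T}).
Hypothesis g : gadget_cut e s1 s2 A B.
Let c : cut e s1 s2 A B. Proof. by case: g. Qed.
Let gA : gadgetA e A (nbr e s1 A) (nbr e s2 A). Proof. by case: g. Qed.
Let gB : gadgetB e B (nbr e s1 B :|: nbr e s2 B). Proof. by case: g. Qed.
Let n12 : s1 != s2. Proof. by case: c. Qed.
Let AB : A :|: B = ~: [set s1; s2]. Proof. by case: c. Qed.
Let dAB : [disjoint A & B]. Proof. by case: c. Qed.

Lemma conn_minus_A v : v \in A -> conn e (~: [set v]).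
Proof.
move=> vA; apply: conn_constant => f inv; exists (f s1).
have h1 : s1 != v by sets. have h2 : s2 != v by sets.
have nB x : x \in B -> x != v by move=> xB; sets.
have [b1 b1B s1b1] := whole_M1 g; have [b2 b2B s2b2] := whole_M2 g.
have b1D : b1 \in nbr e s1 B :|: nbr e s2 B by apply: nbr_U => //; rewrite s1b1.
have b2D : b2 \in nbr e s1 B :|: nbr e s2 B by apply: nbr_U => //; rewrite s2b2 orbT.
have invB x y : x \in B -> y \in B -> e x y -> f x = f y.
  by move=> xB yB; apply: inv; exact: nB.
have inv1 x : x != v -> e s1 x -> f x = f s1 by move=> xv s1x; rewrite (inv s1 x).
have inv2 x : x != v -> e s2 x -> f x = f s2 by move=> xv s2x; rewrite (inv s2 x).
have E12 : f s2 = f s1.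
  rewrite -(inv1 b1 (nB _ b1B) s1b1) -(inv2 b2 (nB _ b2B) s2b2).
  case: (gadgetB_link gB b1D b2D) => [->//|[b12|[p pB [bp pb]]]]; first by rewrite (invB b1 b2).
  by rewrite (invB b1 p) ?(invB p b2).
have EB x : x \in B -> f x = f s1.
  move=> xB; have xv := nB x xB; have [|xD] := boolP (x \in nbr e s1 B :|: nbr e s2 B).
    by rewrite inE !in_nbr xB /= => /orP[/(inv1 x xv)|/(inv2 x xv)->].
  by rewrite (invB x b1) ?(inv1 b1 (nB _ b1B)) //; apply: (gadgetB_toD gB).
move=> x xv; case: (cut_case c x) => [->//|->//|xA|]; last exact: EB.
have : x \in nbr e s1 A :|: nbr e s2 A by rewrite -(gadgetA_cover gA).
by rewrite inE !in_nbr xA /= => /orP[/(inv1 x xv)|/(inv2 x xv)->].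
Qed.

Lemma conn_minus_B v : v \in B -> conn e (~: [set v]).
Proof.
move=> vB; apply: conn_constant => f inv; exists (f s1).
have h1 : s1 != v by sets. have h2 : s2 != v by sets.
have nA x : x \in A -> x != v by move=> xA; sets.
have inv1 x : x != v -> e s1 x -> f x = f s1 by move=> xv s1x; rewrite (inv s1 x).
have inv2 x : x != v -> e s2 x -> f x = f s2 by move=> xv s2x; rewrite (inv s2 x).
have E12 : f s2 = f s1.
  have [a [a' [+ + aa']]] := gadgetA_link gA; rewrite !in_nbr => /andP[aA s1a] /andP[a'A s2a'].
  rewrite -(inv1 a (nA _ aA) s1a) -(inv2 a' (nA _ a'A) s2a').
  by case: aa' => [->//|aa']; rewrite (inv a a') // nA.
have ES x : x != v -> e s1 x || e s2 x -> f x = f s1.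
  by move=> xv /orP[/(inv1 x xv)|/(inv2 x xv)->].
have [b1 b1B s1b1] := whole_M1 g; have [b2 b2B s2b2] := whole_M2 g.
have nb : b1 != b2 by apply: contraTneq s2b2 => <-; exact: (whole_excl g).
have [d [dB dv dS]] : exists d, [/\ d \in B, d != v & e s1 d || e s2 d].
  have [E|n] := eqVneq b1 v; last by exists b1; rewrite b1B n s1b1.
  by exists b2; split=> //; [rewrite -E eq_sym|rewrite s2b2 orbT].
move=> x xv; case: (cut_case c x) => [->//|->//|xA|xB].
  have : x \in nbr e s1 A :|: nbr e s2 A by rewrite -(gadgetA_cover gA).
  by rewrite inE !in_nbr xA /=; apply: ES.
have [xS|xS] := boolP (e s1 x || e s2 x); first exact: ES.
rewrite -(ES d dv dS); apply: inv => //; apply: (gadgetB_toD gB) => //.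
  by rewrite inE !in_nbr xB.
exact: nbr_U.
Qed.

Lemma conn_minus_s1 : conn e (~: [set s1]).
Proof.
apply: conn_constant => f inv; exists (f s2).
have h2 : s2 != s1 by rewrite eq_sym.
have nA x : x \in A -> x != s1 by move=> xA; sets.
have nB x : x \in B -> x != s1 by move=> xB; sets.
have invB x y : x \in B -> y \in B -> e x y -> f x = f y.
  by move=> xB yB; apply: inv; exact: nB.
have inv2 x : x != s1 -> e s2 x -> f x = f s2 by move=> xv s2x; rewrite (inv s2 x).
have [b1 b1B s1b1] := whole_M1 g; have [b2 b2B s2b2] := whole_M2 g.
have b2D : b2 \in nbr e s1 B :|: nbr e s2 B by apply: nbr_U => //; rewrite s2b2 orbT.
have Eb := inv2 b2 (nB _ b2B) s2b2.
move=> x xv; case: (cut_case c x) => [E|->//|xA|xB].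
- by rewrite E eqxx in xv.
- case: (gadgetA_toN2 gA xA) => [|[a]]; rewrite in_nbr => /andP[aA s2a].
    exact: inv2.
  by move=> xa; rewrite (inv x a) ?nA // inv2 ?nA.
- have [xD|xD] := boolP (x \in nbr e s1 B :|: nbr e s2 B); last first.
    by rewrite -Eb; apply: invB => //; apply: (gadgetB_toD gB).
  rewrite -Eb; case: (gadgetB_link gB xD b2D) => [->//|[xb|[p pB [xp pb]]]].
    exact: invB.
  by rewrite (invB x p) ?(invB p b2).
Qed.

End Connect.

Lemma gadget_cut_conn s1 s2 A B v : gadget_cut e s1 s2 A B -> conn e (~: [set v]).
Proof.
move=> g; have gs := gadget_cut_sym g; have [c _ _ _ _] := g.
case: (cut_case c v) => [->|->|vA|vB].
- exact: (conn_minus_s1 g).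
- exact: (conn_minus_s1 gs).
- exact: (conn_minus_A g).
- exact: (conn_minus_B g).
Qed.

End Converse.

(** * Type V satisfies the three conditions *)

Section SpikeConverse.
Variables (T : finType) (e : rel T).
Hypotheses (e_sym : symmetric e) (e_irr : irreflexive e).
Implicit Types (X Y A B C D P Q R U I W N M : {set T}) (x y z u v w b t k : T).

(** Type V with A described through its missing edges, all inside {a1, a2, w}, and with q replaced
    by the order of A. *)
Definition spike_cut s1 s2 b A a1 a2 w :=
  [/\ cut e s1 s2 A [set b], [/\ ~~ e s1 s2, e s1 b & e s2 b],
      [/\ a1 \in A, a2 \in A & w \in A] /\ [/\ a1 != a2, a1 != w & a2 != w],
      {in A, forall x, e s1 x = (x \in [set a1; w]) /\ e s2 x = (x \in [set a2; w])} &
      [/\ ~~ odd #|A|, 6 <= #|A|, independent e [set a1; a2; w] &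
        forall x y, x \in A -> y \in A -> x != y -> ~~ e x y ->
         x \in [set a1; a2; w] /\ y \in [set a1; a2; w]]].

Lemma spike_cut_sym s1 s2 b A a1 a2 w :
  spike_cut s1 s2 b A a1 a2 w -> spike_cut s2 s1 b A a2 a1 w.
Proof.
move=> [c [n12 e1 e2] [[i1 i2 i3] [d1 d2 d3]] N [o c6 iI K]].
have E : [set a2; a1; w] = [set a1; a2; w] by sets.
split; rewrite ?E //.
- exact: cut_sym.
- by split=> //; rewrite e_sym.
- by split; split=> //; rewrite eq_sym.
- by move=> x xA; have [] := N x xA.
Qed.

Section Facts.
Variables (s1 s2 b : T) (A : {set T}) (a1 a2 w : T).
Hypothesis g : spike_cut s1 s2 b A a1 a2 w.
Let c : cut e s1 s2 A [set b]. Proof. by case: g. Qed.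
Let n12 : s1 != s2. Proof. by case: c. Qed.
Let AB : A :|: [set b] = ~: [set s1; s2]. Proof. by case: c. Qed.
Let dAB : [disjoint A & [set b]]. Proof. by case: c. Qed.
Let ns12 : ~~ e s1 s2. Proof. by case: g => _ []. Qed.
Let s1b : e s1 b. Proof. by case: g => _ []. Qed.
Let s2b : e s2 b. Proof. by case: g => _ []. Qed.
Let a1A : a1 \in A. Proof. by case: g => _ _ [[]]. Qed.
Let a2A : a2 \in A. Proof. by case: g => _ _ [[]]. Qed.
Let wA : w \in A. Proof. by case: g => _ _ [[]]. Qed.
Let d12 : a1 != a2. Proof. by case: g => _ _ [_ []]. Qed.
Let d1w : a1 != w. Proof. by case: g => _ _ [_ []]. Qed.
Let d2w : a2 != w. Proof. by case: g => _ _ [_ []]. Qed.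
Let evA : ~~ odd #|A|. Proof. by case: g => _ _ _ _ []. Qed.
Let N1 x : x \in A -> e s1 x = (x \in [set a1; w]).
Proof. by case: g => _ _ _ H _ xA; have [] := H x xA. Qed.
Let N2 x : x \in A -> e s2 x = (x \in [set a2; w]).
Proof. by case: g => _ _ _ H _ xA; have [] := H x xA. Qed.
Let iI : independent e [set a1; a2; w]. Proof. by case: g => _ _ _ _ []. Qed.
Let s1A : s1 \notin A. Proof. by sets. Qed.
Let s2A : s2 \notin A. Proof. by sets. Qed.
Let bA : b \notin A. Proof. by sets. Qed.
Let nb1 : b != s1. Proof. by sets. Qed.
Let nb2 : b != s2. Proof. by sets. Qed.
Let s1a1 : e s1 a1. Proof. by rewrite N1 // !inE eqxx. Qed.
Let s1w : e s1 w. Proof. by rewrite N1 // !inE eqxx orbT. Qed.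
Let s2a2 : e s2 a2. Proof. by rewrite N2 // !inE eqxx. Qed.
Let s2w : e s2 w. Proof. by rewrite N2 // !inE eqxx orbT. Qed.
Let s1a2 : ~~ e s1 a2. Proof. by rewrite N1 // !inE eq_sym negb_or d12. Qed.
Let s2a1 : ~~ e s2 a1. Proof. by rewrite N2 // !inE negb_or d12. Qed.

Lemma spike_adj x y : x \in A -> y \in A -> x != y -> x \notin [set a1; a2; w] -> e x y.
Proof.
move=> xA yA nxy xI; apply/negPn/negP=> xy; case: g => _ _ _ _ [_ _ _ K].
by have [xI' _] := K x y xA yA nxy xy; rewrite xI' in xI.
Qed.

(** A set with at most one vertex of the missing triangle is a clique; t names that vertex and is
    arbitrary if there is none. *)
Lemma spike_pm1 X t : X \subset A -> ~~ odd #|X| -> X :&: [set a1; a2; w] \subset [set t] -> pm e X.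
Proof.
move=> sX o sI; apply: (pm_clique e_irr) => // x y xX yX nxy.
have xA : x \in A by sets. have yA : y \in A by sets.
have [xI|xI] := boolP (x \in [set a1; a2; w]); last exact: spike_adj.
have [yI|yI] := boolP (y \in [set a1; a2; w]); last first.
  by rewrite e_sym; apply: spike_adj => //; rewrite eq_sym.
have /(subsetP sI) : x \in X :&: [set a1; a2; w] by rewrite in_setI xX xI.
have /(subsetP sI) : y \in X :&: [set a1; a2; w] by rewrite in_setI yX yI.
by move=> /set1P E1 /set1P E2; rewrite E1 E2 eqxx in nxy.
Qed.

(** A second vertex i of the missing triangle is first matched to a vertex k outside it. *)
Lemma spike_pm2 X i k t : X \subset A -> ~~ odd #|X| -> i \in X -> k \in X -> i != k ->
  k \notin [set a1; a2; w] ->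
  (X :\ i :\ k) :&: [set a1; a2; w] \subset [set t] -> pm e X.
Proof.
move=> sX o iX kX nik kI sI.
have ik : e i k by rewrite e_sym; apply: spike_adj => //; [by sets|by sets|by rewrite eq_sym].
apply: (pm_add e_irr iX kX ik); apply: (@spike_pm1 _ t) => //; first by sets.
by move: o; rewrite -(card_rem2 nik iX kX) /= negbK.
Qed.

Lemma spike_even2 x y : x \in A -> y \in A -> x != y -> ~~ odd #|A :\ x :\ y|.
Proof. by move=> xA yA n; move: evA; rewrite -(card_rem2 n xA yA) /= negbK. Qed.

Lemma spike_clique_vertex z : exists2 k, k \in A & (k \notin [set a1; a2; w]) && (k != z).
Proof.
have : A :\: [set a1; a2; w] :\ z != set0.
  have sI : [set a1; a2; w] \subset A by sets.
  have := cardsID [set a1; a2; w] A; rewrite (setIidPr sI) cards3 //.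
  have := cardsD1 z (A :\: [set a1; a2; w]); case: g => _ _ _ _ [_ c6 _ _].
  rewrite -card_gt0; move: c6; clear; case: (_ \in _); lia.
by case/set0Pn=> k; rewrite in_setD1 in_setD => /and3P[kz kI kA]; exists k; rewrite ?kI.
Qed.

Lemma spike_fc_s : pm e (~: [set s1]).
Proof.
have [k kA /andP[kI _]] := spike_clique_vertex a1.
have [k' k'A /andP[k'I nkk']] := spike_clique_vertex k.
have na1k : a1 != k by sets. have na1k' : a1 != k' by sets.
have na2k : a2 != k by sets. have na2k' : a2 != k' by sets.
pmadd s2 b.
have a1k : e a1 k by rewrite e_sym; apply: spike_adj => //; rewrite eq_sym.
pmadd a1 k.
have E : ~: [set s1] :\ s2 :\ b :\ a1 :\ k = A :\ a1 :\ k by sets.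
rewrite E; apply: (@spike_pm2 _ a2 k' w) => //; [by sets|exact: spike_even2|by sets|by sets|by sets].
Qed.

Lemma spike_fc_b : pm e (~: [set b]).
Proof.
pmadd s1 a1; pmadd s2 w.
have -> : ~: [set b] :\ s1 :\ a1 :\ s2 :\ w = A :\ a1 :\ w by sets.
by apply: (@spike_pm1 _ a2); [sets|exact: spike_even2|sets].
Qed.

Lemma spike_fc_a1 : pm e (~: [set a1]).
Proof.
pmadd s1 b; pmadd s2 w.
have -> : ~: [set a1] :\ s1 :\ b :\ s2 :\ w = A :\ a1 :\ w by sets.
by apply: (@spike_pm1 _ a2); [sets|exact: spike_even2|sets].
Qed.

Lemma spike_fc_w : pm e (~: [set w]).
Proof.
have nw2 : w != a2 by rewrite eq_sym.
pmadd s1 b; pmadd s2 a2.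
have -> : ~: [set w] :\ s1 :\ b :\ s2 :\ a2 = A :\ w :\ a2 by sets.
by apply: (@spike_pm1 _ a1); [sets|exact: spike_even2|sets].
Qed.

Lemma spike_fc_k k : k \in A -> k \notin [set a1; a2; w] -> pm e (~: [set k]).
Proof.
move=> kA kI; have [k' k'A /andP[k'I nkk']] := spike_clique_vertex k.
have nk2 : k != a2 by sets. have n1k' : a1 != k' by sets.
pmadd s1 b; pmadd s2 a2.
have -> : ~: [set k] :\ s1 :\ b :\ s2 :\ a2 = A :\ k :\ a2 by sets.
by apply: (@spike_pm2 _ a1 k' w) => //; [sets|exact: spike_even2|sets|sets|sets].
Qed.

Lemma spike_indep U : U \subset A -> independent e U -> 2 <= #|U| -> U \subset [set a1; a2; w].
Proof.
move=> sU iU /card_gt1P[x [y [xU yU n]]]; apply/subsetP=> z zU; apply/negPn/negP=> zI.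
have zA : z \in A by sets.
have [E|nzx] := eqVneq z x.
  have yA : y \in A by sets. rewrite -E in n.
  by have := iU z y zU yU; rewrite spike_adj.
have xA : x \in A by sets.
by have := iU z x zU xU; rewrite spike_adj.
Qed.

Lemma spike_card U : #|U| = #|U :&: A| + #|U :&: [set s1; s2; b]|.
Proof. by apply: card_split; sets. Qed.

Lemma spike_restrict X Y : s1 \notin X -> s2 \notin X -> pm e X -> X :&: A = Y -> pm e Y.
Proof. by move=> s1X s2X p <-; have [] := cut_restrict e_sym e_irr c s1X s2X p. Qed.

Lemma spike_nbr1 t : e s1 t -> t = b \/ t = a1 \/ t = w.
Proof.
move=> h; case: (cut_case c t) => [E|E|tA|/set1P ->]; [by rewrite E e_irr in h|by rewrite E (negbTE ns12) in h| |by left].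
by right; move: h; rewrite N1 // !inE => /orP[] /eqP; [left|right].
Qed.

Lemma spike_nbr2 t : e s2 t -> t = b \/ t = a2 \/ t = w.
Proof.
move=> h; case: (cut_case c t) => [E|E|tA|/set1P ->]; [by rewrite E e_sym (negbTE ns12) in h|by rewrite E e_irr in h| |by left].
by right; move: h; rewrite N2 // !inE => /orP[] /eqP; [left|right].
Qed.

Lemma spike_nbrb t : e b t -> t = s1 \/ t = s2.
Proof.
case: (cut_case c t) => [->|->|tA|/set1P ->]; [by left|by right| |by rewrite e_irr].
by case: c => _ _ _ a _; rewrite e_sym (negbTE (a t b tA (set11 b))).
Qed.

Lemma evenU U : U \subset A -> pm e (A :\: U) -> ~~ odd #|U|.
Proof.
move=> sU p; have := cardsID U A; rewrite (setIidPr sU) => E.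
by move: evA; rewrite -E oddD (negbTE (pm_even e_irr p)) addbF.
Qed.

(** A larger U would lie inside the missing triangle, where x and y leave room for one vertex. *)
Lemma spike_le1 U x y : U \subset A -> independent e U -> x \in [set a1; a2; w] ->
  y \in [set a1; a2; w] -> x != y -> x \notin U -> y \notin U -> #|U| <= 1.
Proof.
move=> sU iU xI yI n xU yU; rewrite leqNgt; apply/negP=> U2.
have sI := spike_indep sU iU U2.
have : U \subset [set a1; a2; w] :\ x :\ y by sets.
move/subset_leq_card; have := card_rem2 n xI yI; rewrite cards3 //.
by move: U2; clear; lia.
Qed.

(** With b exposed, s1 and s2 take two vertices of the missing triangle. At most one vertex of A is
    then exposed, and parity excludes even that. *)
Lemma spike_eqm_b U : independent e U -> pm e (~: U) -> b \in U -> #|U| = 1.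
Proof.
move=> iU p bU.
have s1U : s1 \notin U by apply/negP=> h; have := iU s1 b h bU; rewrite s1b.
have s2U : s2 \notin U by apply/negP=> h; have := iU s2 b h bU; rewrite s2b.
have s1X : s1 \in ~: U by sets.
have [t [tX s1t q]] := pm_rem e_sym e_irr p s1X.
have nt2 : t != s2 by apply: contraNneq ns12 => <-.
have s2X : s2 \in ~: U :\ s1 :\ t by sets.
have [t' [t'X s2t' q']] := pm_rem e_sym e_irr q s2X.
have tU : t \notin U by sets. have t'U : t' \notin U by sets.
have ntt : t != t' by sets.
have [tA tI] : t \in A /\ t \in [set a1; a2; w].
  case: (spike_nbr1 s1t) => [E|[E|E]]; first by rewrite E bU in tU.
    by rewrite E; split; [exact: a1A|rewrite !inE eqxx].
  by rewrite E; split; [exact: wA|rewrite !inE eqxx !orbT].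
have [t'A t'I] : t' \in A /\ t' \in [set a1; a2; w].
  case: (spike_nbr2 s2t') => [E|[E|E]]; first by rewrite E bU in t'U.
    by rewrite E; split; [exact: a2A|rewrite !inE eqxx orbT].
  by rewrite E; split; [exact: wA|rewrite !inE eqxx !orbT].
have sUA : U :&: A \subset A by sets.
have iUA := independentS (subsetIl U A) iU.
have q2 : pm e (A :\: (U :&: A) :\ t :\ t').
  by apply: (spike_restrict _ _ q'); sets.
have le1 : #|U :&: A| <= 1 by apply: (@spike_le1 _ t t') => //; sets.
have tX' : t \in A :\: (U :&: A) by sets. have t'X' : t' \in A :\: (U :&: A) by sets.
have E : U :&: [set s1; s2; b] = [set b] by sets.
have o := pm_even e_irr q2; have E2 := card_rem2 ntt tX' t'X'.
have E3 := cardsID (U :&: A) A; rewrite (setIidPr sUA) -E2 in E3.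
rewrite (spike_card U) E cards1; move: le1 evA; rewrite -E3.
by case: #|U :&: A| => [|[|]] //= _; rewrite negbK (negbTE o).
Qed.

(** If s2 is exposed, its neighbours a2 and w are not, so A exposes at most one vertex. If s2 is
    matched, it takes a vertex of the missing triangle and A exposes at most two. Parity fixes the
    number in both cases. *)
Lemma spike_eqm_s1 U : independent e U -> pm e (~: U) -> b \notin U -> s1 \notin U ->
  pm e (~: U :\ s1 :\ b) -> #|U| = 1.
Proof.
move=> iU p bU s1U q.
have sUA : U :&: A \subset A by sets.
have iUA := independentS (subsetIl U A) iU.
have cA := cardsID (U :&: A) A; rewrite (setIidPr sUA) in cA.
have [s2U|s2U] := boolP (s2 \in U).
  have q2 : pm e (A :\: (U :&: A)) by apply: (spike_restrict _ _ q); sets.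
  have a2U : a2 \notin U :&: A.
    by rewrite in_setI; apply/negP=> /andP[h _]; have := iU s2 a2 s2U h; rewrite s2a2.
  have wU : w \notin U :&: A.
    by rewrite in_setI; apply/negP=> /andP[h _]; have := iU s2 w s2U h; rewrite s2w.
  have le1 : #|U :&: A| <= 1.
    by apply: (@spike_le1 _ a2 w) => //; rewrite !inE eqxx ?orbT.
  have E : U :&: [set s1; s2; b] = [set s2] by sets.
  rewrite (spike_card U) E cards1; have := evenU sUA q2.
  by move: le1; case: #|U :&: A| => [|[|]].
have s2X : s2 \in ~: U :\ s1 :\ b by sets.
have [t [tX s2t q']] := pm_rem e_sym e_irr q s2X.
have tU : t \notin U by sets.
have [tA tI] : t \in A /\ t \in [set a1; a2; w].
  case: (spike_nbr2 s2t) => [E|[E|E]]; first by rewrite E !inE eqxx in tX.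
    by rewrite E; split; [exact: a2A|rewrite !inE eqxx orbT].
  by rewrite E; split; [exact: wA|rewrite !inE eqxx !orbT].
have q2 : pm e (A :\: (U :&: A) :\ t) by apply: (spike_restrict _ _ q'); sets.
have tX' : t \in A :\: (U :&: A) by sets.
have E : U :&: [set s1; s2; b] = set0 by sets.
have le2 : #|U :&: A| <= 2.
  rewrite leqNgt; apply/negP=> U3; have sI := spike_indep sUA iUA (ltnW U3).
  have : U :&: A \subset [set a1; a2; w] :\ t by sets.
  move/subset_leq_card; have := card_rem1 tI; rewrite cards3 //.
  by move: U3; clear; lia.
have o := pm_even e_irr q2; rewrite (card_rem1 tX') in cA.
rewrite (spike_card U) E cards0 addn0; move: le2 evA; rewrite -cA.
by case: #|U :&: A| => [|[|[|]]] //= _; rewrite ?negbK ?add0n /= (negbTE o).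
Qed.

Lemma spike_b_A x : x \in A -> ~~ e x b.
Proof. by move=> xA; case: c => _ _ _ a _; apply: (a x b xA (set11 b)). Qed.

(** For all three edges at s1 the witness is a2, adjacent to none of s1, b, a1 and w. *)
Lemma spike_crit_b : critical_at e s1 b.
Proof.
exists a2; split; [by sets|by sets|by []|by rewrite e_sym; apply: spike_b_A|].
pmadd s2 w.
have -> : ~: [set s1; b; a2] :\ s2 :\ w = A :\ a2 :\ w by sets.
by apply: (@spike_pm1 _ a1); [sets|exact: spike_even2|sets].
Qed.

Lemma spike_crit_a1 : critical_at e s1 a1.
Proof.
exists a2; split; [by sets|by rewrite eq_sym|by []| |].
  by apply: iI; rewrite !inE eqxx ?orbT.
pmadd s2 b.
have -> : ~: [set s1; a1; a2] :\ s2 :\ b = A :\ a1 :\ a2 by sets.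
by apply: (@spike_pm1 _ w); [sets|exact: spike_even2|sets].
Qed.

Lemma spike_crit_w : critical_at e s1 w.
Proof.
have nw2 : w != a2 by rewrite eq_sym.
exists a2; split; [by sets|by []|by []| |].
  by apply: iI; rewrite !inE eqxx ?orbT.
pmadd s2 b.
have -> : ~: [set s1; w; a2] :\ s2 :\ b = A :\ w :\ a2 by sets.
by apply: (@spike_pm1 _ a1); [sets|exact: spike_even2|sets].
Qed.

(** The witness is s2, with b matched to s1. *)
Lemma spike_crit_a1k k : k \in A -> k \notin [set a1; a2; w] -> critical_at e a1 k.
Proof.
move=> kA kI; have [k' k'A /andP[k'I nk'k]] := spike_clique_vertex k.
have n1k : a1 != k by sets. have n2k' : a2 != k' by sets.
have n2k : ~~ e s2 k by rewrite N2 //; sets.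
exists s2; split; [by sets|by sets|by rewrite e_sym|by rewrite e_sym|].
pmadd s1 b.
have -> : ~: [set a1; k; s2] :\ s1 :\ b = A :\ a1 :\ k by sets.
by apply: (@spike_pm2 _ a2 k' w) => //; [sets|exact: spike_even2|sets|sets|sets].
Qed.

(** Here, and for edges avoiding the missing triangle, the witness is b, both cut vertices being
    matched into that triangle. *)
Lemma spike_crit_wk k : k \in A -> k \notin [set a1; a2; w] -> critical_at e w k.
Proof.
move=> kA kI; have nwk : w != k by sets.
have nk1 : k != a1 by sets. have nk2 : k != a2 by sets.
exists b; split; [by sets|by sets|exact: spike_b_A|exact: spike_b_A|].
pmadd s1 a1; pmadd s2 a2.
have -> : ~: [set w; k; b] :\ s1 :\ a1 :\ s2 :\ a2 = A :\ w :\ k :\ a1 :\ a2 by sets.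
apply: (@spike_pm1 _ a1); [by sets| |by sets].
by rewrite odd_rem2 ?spike_even2 //; sets.
Qed.

Lemma spike_crit_kk k k' : k \in A -> k \notin [set a1; a2; w] -> k' \in A ->
  k' \notin [set a1; a2; w] -> k != k' -> critical_at e k k'.
Proof.
move=> kA kI k'A k'I nkk'; have nwk : w != k by sets. have nwk' : w != k' by sets.
have nk2 : k != a2 by sets. have nk2' : k' != a2 by sets.
have nw2 : w != a2 by rewrite eq_sym.
exists b; split; [by sets|by sets|exact: spike_b_A|exact: spike_b_A|].
pmadd s1 w; pmadd s2 a2.
have -> : ~: [set k; k'; b] :\ s1 :\ w :\ s2 :\ a2 = A :\ k :\ k' :\ w :\ a2 by sets.
apply: (@spike_pm1 _ a1); [by sets| |by sets].
by rewrite odd_rem2 ?spike_even2 //; sets.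
Qed.

Lemma spike_crit_s x : e s1 x -> critical_at e s1 x.
Proof.
by case/spike_nbr1 => [->|[->|->]]; [exact: spike_crit_b|exact: spike_crit_a1|exact: spike_crit_w].
Qed.

Lemma spike_cut_conn v : conn e (~: [set v]).
Proof.
apply: (conn_constant e_sym) => f inv.
have [k kA /andP[kI kv]] := spike_clique_vertex v.
exists (f k).
have EA x : x \in A -> x != v -> f x = f k.
  move=> xA xv; have [->//|n] := eqVneq x k.
  by rewrite (inv k x) //; apply: spike_adj => //; rewrite eq_sym.
have E1 : s1 != v -> f s1 = f k.
  move=> n; have [E|n1] := eqVneq a1 v; last by rewrite (inv s1 a1) // EA.
  have nw : w != v by rewrite -E eq_sym.
  by rewrite (inv s1 w) // EA.
have E2 : s2 != v -> f s2 = f k.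
  move=> n; have [E|n1] := eqVneq a2 v; last by rewrite (inv s2 a2) // EA.
  have nw : w != v by rewrite -E eq_sym.
  by rewrite (inv s2 w) // EA.
move=> x xv; case: (cut_case c x) => [E|E|xA|/set1P E]; [by rewrite E E1 // -E|by rewrite E E2 // -E|exact: EA|].
rewrite E in xv *; have [Es|ns1] := eqVneq s1 v; last by rewrite -(inv s1 b) // E1.
have ns2 : s2 != v by rewrite -Es eq_sym.
by rewrite -(inv s2 b) // E2.
Qed.

End Facts.

Lemma triple_case a1 a2 w x (I := [set a1; a2; w]) : x \in I -> [\/ x = a1, x = a2 | x = w].
Proof. by rewrite !inE => /orP[/orP[]|] /eqP ->; [constructor 1|constructor 2|constructor 3]. Qed.

Lemma spike_cut_fc s1 s2 b A a1 a2 w : spike_cut s1 s2 b A a1 a2 w -> fc e.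
Proof.
move=> g v; have gs := spike_cut_sym g; have [c _ _ _ _] := g.
case: (cut_case c v) => [->|->|vA|/set1P ->].
- exact: (spike_fc_s g).
- exact: (spike_fc_s gs).
- have [/triple_case[]->|vI] := boolP (v \in [set a1; a2; w]).
  + exact: (spike_fc_a1 g).
  + exact: (spike_fc_a1 gs).
  + exact: (spike_fc_w g).
  + exact: (spike_fc_k g).
- exact: (spike_fc_b g).
Qed.

Lemma spike_cut_eqm s1 s2 b A a1 a2 w : spike_cut s1 s2 b A a1 a2 w -> eqm e.
Proof.
move=> g U iU p; have gs := spike_cut_sym g.
have [bU|bU] := boolP (b \in U); first exact: (spike_eqm_b g).
have bX : b \in ~: U by rewrite inE.
have [t [tX bt q]] := pm_rem e_sym e_irr p bX.
have sw z : pm e (~: U :\ b :\ z) -> pm e (~: U :\ z :\ b).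
  by move=> h; apply: (pm_eq h); sets.
case: (spike_nbrb g bt) => E; rewrite E inE in tX; rewrite {t}E in bt q.
  exact: (spike_eqm_s1 g iU p bU tX (sw _ q)).
exact: (spike_eqm_s1 gs iU p bU tX (sw _ q)).
Qed.

Lemma spike_cut_crit s1 s2 b A a1 a2 w : spike_cut s1 s2 b A a1 a2 w -> crit e.
Proof.
move=> g u v uv; have gs := spike_cut_sym g; have [c _ _ _ [_ _ iI _]] := g.
have n := adj_neq e_irr uv.
have EI : [set a2; a1; w] = [set a1; a2; w] by sets.
have fromk k x : k \in A -> k \notin [set a1; a2; w] -> x \in A -> k != x -> critical_at e k x.
  move=> kA kI xA nkx; have [/triple_case[]->|xI] := boolP (x \in [set a1; a2; w]).
  - by apply/critical_at_sym/(spike_crit_a1k g).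
  - by apply/critical_at_sym/(spike_crit_a1k gs) => //; rewrite EI.
  - by apply/critical_at_sym/(spike_crit_wk g).
  - exact: (spike_crit_kk g).
have S1 x : e s1 x -> critical_at e s1 x by exact: (spike_crit_s g).
have S2 x : e s2 x -> critical_at e s2 x by exact: (spike_crit_s gs).
case: (cut_case c u) => [E|E|uA|/set1P E].
- by rewrite E in uv *; apply: S1.
- by rewrite E in uv *; apply: S2.
- case: (cut_case c v) => [E|E|vA|/set1P E].
  + by rewrite E e_sym in uv *; apply/critical_at_sym/S1.
  + by rewrite E e_sym in uv *; apply/critical_at_sym/S2.
  + have [uI|uI] := boolP (u \in [set a1; a2; w]); last exact: fromk.
    have [vI|vI] := boolP (v \in [set a1; a2; w]); first by have := iI u v uI vI; rewrite uv.
    by apply/critical_at_sym/fromk => //; rewrite eq_sym.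
  + by have := spike_b_A g uA; rewrite -E uv.
- rewrite E in uv *; case: (spike_nbrb g uv) => E'; rewrite E' e_sym in uv *.
    exact/critical_at_sym/S1.
  exact/critical_at_sym/S2.
Qed.

End SpikeConverse.

(** * The concrete types *)

Section Types.
Variables (T : finType) (e : rel T).
Hypotheses (e_sym : symmetric e) (e_irr : irreflexive e).
Implicit Types (X Y A B C D P Q R U I W N M : {set T}) (x y z u v w b t k s : T).

Lemma induces_KnP n A : induces e (Kn n) A <-> clique e A /\ #|A| = n.
Proof.
split=> [[f [f_inj <- fE]]|[k <-]].
  split; last by rewrite card_imset // cardsT card_ord.
  move=> _ _ /imsetP[i _ ->] /imsetP[j _ ->] n_ij; rewrite fE /Kn /=.
  by apply: contraNneq n_ij => ->.
exists (fun i : 'I_#|A| => enum_val i); split.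
- exact: enum_val_inj.
- apply/setP=> x; apply/imsetP/idP=> [[i _ ->]|xA]; first exact: enum_valP.
  by exists (enum_rank_in xA x); rewrite ?inE // enum_rankK_in.
- move=> i j; rewrite /Kn /=; have [->|nij] := eqVneq i j; first by rewrite e_irr.
  by apply: k; rewrite ?enum_valP // (inj_eq enum_val_inj).
Qed.

Lemma induces_KmnP m n A P Q : induces_Kmn e m n A P Q <->
  [/\ bip e P Q, A = P :|: Q, #|P| = m & #|Q| = n].
Proof.
split=> [[f [[f_inj fA fE] -> ->]]|[[d iP iQ k] -> <- <-]].
  split; rewrite ?card_imset ?card_ord //; try by move=> i j /f_inj [].
  - split.
    + by apply: disjointI => _ /imsetP[i _ ->] /imsetP[j _ /f_inj].
    + by move=> _ _ /imsetP[i _ ->] /imsetP[j _ ->]; rewrite fE.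
    + by move=> _ _ /imsetP[i _ ->] /imsetP[j _ ->]; rewrite fE.
    + by move=> _ _ /imsetP[i _ ->] /imsetP[j _ ->]; rewrite fE.
  - rewrite -fA; apply/setP=> x; rewrite inE; apply/imsetP/orP.
      by case=> [[i|j] _ ->]; [left|right]; apply: imset_f.
    by case=> /imsetP[i _ ->]; [exists (inl i)|exists (inr i)].
pose f (u : 'I_#|P| + 'I_#|Q|) : T :=
  match u with inl i => enum_val i | inr j => enum_val j end.
have fP i : f (inl i) \in P by exact: enum_valP.
have fQ i : f (inr i) \in Q by exact: enum_valP.
have imP : P = [set f (inl i) | i : 'I_#|P|].
  apply/setP=> x; apply/idP/imsetP=> [xA|[i _ ->]] //.
  by exists (enum_rank_in xA x); rewrite ?inE //= enum_rankK_in.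
have imQ : Q = [set f (inr i) | i : 'I_#|Q|].
  apply/setP=> x; apply/idP/imsetP=> [xA|[i _ ->]] //.
  by exists (enum_rank_in xA x); rewrite ?inE //= enum_rankK_in.
exists f; split=> //; split.
- move=> [i|i] [j|j] E.
  + by congr inl; apply: enum_val_inj.
  + by have := disjoint_notin d (fP i); rewrite E fQ.
  + by have := disjoint_notin d (fP j); rewrite -E fQ.
  + by congr inr; apply: enum_val_inj.
- apply/setP=> x; rewrite inE; apply/imsetP/orP.
    by case=> [[i|j] _ ->]; [left|right].
  case=> xX.
    have /imsetP[i _ ->] : x \in [set f (inl i) | i : 'I_#|P|] by rewrite -imP.
    by exists (inl i).
  have /imsetP[i _ ->] : x \in [set f (inr i) | i : 'I_#|Q|] by rewrite -imQ.
  by exists (inr i).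
- move=> [i|i] [j|j]; rewrite [RHS]/=.
  + exact/negbTE/iP.
  + exact: k.
  + by rewrite e_sym; apply: k.
  + exact/negbTE/iQ.
Qed.

Lemma layoutP A B s1 s2 : layout e A B s1 s2 <->
  [/\ s1 != s2, ~~ e s1 s2, A :|: B = ~: [set s1; s2], [disjoint A & B] &
      anticomplete_to e A B].
Proof.
split=> [[[n i] [dAB dA dB] E a]|[n ns E d a]].
  split=> //; first by apply: i; rewrite !inE eqxx ?orbT.
  by apply/setP=> x; move/setP: E => /(_ x); rewrite !inE;
     have := disjoint_notin (z := x) dA; have := disjoint_notin (z := x) dB; rewrite !inE;
     case: (x \in A); case: (x \in B); case: (x == s1); case: (x == s2) => //= H1 H2;
     try (by have := H1 isT); try (by have := H2 isT).
split=> //; [by split=> //; exact: independent2|by split=> //; sets|].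
by sets.
Qed.

(** Partial completeness of {s1, s2} without partitions: the pair can only be divided into
    singletons, so each vertex of Y sees exactly one of s1 and s2. *)
Definition splits s1 s2 Y :=
  [/\ {in Y, forall y, e s1 y || e s2 y}, {in Y, forall y, ~~ (e s1 y && e s2 y)},
      exists2 y, y \in Y & e s1 y & exists2 y, y \in Y & e s2 y].

Lemma partially_complete_splits_aux s1 s2 (X1 X2 Y1 Y2 Y : {set T}) : s1 \in X1 -> s2 \in X2 ->
  split_in_two Y Y1 Y2 -> complete_to e X1 Y1 -> complete_to e X2 Y2 ->
  anticomplete_to e X1 Y2 -> anticomplete_to e X2 Y1 -> splits s1 s2 Y.
Proof.
move=> s1X s2X [/set0Pn[y1 y1Y] /set0Pn[y2 y2Y] d <-] c1 c2 n1 n2; split.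
- by move=> y; rewrite inE => /orP[/(c1 _ _ s1X)->|/(c2 _ _ s2X)->]; rewrite ?orbT.
- move=> y; rewrite inE => /orP[/(n2 _ _ s2X)/negbTE->|/(n1 _ _ s1X)/negbTE->] //.
  by rewrite andbF.
- by exists y1; [rewrite inE y1Y|apply: c1].
- by exists y2; [rewrite inE y2Y orbT|apply: c2].
Qed.

Lemma partially_complete_splits s1 s2 Y : s1 != s2 ->
  partially_complete_to e [set s1; s2] Y <->
  [disjoint [set s1; s2] & Y] /\ splits s1 s2 Y.
Proof.
move=> n; split=> [[d _ _ [X1 [X2 [Y1 [Y2 [sX sY [c1 c2] [n1 n2]]]]]]]|[d [ca ex [y1 y1Y s1y1] [y2 y2Y s2y2]]]].
  split=> //; have [/set0Pn[x1 x1X] /set0Pn[x2 x2X] dX EX] := sX.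
  have : s1 \in X1 :|: X2 by rewrite EX !inE eqxx.
  have h1 : x1 \in [set s1; s2] by rewrite -EX inE x1X.
  have h2 : x2 \in [set s1; s2] by rewrite -EX inE x2X orbT.
  (* The part containing s1 may be numbered first or second. *)
  rewrite inE => /orP[s1X|s1X].
    have s2X : s2 \in X2.
      move: h2; rewrite !inE => /orP[] /eqP E; last by rewrite -E.
      by have := disjoint_notin dX s1X; rewrite -E x2X.
    exact: (partially_complete_splits_aux s1X s2X sY).
  have s2X : s2 \in X1.
    move: h1; rewrite !inE => /orP[] /eqP E; last by rewrite -E.
    by have := disjoint_notin dX x1X; rewrite E s1X.
  have sY' : split_in_two Y Y2 Y1.
    by case: sY => y1 y2 dY E; split=> //; [rewrite disjoint_sym|rewrite setUC].
  exact: (partially_complete_splits_aux s1X s2X sY').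
have nxor y : y \in Y -> e s2 y = ~~ e s1 y.
  by move=> yY; have := ca y yY; have := ex y yY; case: (e s1 y); case: (e s2 y).
split=> //; first by rewrite cards2 n.
  apply/card_gt1P; exists y1, y2; split=> //.
  by apply: contraTneq s2y2 => <-; rewrite nxor // s1y1.
exists [set s1], [set s2], [set y in Y | e s1 y], [set y in Y | ~~ e s1 y]; split.
- split; [by apply/set0Pn; exists s1; rewrite inE|by apply/set0Pn; exists s2; rewrite inE| |by []].
  by sets.
- split.
  + by apply/set0Pn; exists y1; rewrite inE y1Y.
  + by apply/set0Pn; exists y2; rewrite inE y2Y -nxor.
  + by apply: disjointI => y; rewrite !inE => /andP[_ ->]; rewrite andbF.
  + by apply/setP=> y; rewrite !inE -andb_orr orbN andbT.
- by split=> x y; rewrite !inE => /eqP -> /andP[yY] //; rewrite nxor.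
- by split=> x y; rewrite !inE => /eqP -> /andP[yY] //; rewrite nxor // negbK.
Qed.

Lemma gadgetA_types A s1 s2 : s1 \notin A -> s2 \notin A ->
  gadgetA e A (nbr e s1 A) (nbr e s2 A) <->
  exists2 q, 1 <= q & A_clique e q A s1 s2 \/ A_biclique e q A s1 s2.
Proof.
move=> s1A s2A; split.
  case=> [[k o A0 E1 E2]|[b E N EA]].
    exists #|A|./2.
      by move: A0 o; rewrite -card_gt0; case: #|A| => [|[|]].
    left; split.
      by apply/induces_KnP; split=> //; rewrite mul2n even_halfK.
    move=> x y; rewrite !inE => /orP[] /eqP -> yA.
      by move: yA; rewrite -{1}E1 inE => /andP[].
    by move: yA; rewrite -{1}E2 inE => /andP[].
  exists #|nbr e s1 A|; first by rewrite card_gt0.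
  right; exists (nbr e s1 A), (nbr e s2 A); have [d _ _ _] := b; split.
  - by apply/induces_KmnP.
  - by move=> x y; rewrite !inE => /eqP -> /andP[].
  - by move=> x y; rewrite !inE => /eqP -> /andP[].
  - move=> x y /set1P -> yN; have yA : y \in A by rewrite EA inE yN orbT.
    by have := disjoint_notin (z := y) d; rewrite !inE yA /= => H; apply/negP=> /H; move: yN; rewrite inE => /andP[_ ->].
  - move=> x y /set1P -> yN; have yA : y \in A by rewrite EA inE yN.
    have := disjoint_notin d yN; by rewrite !inE yA.
case=> q q1 [[/induces_KnP[k cA] c]|[P [Q [/induces_KmnP[b EA cP cQ] c1 c2 n1 n2]]]].
  left; split=> //.
  - by rewrite cA mul2n odd_double.
  - by rewrite -card_gt0 cA; lia.
  - by apply/setP=> x; rewrite inE; case xA: (x \in A) => //=; apply: c; rewrite ?inE ?eqxx.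
  - by apply/setP=> x; rewrite inE; case xA: (x \in A) => //=; apply: c; rewrite ?inE ?eqxx ?orbT.
have E1 : nbr e s1 A = P.
  apply/setP=> x; rewrite inE EA inE; have [xP|xP] := boolP (x \in P).
    by rewrite c1 ?inE.
  by have [xQ|//] := boolP (x \in Q); apply/negbTE/n1; rewrite ?inE.
have E2 : nbr e s2 A = Q.
  apply/setP=> x; rewrite inE EA inE; have [xQ|xQ] := boolP (x \in Q).
    by rewrite orbT c2 ?inE.
  by rewrite orbF; have [xP|//] := boolP (x \in P); apply/negbTE/n2; rewrite ?inE.
right; rewrite E1 E2; split=> //; first by rewrite cP cQ.
by rewrite -card_gt0 cP.
Qed.

Lemma gadgetB_types B s1 s2 : s1 != s2 -> s1 \notin B -> s2 \notin B ->
  gadgetB e B (nbr e s1 B :|: nbr e s2 B) /\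
  [/\ [disjoint nbr e s1 B & nbr e s2 B], nbr e s1 B != set0 & nbr e s2 B != set0] <->
  exists2 p, 1 <= p & B_clique e p B s1 s2 \/ B_biclique e p B s1 s2.
Proof.
move=> n s1B s2B; set D := _ :|: _.
have inD y : (y \in D) = (y \in B) && (e s1 y || e s2 y) by rewrite !inE -andb_orr.
split.
  case=> gB [d /set0Pn[y1 y1N] /set0Pn[y2 y2N]].
  have sp : splits s1 s2 D.
    split; first by move=> y; rewrite inD => /andP[].
    - move=> y; rewrite inD => /andP[yB _]; apply/negP=> /andP[h1 h2].
      by have := disjoint_notin (z := y) d; rewrite !inE yB h1 h2 => /(_ isT).
    - by exists y1; [rewrite inE y1N|move: y1N; rewrite inE => /andP[]].
    - by exists y2; [rewrite inE y2N orbT|move: y2N; rewrite inE => /andP[]].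
  have dD : [disjoint [set s1; s2] & D].
    have sD : D \subset B by apply/subsetP=> y; rewrite inD => /andP[].
    clearbody D; sets.
  case: gB => [[k o B3 E]|[P [b E P0 EB]]].
    exists #|B|./2; first by move: B3; case: #|B| => [|[|]].
    left; split; last by apply/partially_complete_splits => //; rewrite -E.
    by apply/induces_KnP; split=> //; rewrite mul2n -{1}(odd_double_half #|B|) o.
  exists #|P|; first by rewrite card_gt0.
  right; exists P, D; split; [by apply/induces_KmnP|by apply/partially_complete_splits|].
  have [dP _ _ _] := b.
  move=> x y /set2P xs yP; have := disjoint_notin dP yP; rewrite inD EB inE yP /= negb_or => /andP[h1 h2].
  by case: xs => ->.
case=> p p1 [[/induces_KnP[k cB] /(partially_complete_splits _ n)[dS sp]]|
             [P [Q [/induces_KmnP[b EB cP cQ] /(partially_complete_splits _ n)[dS sp] nP]]]].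
  have ED : D = B.
    apply/setP=> y; rewrite inD; case yB: (y \in B) => //=.
    by case: sp => h _ _ _; apply: h.
  case: sp => _ ex [y1 y1B s1y1] [y2 y2B s2y2]; split.
    by left; split; rewrite ?ED // cB mul2n ?oddS ?odd_double // ltnS; lia.
  split.
  - by apply: disjointI => y; rewrite !inE => /andP[yB h1] /andP[_ h2]; have := ex y yB; rewrite h1 h2.
  - by apply/set0Pn; exists y1; rewrite inE y1B.
  - by apply/set0Pn; exists y2; rewrite inE y2B.
have ED : D = Q.
  apply/setP=> y; rewrite inD EB inE; have [yQ|yQ] := boolP (y \in Q).
    by rewrite orbT; case: sp => h _ _ _; apply: h.
  rewrite orbF; have [yP|//] := boolP (y \in P).
  by rewrite (negbTE (nP s1 y _ yP)) ?(negbTE (nP s2 y _ yP)) // !inE eqxx ?orbT.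
have sQ : Q \subset B by rewrite EB; sets.
case: sp => _ ex [y1 y1Q s1y1] [y2 y2Q s2y2]; split.
  by right; exists P; rewrite ED; split=> //; [rewrite cP cQ|rewrite -card_gt0 cP].
split.
- apply: disjointI => y; rewrite !inE => /andP[yB h1] /andP[_ h2].
  have yQ : y \in Q by rewrite -ED inD yB h1.
  by have := ex y yQ; rewrite h1 h2.
- by apply/set0Pn; exists y1; rewrite inE s1y1 (subsetP sQ).
- by apply/set0Pn; exists y2; rewrite inE s2y2 (subsetP sQ).
Qed.

Lemma gadget_family_types :
  gadget_family e <-> [\/ typeI e, typeII e, typeIII e | typeIV e].
Proof.
split.
  move=> [s1 [s2 [A [B [c ns12 gA gB d]]]]].
  have [n12 AB dAB aAB _] := c.
  have L : layout e A B s1 s2 by apply/layoutP.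
  have s1A : s1 \notin A by sets. have s2A : s2 \notin A by sets.
  have s1B : s1 \notin B by sets. have s2B : s2 \notin B by sets.
  have [q q1 hA] := (gadgetA_types s1A s2A).1 gA.
  have [p p1 hB] := (gadgetB_types n12 s1B s2B).1 (conj gB d).
  by case: hA => hA; case: hB => hB; [constructor 1|constructor 3|constructor 2|constructor 4];
    exists A, B, s1, s2, p, q.
have main A B s1 s2 p q : 1 <= p -> 1 <= q -> layout e A B s1 s2 ->
    A_clique e q A s1 s2 \/ A_biclique e q A s1 s2 ->
    B_clique e p B s1 s2 \/ B_biclique e p B s1 s2 -> gadget_family e.
  move=> p1 q1 /layoutP[n12 ns AB dAB aAB] hA hB.
  have s1A : s1 \notin A by sets. have s2A : s2 \notin A by sets.
  have s1B : s1 \notin B by sets. have s2B : s2 \notin B by sets.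
  have gA : gadgetA e A (nbr e s1 A) (nbr e s2 A) by apply/gadgetA_types => //; exists q.
  have [gB d] : gadgetB e B (nbr e s1 B :|: nbr e s2 B) /\
     [/\ [disjoint nbr e s1 B & nbr e s2 B], nbr e s1 B != set0 & nbr e s2 B != set0].
    by apply/gadgetB_types => //; exists p.
  exists s1, s2, A, B; split=> //; split=> //; split; last exact: gadgetB_odd gB.
  case/set0Pn: (gadgetA_ne gA) => a; rewrite inE => /andP[aA _].
  by apply/set0Pn; exists a.
by case=> -[A [B [s1 [s2 [p [q [p1 q1 L hA hB]]]]]]]; apply: (main A B s1 s2 p q) => //; auto.
Qed.

(** The clique left after removing a1 and a2 has 2q - 2 vertices, so A has 2q, and q at least 3
    becomes |A| at least 6. *)
Lemma typeV_spike_cut : typeV e <->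
  exists s1 s2 b A a1 a2 w, spike_cut e s1 s2 b A a1 a2 w.
Proof.
split.
  move=> [A [b [s1 [s2 [a1 [a2 [w [q [q3 /layoutP[n12 ns AB dAB aAB] [sI u] [/induces_KnP[k cK] iI cI] [N1 N2]]]]]]]]]].
  exists s1, s2, b, A, a1, a2, w.
  have [d12 d1w d2w] : [/\ a1 != a2, a1 != w & a2 != w].
    by move: u; rewrite /= !inE negb_or andbT => /andP[/andP[-> ->] ->].
  have a1A : a1 \in A by sets. have a2A : a2 \in A by sets. have wA : w \in A by sets.
  have sI2 : [set a1; a2] \subset A by sets.
  have cA : #|A| = 2 * q.
    have := cardsID [set a1; a2] A; rewrite (setIidPr sI2) cK cards2 d12; clear - q3; lia.
  have bA : b \notin A by sets.
  have inN s x (N : {set T}) : neighbourhood e s = N -> e s x = (x \in N).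
    by move=> <-; rewrite inE.
  split.
  - split=> //; split; last by rewrite cards1.
    by apply/set0Pn; exists w.
  - by split; rewrite // ?(inN _ _ _ N1) ?(inN _ _ _ N2) !inE eqxx.
  - by [].
  - move=> x xA; rewrite (inN _ _ _ N1) (inN _ _ _ N2) !inE.
    by have [E|_] := eqVneq x b; first by rewrite -E xA in bA.
  split=> //.
  - by rewrite cA mul2n odd_double.
  - by rewrite cA; clear - q3; lia.
  move=> x y xA yA nxy xy.
  have one z t : z \in A -> t \in A -> z != t -> ~~ e z t -> z \in [set a1; a2; w].
    move=> zA tA nzt zt; apply/negPn/negP=> zI.
    have [tI|tI] := boolP (t \in [set a1; a2; w]).
      by move: zt; rewrite e_sym cI // inE zI.
    by move: zt; rewrite k //; sets.
  split; first exact: (one x y).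
  by apply: (one y x) => //; rewrite 1?eq_sym 1?e_sym.
move=> [s1 [s2 [b [A [a1 [a2 [w g]]]]]]].
have [c [ns s1b s2b] [[a1A a2A wA] [d12 d1w d2w]] N [o c6 iI K]] := g.
have [n12 AB dAB aAB _] := c.
exists A, b, s1, s2, a1, a2, w, #|A|./2.
have E : #|A|./2.*2 = #|A| by rewrite even_halfK.
have sI2 : [set a1; a2] \subset A by sets.
split.
- by move: E c6; clear; lia.
- by apply/layoutP.
- split; first by sets.
  by rewrite /= !inE negb_or d12 d1w d2w.
- split=> //.
    apply/induces_KnP; split.
      move=> x y xA yA nxy.
      have xA' : x \in A by sets. have yA' : y \in A by sets.
      apply/negPn/negP=> xy; have [xI yI] := K x y xA' yA' nxy xy.
      have Ex : x = w by move: xI xA; rewrite !inE => /orP[->//|/eqP].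
      have Ey : y = w by move: yI yA; rewrite !inE => /orP[->//|/eqP].
      by rewrite Ex Ey eqxx in nxy.
    have := cardsID [set a1; a2] A; rewrite (setIidPr sI2) cards2 d12; move: E c6; clear; lia.
  move=> x y xI yK; have xA : x \in A by sets.
  have yA : y \in A by sets.
  rewrite e_sym; apply: (spike_adj g) => //; by sets.
- have s1A : s1 \notin A by sets. have s2A : s2 \notin A by sets.
  split; apply/setP=> x; rewrite !inE.
    apply/idP/idP=> [h|/orP[/orP[]|] /eqP ->] //.
    + by have [->|[->|->]] := spike_nbr1 e_irr g h; rewrite eqxx ?orbT.
    + by have [-> _] := N a1 a1A; rewrite !inE eqxx.
    + by have [-> _] := N w wA; rewrite !inE eqxx orbT.
  apply/idP/idP=> [h|/orP[/orP[]|] /eqP ->] //.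
  + by have [->|[->|->]] := spike_nbr2 e_sym e_irr g h; rewrite eqxx ?orbT.
  + by have [_ ->] := N a2 a2A; rewrite !inE eqxx.
  + by have [_ ->] := N w wA; rewrite !inE eqxx orbT.
Qed.

Lemma family_types : family_F e <->
  gadget_family e \/ exists s1 s2 b A a1 a2 w, spike_cut e s1 s2 b A a1 a2 w.
Proof.
split.
  case=> [h|h|h|[h|h]]; [left|left|left|left|by right; apply/typeV_spike_cut];
    apply/gadget_family_types; by [constructor 1|constructor 2|constructor 3|constructor 4].
case=> [/gadget_family_types[h|h|h|h]|/typeV_spike_cut h];
  [by constructor 1|by constructor 2|by constructor 3| | ]; by constructor 4; auto.
Qed.

(** Any two vertices are joined in G - v for a third vertex v, so G is connected and no set of fewer
    than two vertices disconnects it, while {s1, s2} does. *)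
Lemma connectivity2 : fc e -> (forall v, conn e (~: [set v])) ->
  forall s1 s2 A B, cut e s1 s2 A B -> has_connectivity e 2.
Proof.
move=> FC TC s1 s2 A B c; have [n12 AB dAB aAB [A0 oB]] := c.
have TV v : connected_on e (~: [set v]).
  have [/forall_inP H|] := boolP [forall x in ~: [set v], [forall y in ~: [set v], connect (induced e (~: [set v])) x y]].
    by move=> x y xX yX; apply: (forall_inP (H x xX)).
  move=> nH; exfalso; have /(not_connectedP e_sym) : ~ connected_on e (~: [set v]).
    move=> H; case/negP: nH; apply/forall_inP=> x xX; apply/forall_inP=> y yX; exact: H.
  by move=> [C [cC C0 CX]]; case/eqP: CX; apply: (TC v).
have T3 x y : exists v, (v != x) && (v != y).
  have [z zn] : exists z, z \notin [set x; y].
    apply/existsP; rewrite -negb_forall; apply/negP=> /forallP H.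
    have sub : [set: T] \subset [set x; y] by apply/subsetP=> z _; apply: H.
    have := subset_leq_card sub; rewrite cardsT cards2.
    have ev : ~~ odd #|A| := cut_evA e_sym e_irr FC c.
    have cT : #|T| = #|A| + #|B| + 2.
      rewrite -(cardsC [set s1; s2]) cards2 n12 -AB cardsU disjoint_setI0 // cards0; clear; lia.
    have : 0 < #|B| by case: #|B| oB.
    have : 0 < #|A| by rewrite card_gt0.
    rewrite cT; clear; case: (x != y); lia.
  by exists z; move: zn; rewrite !inE negb_or.
have TT : connected_on e [set: T].
  move=> x y _ _; have [v /andP[vx vy]] := T3 x y.
  have h : connect (induced e (~: [set v])) x y.
    by apply: TV; rewrite !inE eq_sym.
  apply: connect_sub h => a b /and3P[_ _ ab]; apply: connect1.
  by rewrite /induced /= !inE ab.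
split=> //.
  exists [set s1; s2]; last by rewrite cards2 n12.
  apply/(not_connectedP e_sym); exists A; split=> //.
    split; first by rewrite -AB; sets.
    by rewrite -AB => x y xA; rewrite !inE => /andP[/negbTE-> /= yB]; apply: aAB.
  apply/eqP=> E; have /set0Pn[b bB] : B != set0 by rewrite -card_gt0; case: #|B| oB.
  have : b \in A by rewrite E -AB inE bB orbT.
  by move=> bA; have := disjoint_notin dAB bA; rewrite bB.
move=> X dX; rewrite leqNgt; apply/negP=> X2; apply: dX.
have [->|/set0Pn[v vX]] := eqVneq X set0; first by rewrite setC0.
suff -> : X = [set v] by [].
by apply/setP=> z; rewrite inE; apply/idP/eqP=> [zX|->//]; apply: (card_le1_eq _ zX vX).
Qed.

Lemma family_sufficient : family_F e ->
  [/\ factor_critical e, edge_critical_equimatchable e & has_connectivity e 2].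
Proof.
have wrap s1 s2 A B : cut e s1 s2 A B -> fc e -> eqm e -> crit e ->
    (forall v, conn e (~: [set v])) ->
    [/\ factor_critical e, edge_critical_equimatchable e & has_connectivity e 2].
  move=> c FC EQ CR TC; have FC' : factor_critical e by apply/fcP.
  by split=> //; [apply/(edge_criticalP e_sym e_irr s1)|apply: (connectivity2 FC TC c)].
case/family_types=> [[s1 [s2 [A [B g]]]]|[s1 [s2 [b [A [a1 [a2 [w g]]]]]]]].
  have [c _ _ _ _] := g; apply: (wrap s1 s2 A B c).
  - exact: (gadget_cut_fc e_sym e_irr g).
  - exact: (gadget_cut_eqm e_sym e_irr g).
  - exact: (gadget_cut_crit e_sym e_irr g).
  - by move=> v; exact: (gadget_cut_conn e_sym g).
have [c _ _ _ _] := g; apply: (wrap s1 s2 A [set b] c).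
- exact: (spike_cut_fc e_sym e_irr g).
- exact: (spike_cut_eqm e_sym e_irr g).
- exact: (spike_cut_crit e_sym e_irr g).
- by move=> v; exact: (spike_cut_conn e_sym g).
Qed.

Lemma family_necessary : factor_critical e -> edge_critical_equimatchable e ->
  has_connectivity e 2 -> family_F e.
Proof.
move=> /[dup] FC' /fcP FC EC [cT [S dS cS] min].
have /cards2P[s1 [s2 [n12 ES]]] : #|S| == 2 by apply/eqP.
have [EQ CR] := (edge_criticalP e_sym e_irr s1 FC').1 EC.
have TC v : conn e (~: [set v]).
  move=> C cC C0; apply/eqP; apply/negPn/negP=> CX.
  have : disconnects e [set v] by apply/(not_connectedP e_sym); exists C.
  by move/min; rewrite cards1.
apply/family_types; rewrite {S}ES in dS cS.
have [C [[sC aC] C0 CX]] := (not_connectedP e_sym _).1 dS.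
have oT := odd_order e_irr FC s1.
(* Outside s1 and s2 the order is odd, so exactly one of C and its complement there is odd; that one
   becomes B. *)
have [A [B c]] : exists A B, cut e s1 s2 A B.
  set D := ~: [set s1; s2] :\: C in aC.
  have EU : C :|: D = ~: [set s1; s2] by rewrite /D; sets.
  have dCD : [disjoint C & D] by rewrite /D; sets.
  have D0 : D != set0.
    by rewrite setD_eq0; apply: contra CX => DC; rewrite eqEsubset sC.
  have odd2 : odd (#|C| + #|D|).
    have := cardsC [set s1; s2]; rewrite cards2 n12 -EU cardsU disjoint_setI0 // cards0 subn0.
    by move=> E; move: oT; rewrite -E oddD.
  move: odd2; rewrite oddD; have [oC|oC] := boolP (odd #|C|).
    move=> _; exists D, C; split=> //; [by rewrite setUC|by rewrite disjoint_sym|exact: anticomplete_sym].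
  by move=> oD; exists C, D; split.
have [B3|B3] := leqP 3 #|B|.
  left; exact: (cut_gadgets e_sym e_irr FC EQ CR TC c B3).
have [b EB] : exists b, B = [set b].
  apply/cards1P; have [_ _ _ _ [_ oB]] := c.
  by move: B3 oB; case: #|B| => [|[|[|]]].
rewrite {B}EB in c B3.
(* The given cut isolates b, but another one may have a large odd side; type V is forced only if
   none has. *)
have [[t1 [t2 [A' [B' [c' B'3]]]]]|small] := cut_dec e.
  left; exact: (cut_gadgets e_sym e_irr FC EQ CR TC c' B'3).
right; have pd := cut_pendant e_sym e_irr FC EQ CR TC small c.
have [a1 [a2 [w [[a1A a2A wA] [d12 d1w d2w] [i12 i1w i2w] N [c6 K]]]]] := pendant_spike e_sym e_irr pd.
exists s1, s2, b, A, a1, a2, w; split=> //.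
- split; first exact: (s1s2_nonadj e_sym e_irr CR TC c).
    exact: (adj_s1b e_sym TC c).
  exact: (adj_s1b e_sym TC (cut_sym c)).
- split=> //; first exact: (cut_evA e_sym e_irr FC c).
  exact: independent3.
Qed.

End Types.

Theorem theorem4p9 (T : finType) (e : rel T)
    (e_sym : symmetric e) (e_irr : irreflexive e) :
  [/\ factor_critical e, edge_critical_equimatchable e & has_connectivity e 2]
  <-> family_F e.
Proof.
split; last exact: family_sufficient.
by case=> FC EC HC; apply: family_necessary.
Qed.
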